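(* Let $1<p<\infty$, $0<\alpha<\frac{\gamma}{p}$, $p<q<\infty$, $b\in BMO_P(\mathbb{R}^n)$, and let $\varphi(x,t)$ be a positive measurable function on $\mathbb{R}^n\times(0,\infty)$ satisfying $$\sup_{r<t<\infty}t^{-\gamma}\left(1+\ln\frac tr\right)^{p}\operatorname*{ess\,inf}_{t<\tau<\infty}\varphi(x,\tau)\,\tau^{\gamma}\le C\varphi(x,r)$$ and $$\int_r^\infty\left(1+\ln\frac tr\right)t^{\alpha}\varphi(x,t)^{\frac1p}\,\frac{dt}{t}\le C r^{-\frac{\alpha p}{q-p}},$$ where $C$ does not depend on $x\in\mathbb{R}^n$ and $r>0$. Then the operators $M^P_{b,\alpha}$ and $[b,I^P_{\alpha}]$ are bounded from $M_{p,\varphi^{1/p},P}$ to $M_{q,\varphi^{1/q},P}$.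
   Context: Setting. $n\ge2$; $P$ is a real $n\times n$ matrix all of whose eigenvalues have positive real part; $A_t=t^P$ ($t>0$); $\gamma=\operatorname{tr}P$. $\rho$ is a quasi-distance associated with $P$: $\rho(A_tx)=t\rho(x)$ for $t>0$, $x\in\mathbb{R}^n$; $\rho(0)=0$, $\rho(x-y)=\rho(y-x)\ge0$ (with $\rho(x)>0$ for $x\neq0$), and $\rho(x-y)\le k(\rho(x-z)+\rho(y-z))$ for a constant $k$; and $dx=\rho^{\gamma-1}d\sigma(w)\,d\rho$ where $\rho=\rho(x)$, $w=A_{\rho^{-1}}x$ and $d\sigma(w)$ is a measure on $\{w:\rho(w)=1\}$. The ellipsoid is $E(x,r)=\{y\in\mathbb{R}^n:\rho(x-y)<r\}$; its Lebesgue measure is $|E(x,r)|=\upsilon_\rho r^\gamma$, where $\upsilon_\rho$ is the volume of the unit ellipsoid. $BMO_P(\mathbb{R}^n)$: the $b\in L_1^{loc}(\mathbb{R}^n)$ with $\|b\|_*=\sup_{x\in\mathbb{R}^n,\,r>0}\frac1{|E(x,r)|}\int_{E(x,r)}|b(y)-b_{E(x,r)}|\,dy<\infty$, where $b_{E(x,r)}=\frac1{|E(x,r)|}\int_{E(x,r)}b(y)\,dy$. Operators: $M^P_{b,\alpha}f(x)=\sup_{t>0}|E(x,t)|^{-1+\frac{\alpha}{\gamma}}\int_{E(x,t)}|b(x)-b(y)||f(y)|\,dy$ and $[b,I^P_{\alpha}]f(x)=\int_{\mathbb{R}^n}[b(x)-b(y)]\frac{f(y)}{\rho(x-y)^{\gamma-\alpha}}\,dy$.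 Spaces. For $\psi(x,r)$ positive measurable on $\mathbb{R}^n\times(0,\infty)$ and $1\le p<\infty$, $M_{p,\psi,P}$ is the set of $f\in L_p^{loc}(\mathbb{R}^n)$ with $\|f\|_{M_{p,\psi,P}}=\sup_{x\in\mathbb{R}^n,\,r>0}\psi(x,r)^{-1}|E(x,r)|^{-1/p}\|f\|_{L_p(E(x,r))}<\infty$. $\varphi^{1/p}$ denotes the function $\varphi(x,r)^{1/p}$. Bounded means the norm inequality $\|Tf\|\le C\|f\|$ with $C$ independent of $f$. *)

(* Defs.v *)
From HB Require Import structures.
From mathcomp Require Import all_boot all_order all_algebra.
From mathcomp Require Import all_classical all_reals all_analysis.
From mathcomp Require Import measurable_realfun ess_sup_inf complex.
Import Order.TTheory GRing.Theory Num.Theory.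
Import numFieldNormedType.Exports.

Set Implicit Arguments.
Unset Strict Implicit.
Unset Printing Implicit Defensive.

Local Open Scope classical_set_scope.
Local Open Scope ring_scope.

(* Points of R^n are column vectors.  The sigma-algebra is the one generated by
   the coordinates, i.e. the Borel one. *)
Section borel_cV.
Context {R : realType} (n : nat).

Let coors : 'I_n -> 'cV[R]_n -> R := fun i x => x i ord0.

Let cV_set0 : g_sigma_preimage coors set0.
Proof. exact: sigma_algebra0. Qed.

Let cV_setC A : g_sigma_preimage coors A -> g_sigma_preimage coors (~` A).
Proof. exact: sigma_algebraC. Qed.

Let cV_bigcup (F : _^nat) : (forall i, g_sigma_preimage coors (F i)) ->
  g_sigma_preimage coors (\bigcup_i (F i)).
Proof. exact: sigma_algebra_bigcup. Qed.

HB.instance Definition _ := @isMeasurable.Build default_measure_display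
  'cV[R]_n (g_sigma_preimage coors) cV_set0 cV_setC cV_bigcup.

End borel_cV.

Lemma measurable_coord {R : realType} n (i : 'I_n) :
  measurable_fun [set: 'cV[R]_n] (fun x : 'cV[R]_n => x i ord0).
Proof.
move=> _ Y mY; rewrite setTI; apply: sub_sigma_algebra => /=.
rewrite -bigcup_seq/=; exists i => /=; first by rewrite mem_index_enum.
by exists Y => //; rewrite setTI.
Qed.

Lemma measurable_fun_coordP {R : realType} d (T : measurableType d) n
    (f : T -> 'cV[R]_n) :
  (forall i, measurable_fun [set: T] (fun t => f t i ord0)) ->
  measurable_fun [set: T] f.
Proof.
move=> mf _ Y mY; rewrite setTI.
suff: g_sigma_preimage (fun (i : 'I_n) (x : 'cV[R]_n) => x i ord0)
    `<=` [set A | measurable (f @^-1` A)] by exact.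
apply: smallest_sub.
  split => /=; first by rewrite preimage_set0.
  - by move=> A mA; rewrite setTD preimage_setC; exact: measurableC.
  - by move=> F mF; rewrite preimage_bigcup; exact: bigcupT_measurable.
rewrite -bigcup_seq; apply: bigcup_sub => i _ A [B mB <-] /=.
by have := mf i measurableT B mB; rewrite !setTI.
Qed.

Section lebesgue_measure_cV.
Context {R : realType}.

Definition vcons n (z : (measurableTypeR R * 'cV[R]_n)%type) : 'cV[R]_n.+1 :=
  col_mx (z.1 : R)%:M z.2.

Definition vuncons n (x : 'cV[R]_n.+1) : (measurableTypeR R * 'cV[R]_n)%type :=
  (x ord0 ord0, dsubmx (x : 'M[R]_(1 + n, 1))).

Lemma vconsK n : cancel (@vcons n) (@vuncons n).
Proof.
move=> [a v]; rewrite /vcons /vuncons col_mxKd; congr pair.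
by rewrite mxE; case: splitP => // j _; rewrite mxE !ord1 eqxx mulr1n.
Qed.

Lemma vunconsK n : cancel (@vuncons n) (@vcons n).
Proof.
move=> x; rewrite /vcons /vuncons /=; apply/matrixP => i j.
rewrite !mxE !ord1; case: splitP => k ik; rewrite !mxE.
  rewrite !ord1 eqxx mulr1n; congr (x _ _).
  by apply: val_inj; rewrite /= ik ord1.
by congr (x _ _); apply: val_inj; rewrite /= ik.
Qed.

Lemma measurable_vcons n : measurable_fun setT (@vcons n).
Proof.
apply: measurable_fun_coordP => i.
rewrite (_ : (fun t => _) = (fun t : (measurableTypeR R * 'cV[R]_n)%type =>
    match fintype.split (i : 'I_(1 + n)) with
  | inl _ => t.1 : R | inr k => t.2 k ord0 end)); last first.
  apply/funext => t; rewrite /vcons mxE; case: fintype.split => j //.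
  by rewrite mxE !ord1 mulr1n.
case: fintype.split => j; first exact: measurable_fst.
exact: (measurableT_comp (measurable_coord j) measurable_snd).
Qed.

Lemma measurable_vuncons n : measurable_fun setT (@vuncons n).
Proof.
apply/measurable_fun_pair; first exact: measurable_coord.
apply: measurable_fun_coordP => i.
rewrite (_ : (fun t => _) = fun t : 'cV[R]_n.+1 =>
  t (rshift 1 i : 'I_n.+1) ord0); first exact: measurable_coord.
by apply/funext => x; rewrite mxE.
Qed.

Section step.
Variables (n : nat) (m : {sigma_finite_measure set 'cV[R]_n -> \bar R}).

(* R^(n+1) is identified with R x R^n, the latter carrying product measure. *)
Definition lebesgue_step : set 'cV[R]_n.+1 -> \bar R :=
  pushforward (@lebesgue_measure R \x m)%E (@vcons n).

Let step0 : lebesgue_step set0 = 0%E.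
Proof. by rewrite /lebesgue_step /pushforward preimage_set0 measure0. Qed.

Let step_ge0 A : (0 <= lebesgue_step A)%E.
Proof. by rewrite /lebesgue_step /pushforward; apply: measure_ge0. Qed.

Let step_sigma_additive : semi_sigma_additive lebesgue_step.
Proof.
pose m' : {measure set 'cV[R]_n.+1 -> \bar R} :=
  measure_function_pushforward__canonical__measure_function_Measure
    (@lebesgue_measure R \x m)%E (@measurable_vcons n).
exact: (@measure_semi_sigma_additive _ _ _ m').
Qed.

HB.instance Definition _ := isMeasure.Build _ _ _ lebesgue_step
  step0 step_ge0 step_sigma_additive.

Let step_sigma_finite : sigma_finite setT lebesgue_step.
Proof.
have /sigma_finiteP[F [TF ndF Foo]] := sigma_finiteT (@lebesgue_measure R).
have /sigma_finiteP[G [TG ndG Goo]] := sigma_finiteT m.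
exists (fun k => @vuncons n @^-1` (F k `*` G k)).
  rewrite -preimage_bigcup; apply/esym/seteqP; split => // x _ /=.
  have [i _ Fi] : (\bigcup_i F i) (vuncons x).1 by rewrite -TF.
  have [j _ Gj] : (\bigcup_i G i) (vuncons x).2 by rewrite -TG.
  exists (maxn i j) => //; split.
    by move: Fi; exact/subsetPset/ndF/leq_maxl.
  by move: Gj; exact/subsetPset/ndG/leq_maxr.
move=> k; have [mF Fk] := Foo k; have [mG Gk] := Goo k.
have mFG : measurable (F k `*` G k) by exact: measurableX.
split; first by rewrite -[X in measurable X]setTI; exact: measurable_vuncons.
rewrite /lebesgue_step /pushforward -comp_preimage.
rewrite (_ : _ \o _ = idfun); last by apply/funext => z /=; rewrite vconsK.
by rewrite preimage_id product_measure1E// lte_mul_pinfty// ge0_fin_numE.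
Qed.

HB.instance Definition _ := Measure_isSigmaFinite.Build _ _ _ lebesgue_step
  step_sigma_finite.
End step.

Fixpoint lebesgue_cV n : {sigma_finite_measure set 'cV[R]_n -> \bar R} :=
  match n with
  | 0 => \d_(0 : 'cV[R]_0)
  | k.+1 => lebesgue_step (lebesgue_cV k)
  end.
End lebesgue_measure_cV.

Section anisotropic.
Context {R : realType} (n : nat).
Local Notation V := ('cV[R]_n).
Local Notation leb := (@lebesgue_cV R n).

Definition mxexp (A : 'M[R]_n) : 'M[R]_n :=
  limn (series (fun k => k`!%:R^-1 *: A ^+ k)).

(* t^P = exp((ln t) P) *)
Definition dilation (P : 'M[R]_n) (t : R) : 'M[R]_n := mxexp (ln t *: P).

Definition eigenvalues_Re_gt0 (P : 'M[R]_n) :=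
  forall z : R[i], eigenvalue (map_mx (real_complex R) P) z ->
    0 < complex.Re z.

(* Measurability of rho is implicit in the polar decomposition of dx; without
   it the ellipsoids need not have a volume. *)
Record quasi_distance (P : 'M[R]_n) (rho : V -> R) : Prop := QuasiDistance {
  qd_measurable : measurable_fun [set: V] rho ;
  qd_homogeneous : forall (t : R) (x : V), 0 < t ->
    rho (dilation P t *m x) = t * rho x ;
  qd_0 : rho 0 = 0 ;
  qd_sym : forall x y : V, rho (x - y) = rho (y - x) ;
  qd_ge0 : forall x y : V, 0 <= rho (x - y) ;
  qd_gt0 : forall x : V, x != 0 -> 0 < rho x ;
  qd_triangle : exists k : R,
    forall x y z : V, rho (x - y) <= k * (rho (x - z) + rho (y - z)) ;
  qd_polar : exists sigma : {measure set V -> \bar R},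
    forall f : V -> \bar R, measurable_fun [set: V] f ->
      (forall x, (0 <= f x)%E) ->
      (\int[leb]_x f x =
       \int[lebesgue_measure]_(r in `]0%R, +oo[)
         ((\int[sigma]_(w in [set w | rho w = 1%R]) f (dilation P r *m w)) *
          (r `^ (\tr P - 1))%:E))%E }.

Section operators.
Variables (P : 'M[R]_n) (rho : V -> R).

Definition ellipsoid (x : V) (r : R) : set V := [set y | rho (x - y) < r].

Definition vol (x : V) (r : R) : R := fine (leb (ellipsoid x r)).

Definition Lploc (p : R) (g : V -> \bar R) :=
  measurable_fun [set: V] g /\
  forall K : set V, compact K -> (\int[leb]_(x in K) `|g x| `^ p < +oo)%E.

Definition mean (b : V -> R) (x : V) (r : R) : R :=
  (vol x r)^-1 * \int[leb]_(y in ellipsoid x r) b y.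

Definition bmo_norm (b : V -> R) : \bar R := ereal_sup
  [set (((vol z.1 z.2)^-1)%:E *
     \int[leb]_(y in ellipsoid z.1 z.2) `|b y - mean b z.1 z.2|%:E)%E
  | z in [set z : V * R | 0 < z.2]].

Definition BMO (b : V -> R) :=
  Lploc 1 (EFin \o b) /\ (bmo_norm b < +oo)%E.

(* Functions are [\bar R]-valued because the operators below may take infinite
   values on a null set. *)
Definition morrey_norm (p : R) (psi : V -> R -> R) (g : V -> \bar R) : \bar R :=
  ereal_sup
  [set (((psi z.1 z.2)^-1 * vol z.1 z.2 `^ (- p^-1))%:E *
     'N[leb]_p%:E[g \_ (ellipsoid z.1 z.2)])%E
  | z in [set z : V * R | 0 < z.2]].

Definition morrey (p : R) (psi : V -> R -> R) (g : V -> \bar R) :=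
  Lploc p g /\ (morrey_norm p psi g < +oo)%E.

Definition maximal_commutator (b : V -> R) (alpha : R) (f : V -> R) (x : V) :
    \bar R :=
  ereal_sup
  [set ((vol x t `^ (- 1 + alpha / \tr P))%:E *
     \int[leb]_(y in ellipsoid x t) (`|b x - b y| * `|f y|)%:E)%E
  | t in `]0, +oo[].

(* When the integrand is not integrable the value of [\int] is infinite, so
   membership of the image in a Morrey space entails absolute convergence for
   almost every x. *)
Definition potential_commutator (b : V -> R) (alpha : R) (f : V -> R) (x : V) :
    \bar R :=
  (\int[leb]_y
     ((b x - b y) * (f y / rho (x - y) `^ (\tr P - alpha)))%:E)%E.

Definition morrey_bounded (T : (V -> R) -> V -> \bar R)
    (p : R) (psi : V -> R -> R) (q : R) (chi : V -> R -> R) :=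
  exists C : R, forall f : V -> R, morrey p psi (EFin \o f) ->
    morrey q chi (T f) /\
    (morrey_norm q chi (T f) <= C%:E * morrey_norm p psi (EFin \o f))%E.

End operators.

Definition ess_inf_above (t : R) (g : R -> R) : \bar R :=
  ess_inf (mrestr (@lebesgue_measure R) (measurable_itv `]t, +oo[))
    (EFin \o g).

End anisotropic.

(* Main.v *)
Require Import Defs.
From HB Require Import structures.
From mathcomp Require Import all_boot all_order all_algebra.
From mathcomp Require Import all_classical all_reals all_analysis.
From mathcomp Require Import measurable_realfun ess_sup_inf.
From mathcomp Require Import ring lra.
Import Order.TTheory GRing.Theory Num.Theory.
Import numFieldNormedType.Exports.

Set Implicit Arguments.
Unset Strict Implicit.
Unset Printing Implicit Defensive.

Local Open Scope classical_set_scope.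
Local Open Scope ring_scope.

(** Write g = tr P, E(x,t) for the ellipsoids, and be = al p / (q - p). Both operators are dominated
    pointwise, up to a constant, by the positive operator [potential], with kernel |b x - b y| rho(x
    - y)^(al - g) acting on |f|. So it suffices to bound the integral over E(x0,r) of its q-th power
    by a multiple of N^q phi(x0,r) r^g, whenever the integral of |f|^p over every E(x,t) is at most
    N^p phi(x,t) t^g ([potential_morrey]).

    The conditions on phi act through two bounds on J(t), the integral of |f|^p over E(x0,t). The
    integral condition, on the range (t,2t), gives J(t) <= const N^p t^(g - p(al+be))
    ([growth_int_bound]). Since J increases, J(t) is at most N^p times the essential infimum of
    phi(x0,tau) tau^g over tau > t, and the supremum condition, iterated, shows that this infimum
    grows more slowly than t^g by a factor 2 per scale: J(L^(j+1) r) <= const 2^(-j) N^p (L^(j+1)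
    r)^g phi(x0,r) ([ess_inf_above_geometric]).

    For x in E(x0,r), split f along E(x0,Lr). On the far part, Hölder and John-Nirenberg show that
    the shell of size t = L^j r contributes at most a multiple of (|b x - beta| + j + 1) t^al
    (t^(-g) J(t))^(1/p), where beta is the mean of b. Interpolating the two bounds on J with weights
    p/q and 1 - p/q cancels t^al and leaves N phi^(1/q) 2^(-j/q), so the shells are summable
    ([far_pointwise]).

    The near part is estimated in L^q by duality. At one scale t, averaging over the centres of
    balls, Hölder and John-Nirenberg leave a product of means of f^s and h^s, where h is the test
    function and s > 1 is close to 1. The mean of f^s has two bounds, one through its maximal
    function with a factor t^al, one through the Morrey bound with a factor t^(-be); summing the
    smaller one over the scales, as in Hedberg's inequality, yields the power th = be/(al+be) = p/q
    of the first ([near_duality]). Young's inequality and the maximal theorem then bound the near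
    part by N^(q-p) times the integral of f^p over E(x0,Lr) ([near_bound]).

    The maximal theorem and the John-Nirenberg inequality are proved on a [homogeneous_space] by
    Vitali coverings with countably many balls. That ellipsoids form such a space rests on a
    Steinhaus argument, which bounds the measurable function rho locally, on the polar
    decomposition, which gives the volume law, and on a weak density statement
    ([ellipsoid_density]). *)

(** * Translation invariance of Lebesgue measure on R^n *)

Section lebesgue_translation.
Context {R : realType}.

Lemma measurable_shift1 (a : R) : measurable_fun [set: measurableTypeR R]
  (fun y : measurableTypeR R => (y + a : measurableTypeR R)).
Proof. exact: measurable_funD. Qed.

(** By uniqueness of Lebesgue measure: its image under the shift has the same values on half-open
    intervals. *)
Lemma lebesgue_measure_shift (a : R) (A : set R) : measurable A ->
  lebesgue_measure ((fun y => y + a) @^-1` A) = lebesgue_measure A.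
Proof.
move=> mA; apply/esym.
pose m' : {measure set (measurableTypeR R) -> \bar R} :=
  measure_function_pushforward__canonical__measure_function_Measure
    (@lebesgue_measure R) (measurable_shift1 a).
apply: (@lebesgue_measure_unique R m') => //= _ [[x y]] _ <-.
rewrite /m' /= /pushforward (_ : _ @^-1` _ = `]x - a, y - a]%classic).
  rewrite !lebesgue_measure_itv/= !lte_fin ltrD2r.
  by case: ifP => // _; congr (_%:E); rewrite opprB addrA subrK.
by apply/seteqP; split => t /=; rewrite !in_itv/= ltrBlDr lerBrDr.
Qed.

Lemma measurable_shift n (h : 'cV[R]_n) :
  measurable_fun [set: 'cV[R]_n] (fun y => y + h).
Proof.
apply: measurable_fun_coordP => i.
rewrite (_ : (fun _ => _) = (fun y : 'cV[R]_n => y i ord0 + h i ord0)).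
  by apply: measurable_funD => //; exact: measurable_coord.
by apply/funext => y; rewrite mxE.
Qed.

Lemma vcons_shift n (h : 'cV[R]_n.+1) (z : (measurableTypeR R * 'cV[R]_n)%type) :
  vcons z + h = vcons (z.1 + (vuncons h).1, z.2 + (vuncons h).2).
Proof.
apply/matrixP => i j; rewrite !ord1 /vcons !mxE; case: splitP => l il.
  rewrite !mxE !ord1 !mulr1n; congr (_ + h _ _).
  by apply: val_inj; rewrite /= il ord1.
by rewrite !mxE; congr (_ + h _ _); apply: val_inj; rewrite /= il.
Qed.

(** Induction on the dimension: through [vcons] a translation becomes a product of translations, and
    a product measure is determined by its values on rectangles. *)
Lemma lebesgue_cV_shift n (h : 'cV[R]_n) (A : set 'cV[R]_n) : measurable A ->
  lebesgue_cV n ((fun y => y + h) @^-1` A) = lebesgue_cV n A.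
Proof.
elim: n h A => [|n IH] h A mA.
  congr (_ _); apply/seteqP; split => y /=; last first.
    by rewrite (_ : y + h = y)//; apply/matrixP => -[].
  by rewrite (_ : y + h = y)//; apply/matrixP => -[].
rewrite /= /lebesgue_step /pushforward.
set S := fun z : (measurableTypeR R * 'cV[R]_n)%type =>
  (z.1 + (vuncons h).1 : measurableTypeR R, z.2 + (vuncons h).2).
have mS : measurable_fun setT S.
  apply/measurable_fun_pair.
    exact: (measurableT_comp (measurable_shift1 _) measurable_fst).
  exact: (measurableT_comp (measurable_shift _) measurable_snd).
have -> : vcons (n:=n) @^-1` ((fun y : 'cV_n.+1 => y + h) @^-1` A) =
    S @^-1` (vcons (n:=n) @^-1` A).
  by apply/seteqP; split => z /=; rewrite vcons_shift.
pose m' : {measure set (measurableTypeR R * 'cV[R]_n)%type -> \bar R} :=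
  measure_function_pushforward__canonical__measure_function_Measure
    (@lebesgue_measure R \x lebesgue_cV n)%E mS.
apply/esym; apply: (@product_measure_unique _ _ _ _ _ _ _ m').
- move=> B C mB mC; rewrite /m' /= /pushforward.
  have -> : S @^-1` (B `*` C) = ((fun y => y + (vuncons h).1) @^-1` B) `*`
     ((fun y => y + (vuncons h).2) @^-1` C) by [].
  rewrite product_measure1E//.
  + congr (_ * _)%E; first exact: lebesgue_measure_shift.
    exact: IH.
  + by rewrite -[X in measurable X]setTI; exact: measurable_shift1.
  + by rewrite -[X in measurable X]setTI; exact: measurable_shift.
- by rewrite -[X in measurable X]setTI; exact: measurable_vcons.
Qed.

Definition cube n (m : R) : set 'cV[R]_n := [set x | forall i, `|x i ord0| < m].

Lemma measurable_cube n m : measurable (@cube n m).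
Proof.
rewrite (_ : cube m = \bigcap_(i in [set: 'I_n])
    ((fun x : 'cV[R]_n => x i ord0) @^-1` [set y : R | `|y| < m])).
  apply: fin_bigcap_measurable => // i _; rewrite -[X in measurable X]setTI.
  apply: measurable_coord => //.
  rewrite (_ : [set _ | _] = ball (0 : R) m); last first.
    by apply/seteqP; split => y /=; rewrite /ball /= sub0r normrN.
  exact: measurable_ball.
by apply/seteqP; split => x /= xm i; [move=> _|]; exact: xm.
Qed.

Lemma lebesgue_cV_cube n (m : R) : 0 < m ->
  lebesgue_cV n (cube m) = ((m *+ 2) ^+ n)%:E.
Proof.
move=> m0; elim: n => [|n IH].
  by rewrite /= diracE mem_set// => -[].
rewrite /= /lebesgue_step /pushforward.
have -> : vcons (n:=n) @^-1` cube m = [set y : measurableTypeR R | `|y| < m] `*` cube m.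
  apply/seteqP; split => -[t v] /=.
    move=> H; split => /=.
      by have := H ord0; rewrite /vcons mxE; case: splitP => //= j _; rewrite mxE !ord1 mulr1n.
    move=> i; have := H (rshift 1 i : 'I_n.+1).
    by rewrite /vcons (col_mxEd (t%:M) v i).
  move=> [/= tm vm] i; rewrite /vcons mxE; case: splitP => j _ //=.
  by rewrite mxE !ord1 mulr1n.
have -> : [set y : R | `|y| < m] = `]-m, m[%classic.
  by apply/seteqP; split => y /=; rewrite in_itv/= ltr_norml.
rewrite product_measure1E//; last exact: measurable_cube.
rewrite IH [X in (X * _)%E](_ : _ = (m *+ 2)%:E); first by rewrite -EFinM exprS.
transitivity (lebesgue_measure `]-m, m[%classic) => //.
by rewrite lebesgue_measure_itv/= lte_fin gtrN// opprK mulr2n.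
Qed.

End lebesgue_translation.

(** * Continuity of translations in measure *)

Section translation_continuity.
Context {R : realType} (n : nat).
Local Notation V := ('cV[R]_n).
Local Notation leb := (@lebesgue_cV R n).
Implicit Types (A B : set V) (h x : V) (m : R).

Lemma cubeN m h : cube m h -> cube m (- h).
Proof. by move=> hm i; rewrite mxE normrN. Qed.

Lemma le_cube m1 m2 : m1 <= m2 -> @cube R n m1 `<=` cube m2.
Proof. by move=> m12 x xm i; exact: lt_le_trans m12. Qed.

Lemma cube_fin m : (leb (cube m) < +oo)%E.
Proof.
apply: (@le_lt_trans _ _ (leb (cube (Num.max 1 m)))).
  apply: le_measure; rewrite ?inE; try exact: measurable_cube.
  by apply: le_cube; rewrite le_max lexx orbT.
by rewrite lebesgue_cV_cube ?ltry// lt_max ltr01.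
Qed.

Lemma measurable_preshift h A : measurable A -> measurable ((fun y => y + h) @^-1` A).
Proof. by move=> mA; rewrite -[X in measurable X]setTI; exact: measurable_shift. Qed.

Lemma shrinking_set (F : nat -> set V) (e : R) :
  (forall k, measurable (F k)) -> nonincreasing_seq F ->
  (leb (F 0%N) < +oo)%E -> \bigcap_k F k = set0 -> 0 < e ->
  exists k, (leb (F k) <= e%:E)%E.
Proof.
move=> mF dF F0 F_0 e0.
have := nonincreasing_cvg_mu F0 mF.
rewrite F_0 measure0 => /(_ measurable0 dF) /fine_cvgP[_].
move=> /cvgrPdist_le /(_ e e0) [k _ /(_ k (leqnn k))] /=.
rewrite sub0r normrN ger0_norm ?fine_ge0// => H; exists k.
rewrite -(@fineK _ (leb (F k))) ?lee_fin// ge0_fin_numE//.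
apply: le_lt_trans F0; apply: le_measure; rewrite ?inE//.
exact/subsetPset/dF.
Qed.

(** The part of [A] in the cube that leaves it under the shift by [h]. Cutting by a cube keeps
    measures finite, so that continuity from above is available. *)
Definition shift_defect A m h :=
  leb ((A `&` cube m) `\` ((fun y => y + h) @^-1` (A `&` cube m))).

(** Measurability is part of the property so that the sets that have it can be shown to form a
    sigma-algebra. *)
Definition shift_continuous m A := measurable A /\ forall e : R, 0 < e ->
  exists2 d, 0 < d & forall h, cube d h -> (shift_defect A m h <= e%:E)%E.

Lemma le_shift_defect A m h B : measurable A -> measurable B ->
  (A `&` cube m) `\` ((fun y => y + h) @^-1` (A `&` cube m)) `<=` B ->
  (shift_defect A m h <= leb B)%E.
Proof.
move=> mA mB AB; apply: le_measure; rewrite ?inE//.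
have mAm : measurable (A `&` cube m) by apply: measurableI => //; exact: measurable_cube.
by apply: measurableD => //; exact: measurable_preshift.
Qed.

(** Points that leave the cube under a small shift lie in a thin shell inside its boundary, and
    these shells decrease to the empty set. *)
Lemma shift_continuous_cube m : shift_continuous m setT.
Proof.
split=> // e e0.
pose F k := cube m `\` @cube R n (m - k.+1%:R^-1).
have mF k : measurable (F k) by apply: measurableD; exact: measurable_cube.
have dF : nonincreasing_seq F.
  move=> i j ij; apply/subsetPset; apply: setDS; apply: le_cube.
  by rewrite lerD2l lerN2 lef_pV2 ?posrE// ler_nat.
have F0 : (leb (F 0%N) < +oo)%E.
  apply: le_lt_trans (cube_fin m); apply: le_measure; rewrite ?inE//.
    exact: measurable_cube.
  by move=> x [].
have FI : \bigcap_k F k = set0.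
  apply/seteqP; split => // x Fx.
  have xm i : exists k : nat, `|x i ord0| < m - k.+1%:R^-1.
    have [+ _] := Fx 0%N I => /(_ i) xi.
    have : 0 < m - `|x i ord0| by rewrite subr_gt0.
    move=> /ltr_add_invr [k]; rewrite add0r => Hk; exists k.
    by rewrite ltrBrDl -ltrBrDr.
  pose K := \max_(i < n) projT1 (cid (xm i)).
  have [_] := Fx K I; apply => i.
  case: (cid (xm i)) (leq_bigmax i : (projT1 (cid (xm i)) <= K)%N) => k /= xk kK.
  apply: lt_le_trans xk _.
  by rewrite lerD2l lerN2 lef_pV2 ?posrE// ler_nat.
have [k Hk] := shrinking_set mF dF F0 FI e0.
exists k.+1%:R^-1; rewrite ?invr_gt0// => h hk.
apply: le_trans Hk; apply: le_shift_defect => //; rewrite !setTI.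
move=> x /= [xm xhm]; split => // xm'; apply: xhm => i.
rewrite mxE; apply: le_lt_trans (ler_normD _ _) _.
by rewrite -[m](subrK k.+1%:R^-1) ltrD.
Qed.

Lemma shift_continuousU m A B :
  shift_continuous m A -> shift_continuous m B -> shift_continuous m (A `|` B).
Proof.
move=> [mA cA] [mB cB]; split=> [|e e0]; first exact: measurableU.
have e20 : 0 < e / 2 by rewrite divr_gt0.
have [d1 d10 H1] := cA _ e20; have [d2 d20 H2] := cB _ e20.
exists (Num.min d1 d2) => [|h hd]; first by rewrite lt_min d10.
rewrite (splitr e) EFinD.
apply: le_trans; last apply: leeD; last 2 first.
- by apply: H1; apply: le_cube hd; rewrite ge_min lexx.
- by apply: H2; apply: le_cube hd; rewrite ge_min lexx orbT.
have mC C : measurable C ->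
    measurable ((C `&` cube m) `\` ((fun y => y + h) @^-1` (C `&` cube m))).
  move=> mC; have mCm : measurable (C `&` cube m) by apply: measurableI => //; exact: measurable_cube.
  by apply: measurableD => //; exact: measurable_preshift.
apply: le_trans; last by apply: measureU2; exact: mC.
apply: le_shift_defect; [exact: measurableU|by apply: measurableU; exact: mC|].
move=> x /= [[[Ax|Bx] xm] H]; [left|right]; split => // -[Cx xhm]; apply: H.
  by split => //; left.
by split => //; right.
Qed.

(** A point leaves the complement either by leaving the cube or by entering [A]. In the second case
    its translate is a point of [A] that leaves under the shift by [- h], and translation invariance
    compares the measures. *)
Lemma shift_continuousC m A :
  shift_continuous m A -> shift_continuous m (~` A).
Proof.
move=> [mA cA]; split=> [|e e0]; first exact: measurableC.
have e20 : 0 < e / 2 by rewrite divr_gt0.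
have [d1 d10 H1] := cA _ e20; have [_ cT] := shift_continuous_cube m.
have [d2 d20 H2] := cT _ e20.
exists (Num.min d1 d2) => [|h hd]; first by rewrite lt_min d10.
rewrite (splitr e) EFinD.
apply: (@le_trans _ _ (shift_defect A m (- h) + shift_defect setT m h)%E); last first.
  apply: leeD.
    by apply: H1; apply: cubeN; apply: le_cube hd; rewrite ge_min lexx.
  by apply: H2; apply: le_cube hd; rewrite ge_min lexx orbT.
have mC (g : V) C : measurable C ->
    measurable ((C `&` cube m) `\` ((fun y => y + g) @^-1` (C `&` cube m))).
  move=> mC; have mCm : measurable (C `&` cube m) by apply: measurableI => //; exact: measurable_cube.
  by apply: measurableD => //; exact: measurable_preshift.
rewrite [shift_defect A m (- h)]/shift_defect -(lebesgue_cV_shift h (mC (- h) A mA)).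
apply: le_trans; last first.
  apply: measureU2; last by apply: mC; exact: measurableT.
  by apply: measurable_preshift; exact: mC.
apply: le_shift_defect; [exact: measurableC| |].
  apply: measurableU; last by apply: mC; exact: measurableT.
  by apply: measurable_preshift; exact: mC.
move=> x /= [[Ax xm] H].
have [xhm|xhm] := pselect (cube m (x + h)); last by right; split => // -[].
left; rewrite addrK; split; last by case.
by split => //; apply: contrapT => Axh; apply: H.
Qed.

(** Inside the cube a finite subunion exhausts the union up to measure e/2, and finite unions are
    already covered. *)
Lemma shift_continuous_bigcup m (F : nat -> set V) :
  (forall k, shift_continuous m (F k)) -> shift_continuous m (\bigcup_k F k).
Proof.
move=> cF; have mF k := (cF k).1.
split=> [|e e0]; first exact: bigcup_measurable.
pose U k := \big[setU/set0]_(i < k) F i.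
have cU k : shift_continuous m (U k).
  rewrite /U; elim: k => [|k IH]; last by rewrite big_ord_recr /=; exact: shift_continuousU.
  by rewrite big_ord0 -setCT; apply: shift_continuousC; exact: shift_continuous_cube.
have mU k := (cU k).1.
have nU : nondecreasing_seq U by move=> i j ij; apply/subsetPset; exact: subset_bigsetU.
have mT : measurable ((\bigcup_k F k) `&` cube m).
  by apply: measurableI; [exact: bigcup_measurable|exact: measurable_cube].
have e20 : 0 < e / 2 by rewrite divr_gt0.
pose G k := ((\bigcup_k F k) `&` cube m) `\` U k.
have mG k : measurable (G k) by exact: measurableD.
have [k Hk] : exists k, (leb (G k) <= (e / 2)%:E)%E.
  apply: shrinking_set => //.
  - by move=> i j ij; apply/subsetPset; apply: setDS; apply/subsetPset/nU.
  - apply: le_lt_trans (cube_fin m); apply: le_measure; rewrite ?inE//.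
      exact: measurable_cube.
    by move=> x [[]].
  - apply/seteqP; split => // x Gx; have [[[i _ Fix] _] _] := Gx 0%N I.
    have [_] := Gx i.+1 I; apply; rewrite /U big_ord_recr /=; by right.
have [d d0 H] := (cU k).2 _ e20.
exists d => // h /H Hd; rewrite (splitr e) EFinD.
apply: le_trans (leeD Hd Hk).
have mC : measurable ((U k `&` cube m) `\` ((fun y => y + h) @^-1` (U k `&` cube m))).
  have mCm : measurable (U k `&` cube m) by apply: measurableI => //; exact: measurable_cube.
  by apply: measurableD => //; exact: measurable_preshift.
apply: le_trans; last by apply: measureU2.
apply: le_shift_defect; [exact: bigcup_measurable|exact: measurableU|].
move=> x /= [[Fx xm] Hx]; have [Ux|nUx] := pselect (U k x); last by right.
left; split => // -[Uxh xhm]; apply: Hx; split => //.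
move: Uxh; rewrite /U -bigcup_mkord => -[i _ Fi]; by exists i.
Qed.

(** Apart from points that leave the cube, only points of a thin strip along the boundary hyperplane
    can leave the half-space. *)
Lemma shift_continuous_ray m (i : 'I_n) (a : R) :
  shift_continuous m [set x | a < x i ord0].
Proof.
have mray c : measurable [set x : V | c < x i ord0].
  rewrite (_ : [set _ | _] = (fun x : V => x i ord0) @^-1` `]c, +oo[%classic).
    by rewrite -[X in measurable X]setTI; apply: measurable_coord.
  by apply/seteqP; split => x /=; rewrite in_itv/= andbT.
split=> [|e e0]; first exact: mray.
have e20 : 0 < e / 2 by rewrite divr_gt0.
pose F k := cube m `&` [set x : V | a < x i ord0] `\` [set x : V | a + k.+1%:R^-1 < x i ord0].
have mF k : measurable (F k).
  by apply: measurableD => //; apply: measurableI => //; exact: measurable_cube.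
have [k Hk] : exists k, (leb (F k) <= (e / 2)%:E)%E.
  apply: shrinking_set => //.
  - move=> p q pq; apply/subsetPset; apply: setDS => x /=.
    by apply: le_lt_trans; rewrite lerD2l lef_pV2 ?posrE// ler_nat.
  - apply: le_lt_trans (cube_fin m); apply: le_measure; rewrite ?inE//.
      exact: measurable_cube.
    by move=> x [[]].
  - apply/seteqP; split => // x Fx; have [[_ /= ax] _] := Fx 0%N I.
    by have [k ak] := ltr_add_invr ax; have [_] := Fx k I; apply.
have [_ cT] := shift_continuous_cube m.
have [d d0 H] := cT _ e20.
exists (Num.min d k.+1%:R^-1) => [|h hd]; first by rewrite lt_min d0 invr_gt0/=.
have hk := le_cube (ltac:(by rewrite ge_min lexx orbT) : Num.min d k.+1%:R^-1 <= k.+1%:R^-1) hd.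
have hd' := le_cube (ltac:(by rewrite ge_min lexx) : Num.min d k.+1%:R^-1 <= d) hd.
rewrite (splitr e) EFinD; apply: le_trans (leeD (H h hd') Hk).
have mC : measurable ((setT `&` cube m) `\` ((fun y => y + h) @^-1` (setT `&` @cube R n m))).
  rewrite setTI; apply: measurableD; first exact: measurable_cube.
  by apply: measurable_preshift; exact: measurable_cube.
apply: le_trans; last by apply: measureU2.
apply: le_shift_defect; [exact: mray|exact: measurableU|].
move=> x /= [[ax xm] Hx]; have [xhm|xhm] := pselect (cube m (x + h)); last by left; split=> // -[].
right; split => // axk; apply: Hx; split => //.
rewrite /= mxE; have := hk i; rewrite ltr_norml => /andP[+ _]; move: axk => /=.
move: (k.+1%:R^-1) => t; lra.
Qed.

(** Two nested inductions over sigma-algebras: the outer one over the coordinate preimages that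
    generate it, the inner one over the open rays that generate the Borel sets of the line. *)
Lemma measurable_shift_continuous m A : measurable A -> shift_continuous m A.
Proof.
suff: @measurable _ V `<=` shift_continuous m by exact.
have sC0 : shift_continuous m set0.
  by rewrite -setCT; apply: shift_continuousC; exact: shift_continuous_cube.
apply: smallest_sub.
  split => //=; last exact: shift_continuous_bigcup.
  by move=> B cB; rewrite setTD; exact: shift_continuousC.
rewrite -bigcup_seq; apply: bigcup_sub => i _ _ [B mB <-] /=; rewrite setTI.
move: mB; rewrite -[measurable]/((ocitv (R:=R)).-sigma.-measurable) RGenOInfty.measurableE.
suff: <<s @RGenOInfty.G R >> `<=`
    [set B | shift_continuous m ((fun x : V => x i ord0) @^-1` B)] by exact.
apply: smallest_sub.
  split => /=; first by rewrite preimage_set0.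
  - by move=> C cC; rewrite setTD preimage_setC; exact: shift_continuousC.
  - by move=> F cF; rewrite preimage_bigcup; exact: shift_continuous_bigcup.
move=> _ [a ->] /=; rewrite (_ : _ @^-1` _ = [set x : V | a < x i ord0]).
  exact: shift_continuous_ray.
by apply/seteqP; split => x /=; rewrite in_itv/= andbT.
Qed.

(** The form in which continuity is used: a set overlaps its small translates up to an error [c]. It
    yields both the local boundedness of rho and the density property of ellipsoids. *)
Lemma shift_overlap A m (c : R) : measurable A -> 0 < c ->
  exists2 d, 0 < d & forall h, cube d h ->
  (leb (A `&` cube m) <= leb (A `&` cube m `&` (fun y => y + h)%R @^-1` (A `&` cube m)) + c%:E)%E.
Proof.
move=> mA c0; have [_ /(_ c c0)[d d0 H]] := measurable_shift_continuous m mA.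
exists d => // h /H Hd.
have mAm : measurable (A `&` cube m) by apply: measurableI => //; exact: measurable_cube.
have mS := measurable_preshift h mAm.
rewrite (measureDI _ mAm mS) addeC; exact: leeD.
Qed.

End translation_continuity.

(** * Homogeneous quasinorms: local boundedness, continuity at 0, coercivity *)

Section homogeneous_quasinorm.
Context {R : realType} (n : nat).
Local Notation V := ('cV[R]_n).
Local Notation leb := (@lebesgue_cV R n).
Variables (rho : V -> R) (A : R -> 'M[R]_n) (k : R).
Hypothesis mrho : measurable_fun setT rho.
Hypothesis rhoA : forall t x, 0 < t -> rho (A t *m x) = t * rho x.
Hypothesis rhoN : forall x, rho (- x) = rho x.
Hypothesis rho_ge0 : forall x, 0 <= rho x.
Hypothesis rho_gt0 : forall x, x != 0 -> 0 < rho x.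
Hypothesis k1 : 1 <= k.
Hypothesis rhoD : forall x y, rho (x + y) <= k * (rho x + rho y).

Lemma measurable_sublevel (r : R) : measurable [set x | rho x < r].
Proof.
rewrite (_ : [set _ | _] = rho @^-1` `]-oo, r[%classic).
  by rewrite -[X in measurable X]setTI; exact: mrho.
by apply/seteqP; split => x /=; rewrite in_itv.
Qed.

(** Steinhaus' argument: some sublevel set of the measurable function [rho] has positive measure in
    the unit cube, hence meets its translate by any small [h]. Then [h] is a difference of two
    points at which [rho] is bounded. *)
Lemma rho_bounded_near0 : exists2 d, 0 < d &
  exists M, forall h, cube d h -> rho h <= M.
Proof.
pose F j := [set x : V | rho x < j%:R] `&` cube 1.
have mF j : measurable (F j).
  by apply: measurableI; [exact: measurable_sublevel|exact: measurable_cube].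
have [j Fj] : exists j, (0 < leb (F j))%E.
  apply: contrapT => /forallNP F0.
  have : (leb (\bigcup_j F j) = 0)%E.
    apply/negligibleP; first exact: bigcup_measurable.
    apply: negligible_bigcup => j; apply/negligibleP => //.
    by apply/eqP; rewrite eq_le measure_ge0 andbT leNgt; apply/negP/F0.
  rewrite (_ : \bigcup_j F j = cube 1); last first.
    apply/seteqP; split => x /=; first by move=> [j _ []].
    move=> x1; exists (Num.truncn (rho x)).+1 => //; split => //=.
    exact: truncnS_gt.
  by rewrite lebesgue_cV_cube// => /eqP; rewrite eqe expf_eq0 (pnatr_eq0 R 2) andbF.
have Fjoo : (leb (F j) < +oo)%E.
  apply: le_lt_trans (cube_fin n 1); apply: le_measure; rewrite ?inE//.
    exact: measurable_cube.
  by move=> x [].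
pose c := fine (leb (F j)).
have cE : leb (F j) = c%:E by rewrite fineK// ge0_fin_numE.
have c0 : 0 < c by rewrite -lte_fin -cE.
have [d d0 Hd] := shift_overlap (A := [set x | rho x < j%:R]) 1
  (measurable_sublevel _) (ltac:(by rewrite divr_gt0) : 0 < c / 2).
exists d => //; exists (k * (j%:R + j%:R)) => h /Hd Hh.
have [x [[rx _] [rxh _]]] : F j `&` (fun y => y + h) @^-1` F j !=set0.
  apply/set0P/eqP => H; move: Hh; rewrite -/(F j) H measure0 add0e cE lee_fin.
  by rewrite leNgt ltr_pdivrMr// mulr2n mulrDr mulr1 ltrDl c0.
rewrite (_ : h = (x + h) + (- x)); last by rewrite addrC addKr.
apply: le_trans (rhoD _ _) _; rewrite rhoN.
have k0 : 0 < k by apply: lt_le_trans k1.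
by rewrite ler_pM2l// lerD// ltW.
Qed.

(** Writing [h] as h/2 + h/2 doubles the cube at the cost of a factor 2k in the bound. *)
Lemma rho_bounded m : exists M, forall h, cube m h -> rho h <= M.
Proof.
have [d d0 [M HM]] := rho_bounded_near0.
have H j : exists M, forall h, cube (2 ^+ j * d) h -> rho h <= M.
  elim: j => [|j [M' HM']]; first by rewrite expr0 mul1r; exists M.
  exists (k * (M' + M')) => h hj.
  rewrite -[h]scale1r (splitr 1) scalerDl.
  apply: le_trans (rhoD _ _) _; rewrite ler_pM2l; last by apply: lt_le_trans k1.
  suff : rho ((1 / 2) *: h) <= M' by move=> ?; exact: lerD.
  apply: HM' => i; rewrite mxE normrM ger0_norm// mul1r mulrC ltr_pdivrMr//.
  by rewrite -mulrA (mulrC d) mulrA -exprSr; exact: hj.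
have [j mj] : exists j, m <= 2 ^+ j * d.
  exists (Num.truncn (m / d)).+1; rewrite -ler_pdivrMr//.
  apply: ltW; apply: lt_trans (truncnS_gt _) _.
  by rewrite -natrX ltr_nat ltn_expl.
have [M' HM'] := H j; exists M' => h hm; apply: HM'; exact: le_cube hm.
Qed.

Lemma mulmx_cube (B : 'M[R]_n) : exists2 L, 1 <= L &
  forall m h, cube m h -> cube (L * m) (B *m h).
Proof.
pose L := 1 + \sum_i \sum_j `|B i j|.
have S0 : 0 <= \sum_i \sum_j `|B i j| by apply: sumr_ge0 => i _; apply: sumr_ge0.
exists L; first by rewrite lerDl.
move=> m h hm i.
have m0 : 0 < m by apply: le_lt_trans (hm i).
rewrite mxE; apply: le_lt_trans (ler_norm_sum _ _ _) _.
apply: (@le_lt_trans _ _ ((\sum_j `|B i j|) * m)).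
  rewrite mulr_suml; apply: ler_sum => j _; rewrite normrM.
  by apply: ler_wpM2l => //; exact/ltW/hm.
rewrite ltr_pM2r//; apply: (@le_lt_trans _ _ (\sum_i \sum_j `|B i j|)).
  by rewrite [leRHS](bigD1 i)//= lerDl; apply: sumr_ge0 => l _; apply: sumr_ge0.
by rewrite /L ltrDr.
Qed.

(** Homogeneity turns boundedness into continuity at 0: [A t] maps a small enough cube into the unit
    cube and multiplies [rho] by a large [t]. *)
Lemma rho_small (e : R) : 0 < e -> exists2 d, 0 < d & forall x, cube d x -> rho x < e.
Proof.
move=> e0; have [M HM] := rho_bounded 1.
pose M1 := Num.max M 1; have M10 : 0 < M1 by rewrite lt_max ltr01 orbT.
pose t := M1 * 2 / e; have t0 : 0 < t by rewrite divr_gt0// mulr_gt0.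
have [L L1 HL] := mulmx_cube (A t).
have L0 : 0 < L by apply: lt_le_trans L1.
exists L^-1; first by rewrite invr_gt0.
move=> x /HL; rewrite mulfV ?gt_eqF// => /HM; rewrite rhoA// => H.
have : t * rho x <= M1 by apply: le_trans H _; rewrite le_max lexx.
rewrite /t -ler_pdivlMl// => /le_lt_trans; apply.
have -> : (M1 * 2 / e)^-1 * M1 = e / 2 by field; rewrite !gt_eqF.
by rewrite ltr_pdivrMr// mulr2n mulrDr mulr1 ltrDl.
Qed.

(** Compactness of the closed cube. Near a nonzero point [v] the quasi-triangle inequality and
    [rho_small] keep [rho] above rho(v)/(2k), which replaces lower semicontinuity; points near 0 are
    excluded by the inner cube. *)
Lemma rho_lower_annulus (d M : R) : 0 < d ->
  exists2 c, 0 < c & forall x, cube M x -> ~ cube d x -> c <= rho x.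
Proof.
move=> d0.
(* Compactness of boxes is used for row vectors, hence the transposes below. *)
pose K : set 'rV[R]_n := [set v | forall i, `[- M, M]%classic (v ord0 i)].
have cK : compact K.
  apply: (rV_compact (A := fun=> `[- M, M]%classic)) => i.
  exact: segment_compact.
have k0 : 0 < k by apply: lt_le_trans k1.
pose P (j : nat) (v : 'rV[R]_n) := ~ cube d v^T -> j.+1%:R^-1 <= rho v^T.
have : \forall j \near \oo, K `<=` P j.
  apply: (compact_near_coveringP K).1 => // v Kv.
  have [v0|v0] := eqVneq v 0.
    exists ([set x : 'rV[R]_n | cube d x^T], setT) => /=; last first.
      by move=> -[x j] [/= xd _]; rewrite /P.
    split; last exact: filterT.
    apply/nbhs_ballP; exists d => //= x; rewrite -ball_normE /= v0 sub0r normrN => xd i.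
    rewrite mxE; apply: le_lt_trans xd.
    by rewrite [leRHS]mx_normrE; apply: (le_bigmax _ (fun ij => `|x ij.1 ij.2|) (ord0, i)).
  have vT0 : v^T != 0 by rewrite trmx_eq0.
  have r0 := rho_gt0 vT0.
  have e0 : 0 < rho v^T / (2 * k) by rewrite divr_gt0// mulr_gt0.
  have [e e_0 He] := rho_small e0.
  exists ([set x : 'rV[R]_n | cube e (v - x)^T], [set j | j.+1%:R^-1 <= rho v^T / (2 * k)]) => /=.
    split.
      apply/nbhs_ballP; exists e => //= x; rewrite -ball_normE /= => xd i.
      rewrite [_ i ord0]mxE; apply: le_lt_trans xd.
      by rewrite [leRHS]mx_normrE; apply: (le_bigmax _ (fun ij => `|(v - x) ij.1 ij.2|) (ord0, i)).
    have [j] := ltr_add_invr e0; rewrite add0r => Hj; exists j => // i /= ji.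
    by apply: le_trans (ltW Hj); rewrite lef_pV2 ?posrE// ler_nat.
  move=> -[x j] [/= /He xe jr] _; apply: le_trans jr _.
  have : rho v^T <= k * (rho x^T + rho (v - x)^T).
    apply: le_trans (rhoD _ _); rewrite -raddfD/= addrC subrK.
    exact: lexx.
  rewrite -ler_pdivrMl// => H.
  rewrite -(lerD2r (rho (v - x)^T)); apply: le_trans H.
  rewrite [in leRHS](splitr (k^-1 * _)).
  have -> : k^-1 * rho v^T / 2 = rho v^T / (2 * k) by field; rewrite gt_eqF.
  by rewrite lerD2l ltW.
move=> [j _ /(_ j (leqnn j)) Hj].
exists j.+1%:R^-1; first by rewrite invr_gt0.
move=> x xM xd; rewrite -[x]trmxK; apply: Hj; last by rewrite trmxK.
move=> i; rewrite mxE /= in_itv/=.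
by have := xM i; rewrite ltr_norml => /andP[/ltW -> /ltW ->].
Qed.

Lemma cube_normP (m : R) (x : V) : 0 < m -> cube m x <-> `|x| < m.
Proof.
move=> m0; rewrite [`|x|]mx_normrE; split => [xm|xm i].
  by apply: bigmax_lt => // -[i j] _ /=; rewrite ord1; exact: xm.
by apply: le_lt_trans xm; apply: (le_bigmax _ (fun ij => `|x ij.1 ij.2|) (i, ord0)).
Qed.

(** If [x] has norm 1 and its image has norm below 2, then [T * rho x] is at most the bound [M] of
    [rho] on the cube of size 2, while [rho x] is at least [c]. So any [T] with T c > M expands unit
    vectors, and linearity does the rest. *)
Lemma expanding_dilation : exists2 T, 1 <= T & forall x : V, 2 * `|x| <= `|A T *m x|.
Proof.
have [c c0 Hc] := rho_lower_annulus 2 (@ltr01 R).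
have [M HM] := rho_bounded 2.
pose T := 1 + (`|M| + 1) / c.
have T0 : 0 < T by rewrite ltr_pwDl// divr_ge0// ?addr_ge0// ltW.
exists T; first by rewrite lerDl divr_ge0// ?addr_ge0// ltW.
have H1 (x : V) : `|x| = 1 -> 2 <= `|A T *m x|.
  move=> x1; rewrite leNgt; apply/negP => /cube_normP => /(_ ltac:(by [])) /HM.
  rewrite rhoA// leNgt => /negP; apply.
  have cx : c <= rho x.
    by apply: Hc => [|/cube_normP]; [apply/cube_normP|rewrite x1 ltxx => /(_ ltac:(by []))]; rewrite ?x1 ?ltr1n.
  apply: lt_le_trans (ler_wpM2l (ltW T0) cx).
  rewrite /T mulrDl mul1r mulfVK ?gt_eqF//.
  by have := ler_norm M; move: c0; lra.
move=> x; have [->|x0] := eqVneq x 0; first by rewrite mulmx0 normr0 mulr0.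
have nx0 : 0 < `|x| by rewrite normr_gt0.
have /H1 : `| `|x|^-1 *: x| = 1 by rewrite normrZ ger0_norm ?invr_ge0// mulVf ?gt_eqF.
rewrite -scalemxAr normrZ ger0_norm ?invr_ge0//.
by rewrite ler_pdivlMl// mulrC.
Qed.

(** A point far from 0 is pulled back by the inverse of the expanding dilation: each step halves the
    norm and does not increase [rho]. The pullbacks stop in a fixed annulus, where
    [rho_lower_annulus] applies. *)
Lemma rho_lower (d : R) : 0 < d ->
  exists2 c, 0 < c & forall x, ~ cube d x -> c <= rho x.
Proof.
move=> d0; have [T T1 HT] := expanding_dilation.
have T0 : 0 < T by apply: lt_le_trans T1.
have uA : A T \in unitmx.
  rewrite unitmxE unitfE; apply/negP; rewrite -det_tr => /det0P[v v0 vA].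
  have := HT v^T; rewrite -[A T]trmxK -trmx_mul vA trmx0 normr0.
  rewrite leNgt mulr_gt0// normr_gt0.
  by rewrite trmx_eq0.
have [L L1 HL] := mulmx_cube (A T).
have L0 : 0 < L by apply: lt_le_trans L1.
have [c c0 Hc] := rho_lower_annulus (L * d) d0.
have Ld0 : 0 < L * d by rewrite mulr_gt0.
exists c => //.
have H j : forall x, cube (2 ^+ j * (L * d)) x -> ~ cube d x -> c <= rho x.
  elim: j => [|j IH] x; first by rewrite expr0 mul1r; exact: Hc.
  move=> xj xd; have [/Hc|xLd] := pselect (cube (L * d) x); first exact.
  set y := invmx (A T) *m x.
  have xE : x = A T *m y by rewrite mulKVmx.
  have jLd0 i : 0 < 2 ^+ i * (L * d) by rewrite mulr_gt0// exprn_gt0.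
  rewrite xE rhoA//; apply: (@le_trans _ _ (rho y)); last by rewrite ler_peMl.
  apply: IH; last by move=> /HL; rewrite -xE.
  apply/cube_normP => //; move: xj => /cube_normP => /(_ (jLd0 _)).
  rewrite exprS -mulrA => xj; rewrite -(ltr_pM2l (ltr0Sn _ 1)).
  by apply: le_lt_trans xj; rewrite xE.
move=> x xd.
have [j xj] : exists j, `|x| < 2 ^+ j * (L * d).
  exists (Num.truncn (`|x| / (L * d))).+1; rewrite -ltr_pdivrMr//.
  by apply: lt_trans (truncnS_gt _) _; rewrite -natrX ltr_nat ltn_expl.
apply: (H j) => //; apply/cube_normP => //.
by rewrite mulr_gt0// exprn_gt0.
Qed.

Lemma sublevel_lt_pinfty : exists2 c, 0 < c & (leb [set x | (rho x < c)%R] < +oo)%E.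
Proof.
have [c c0 Hc] := rho_lower ltr01.
exists c => //; apply: le_lt_trans (cube_fin n 1).
apply: le_measure; rewrite ?inE//; [exact: measurable_sublevel|exact: measurable_cube|].
move=> x /= xc; apply: contrapT => /Hc; rewrite leNgt xc//.
Qed.

Lemma sublevel_gt0 r : 0 < r -> (0 < leb [set x | (rho x < r)%R])%E.
Proof.
move=> /rho_small [d d0 Hd].
apply: (@lt_le_trans _ _ (leb (cube d))).
  by rewrite lebesgue_cV_cube// lte_fin exprn_gt0// pmulrn_rgt0.
by apply: le_measure; rewrite ?inE//; [exact: measurable_cube|exact: measurable_sublevel].
Qed.

End homogeneous_quasinorm.

(** * Scaling of integrals on the line *)

Section lebesgue_scaling.
Context {R : realType}.

(** Uniqueness of Lebesgue measure again: [r] times its image under multiplication by [r] has the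
    right values on intervals. *)
Lemma lebesgue_integral_scale (r : R) (g : R -> \bar R) : 0 < r ->
  measurable_fun setT g -> (forall s, (0 <= g s)%E) ->
  (\int[lebesgue_measure]_s g s = r%:E * \int[lebesgue_measure]_s g (r * s)%R)%E.
Proof.
move=> r0 mg g0.
have mr : measurable_fun [set: measurableTypeR R]
    (fun s : measurableTypeR R => (r * s : measurableTypeR R)).
  exact: measurable_funM.
pose pf : {measure set (measurableTypeR R) -> \bar R} :=
  measure_function_pushforward__canonical__measure_function_Measure
    (@lebesgue_measure R) mr.
pose m' : {measure set (measurableTypeR R) -> \bar R} := mscale (NngNum (ltW r0)) pf.
transitivity (\int[m']_s g s)%E.
  apply: eq_measure_integral => /= A mA _.
  apply: (@lebesgue_measure_unique R m') => //= _ [[x y]] _ <-.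
  rewrite /m' /= /mscale /= /pushforward.
  rewrite (_ : _ @^-1` _ = `]r^-1 * x, r^-1 * y]%classic); last first.
    apply/seteqP; split => t /=; rewrite !in_itv/= ltr_pdivrMl// ler_pdivlMl//.
  rewrite !lebesgue_measure_itv/= !lte_fin ltr_pM2l ?invr_gt0//.
  case: ifP => // _; last by rewrite mule0.
  by rewrite -!EFinB -mulrBr -EFinM mulVKf// gt_eqF.
rewrite ge0_integral_mscale//=.
by congr (_ * _)%E; rewrite ge0_integral_pushforward.
Qed.

End lebesgue_scaling.

(** * Ellipsoids: volume, dense centres, weak density *)

Section quasi_distance_geometry.
Context {R : realType} (n : nat).
Local Notation V := ('cV[R]_n).
Local Notation leb := (@lebesgue_cV R n).
Variables (P : 'M[R]_n) (rho : V -> R).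
Hypothesis rhoP : quasi_distance P rho.
Local Notation g := (\tr P).

Lemma quasi_distance_ge0 x : 0 <= rho x.
Proof. by have := qd_ge0 rhoP x 0; rewrite subr0. Qed.

Lemma quasi_distanceN x : rho (- x) = rho x.
Proof. by have := qd_sym rhoP x 0; rewrite subr0 sub0r. Qed.

Lemma quasi_distance_subadd : exists2 k, 1 <= k &
  forall x y, rho (x + y) <= k * (rho x + rho y).
Proof.
have [k Hk] := qd_triangle rhoP.
exists (Num.max 1 k) => [|x y]; first by rewrite le_max lexx.
have := Hk x (- y) 0; rewrite !subr0 opprK quasi_distanceN => /le_trans; apply.
apply: ler_wpM2r; last by rewrite le_max lexx orbT.
by rewrite addr_ge0// quasi_distance_ge0.
Qed.

Let k := projT1 (cid2 quasi_distance_subadd).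
Let k1 : 1 <= k. Proof. by rewrite /k; case: cid2. Qed.
Let rhoD x y : rho (x + y) <= k * (rho x + rho y).
Proof. by rewrite /k; case: cid2 => /= ? ? ?. Qed.

Let mrho := qd_measurable rhoP.
Let rhoA := qd_homogeneous rhoP.
Let rho0 := quasi_distance_ge0.
Let rhoN := quasi_distanceN.
Let rhogt0 := qd_gt0 rhoP.
Let small := rho_small mrho rhoA rhoN k1 rhoD.
Let lower := rho_lower mrho rhoA rhoN rho0 rhogt0 k1 rhoD.

Lemma ellipsoidE x r : ellipsoid rho x r = (fun y => y + (- x)) @^-1` [set y | rho y < r].
Proof. by apply/seteqP; split => y /=; rewrite /ellipsoid /= (qd_sym rhoP x y). Qed.

Lemma measurable_ellipsoid x r : measurable (ellipsoid rho x r).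
Proof. by rewrite ellipsoidE; apply: measurable_preshift; exact: (measurable_sublevel mrho). Qed.

Lemma lebesgue_ellipsoid x r :
  leb (ellipsoid rho x r) = leb [set y | rho y < r].
Proof. by rewrite ellipsoidE lebesgue_cV_shift//; exact: (measurable_sublevel mrho). Qed.

Lemma measurable_quasi_distance :
  measurable_fun [set: V * V] (fun z => rho (z.1 - z.2)).
Proof.
apply: (measurableT_comp mrho) => /=.
apply: measurable_fun_coordP => i.
rewrite (_ : (fun _ => _) = (fun z : V * V => z.1 i ord0 - z.2 i ord0)); last first.
  by apply/funext => z; rewrite !mxE.
apply: measurable_funB.
  exact: (measurableT_comp (measurable_coord i) measurable_fst).
exact: (measurableT_comp (measurable_coord i) measurable_snd).
Qed.

(** In polar coordinates the measure is the mass of the unit sphere times the integral of s^(g-1)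
    over (0,r); rescaling s produces r^g. Finiteness is not yet known here, so the identity lives in
    the extended reals. *)
Lemma sublevel_scale r : 0 < r ->
  leb [set y | rho y < r] = ((r `^ g)%:E * leb [set y | (rho y < 1)%R])%E.
Proof.
have [sigma Hs] := qd_polar rhoP.
pose S := [set w | rho w = 1].
have mS : measurable S.
  by rewrite (_ : S = rho @^-1` [set 1])// -[X in measurable X]setTI; exact: mrho.
pose I (r : R) : \bar R := (\int[lebesgue_measure]_(s in `]0%R, +oo[)
   ((\1_[set s | (s < r)%R] s * s `^ (g - 1))%:E))%E.
have mI (t : R) : measurable_fun setT (fun s : R => ((\1_[set s | (s < t)%R] s * s `^ (g - 1))%:E : \bar R)).
  apply/measurable_EFinP; apply: measurable_funM; last exact: measurable_powR.
  by apply: measurable_indic; rewrite (_ : [set _ | _] = `]-oo, t[%classic).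
have E t : 0 < t -> leb [set y | rho y < t] = (sigma S * I t)%E.
  move=> t0.
  have := Hs (fun y => (\1_[set y | rho y < t] y)%:E).
  rewrite integral_indic//; last exact: (measurable_sublevel mrho).
  rewrite setIT => ->; last 2 first.
  - by apply/measurable_EFinP; apply: measurable_indic; exact: (measurable_sublevel mrho).
  - by move=> x; rewrite lee_fin.
  rewrite /I -ge0_integralZl//; last 2 first.
  - by apply: measurable_funTS; exact: mI.
  - by move=> s _; rewrite lee_fin mulr_ge0// powR_ge0.
  apply: eq_integral => s; rewrite inE/= in_itv/= andbT => s0.
  rewrite EFinM muleA; congr (_ * _)%E.
  transitivity (\int[sigma]_(w in S) (cst (\1_[set s | s < t] s)%:E w))%E.
    apply: eq_integral => w; rewrite inE => Sw /=.
    congr (_%:E); rewrite !indicE; congr ((nat_of_bool _)%:R); apply/idP/idP; rewrite !inE/= rhoA// Sw mulr1//.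
  by rewrite integral_cst// muleC.
move=> r0; rewrite !E// muleCA; congr (_ * _)%E.
rewrite /I integral_mkcond [in RHS]integral_mkcond.
pose G (t : R) := (fun s : R => ((\1_[set s | (s < t)%R] s * s `^ (g - 1))%:E : \bar R)) \_ `]0, +oo[.
have mG (t : R) : measurable_fun setT (G t).
  apply: (measurable_restrictT _ _).1; first exact: measurable_itv.
  by apply: measurable_funTS; exact: mI.
have G0 t s : (0 <= G t s)%E.
  by rewrite /G patchE; case: ifP => // _; rewrite lee_fin mulr_ge0// powR_ge0.
have Grs s : G r (r * s) = ((r `^ (g - 1))%:E * G 1%R s)%E.
  rewrite /G !patchE.
  have -> : (r * s \in `]0, +oo[%classic) = (s \in `]0, +oo[%classic).
    by apply/idP/idP; rewrite !inE/= !in_itv/= !andbT pmulr_rgt0.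
  case: ifP => [|_]; last by rewrite !mule0.
  rewrite inE/= in_itv/= andbT => s0; rewrite -!EFinM; congr (_%:E).
  have -> : \1_[set s | s < r] (r * s) = \1_[set s | s < 1] s :> R.
    by rewrite !indicE; congr ((nat_of_bool _)%:R); apply/idP/idP; rewrite !inE/= gtr_pMr.
  by rewrite powRM ?ltW// mulrCA.
have := lebesgue_integral_scale r0 (mG r) (G0 r); rewrite -/(G r) => ->.
rewrite (_ : (fun s => G r (r * s)) = (fun s => (r `^ (g - 1))%:E * G 1%R s)%E); last exact/funext.
have -> := @ge0_integralZl_EFin _ _ _ lebesgue_measure setT measurableT (G 1) (fun s _ => G0 1 s)
  (mG 1) _ (powR_ge0 r (g - 1)).
rewrite muleA -EFinM -{1}(powRr1 (ltW r0)) -powRD; first by rewrite addrC subrK.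
by rewrite (gt_eqF r0) implybT.
Qed.

(** The sublevel set is bounded for one small radius; the scaling law carries finiteness over to
    radius 1. *)
Lemma ellipsoid_volume : exists2 v, 0 < v &
  forall x r, 0 < r -> leb (ellipsoid rho x r) = (v * r `^ g)%:E.
Proof.
have [c c0 cfin] := sublevel_lt_pinfty mrho rhoA rhoN rho0 rhogt0 k1 rhoD.
have v0 : (0 < leb [set x | (rho x < 1)%R])%E by exact: (sublevel_gt0 mrho rhoA rhoN k1 rhoD ltr01).
have vfin : leb [set x | (rho x < 1)%R] \is a fin_num.
  rewrite ge0_fin_numE// ltey; apply/eqP => voo; move: cfin.
  by rewrite sublevel_scale// voo gt0_muley// lte_fin powR_gt0.
exists (fine (leb [set x | (rho x < 1)%R])).
  by apply: fine_gt0; rewrite v0 -ge0_fin_numE.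
by move=> x r r0; rewrite lebesgue_ellipsoid sublevel_scale// muleC EFinM fineK.
Qed.

Lemma dense_centers : exists c : nat -> V, forall x r, 0 < r ->
  exists i, rho (x - c i) < r.
Proof.
exists (fun i => map_mx ratr (odflt 0 (unpickle i : option 'cV[rat]_n))) => x r /small[d d0 Hd].
have H i : exists q : rat, x i ord0 - d < ratr q < x i ord0 + d.
  have [|q] := @rat_in_itvoo R (x i ord0 - d) (x i ord0 + d).
    by rewrite ltrD2l gtrN.
  by rewrite in_itv; exists q.
exists (pickle (\col_i projT1 (cid (H i)))); apply: Hd => i.
rewrite pickleK /= !mxE; case: cid => q /= /andP[q1 q2].
by rewrite ltr_norml; apply/andP; split; [move: q2|move: q1]; lra.
Qed.

(** Serves to deduce local integrability from bounds on ellipsoids. *)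
Lemma compact_sub_ellipsoid (K : set V) : compact K ->
  exists2 r, 0 < r & K `<=` ellipsoid rho 0 r.
Proof.
move=> /compact_bounded[M [_ HM]].
have [B HB] := rho_bounded mrho rhoN k1 rhoD (`|M| + 2).
exists (`|B| + 1); first by rewrite ltr_wpDl.
move=> x Kx; rewrite /ellipsoid /= sub0r rhoN.
apply: le_lt_trans (HB x _) _; last by rewrite (le_lt_trans (ler_norm B))// ltrDl.
apply/cube_normP; first by rewrite ltr_wpDl.
have := HM (`|M| + 1); rewrite (le_lt_trans (ler_norm M)) ?ltrDl// => /(_ isT x Kx) /= H.
by apply: le_lt_trans H _; rewrite ltrD2l ltr1n.
Qed.

(** A weak substitute for Lebesgue's density theorem. If the exceptional set had positive measure,
    let [M] be its part in a cube, of measure c, and measure in two ways the pairs (x,y) with x and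
    x + y in [M] and rho(y) < s_j. For fixed x this is less than half of the ellipsoid volume e, by
    the choice of the set; for fixed small y the overlap of [M] with its translate is at least 3c/4.
    Tonelli would give 3ec/4 <= ec/2. *)
Lemma ellipsoid_density (B : set V) (s : nat -> R) : measurable B ->
  (forall j, 0 < s j) -> (forall e, 0 < e -> exists j, s j < e) ->
  leb.-negligible [set x | B x /\ forall j, (leb (B `&` ellipsoid rho x (s j))
     < 2^-1%:E * leb (ellipsoid rho x (s j)))%E].
Proof.
move=> mB s0 s_0.
have [v v0 Hv] := ellipsoid_volume.
have mW (C : set V) r : measurable C ->
    measurable [set z : V * V | C z.2 /\ rho (z.1 - z.2) < r].
  move=> mC; rewrite (_ : [set _ | _] = (snd @^-1` C) `&`
     (fun z => rho (z.1 - z.2)) @^-1` `]-oo, r[%classic); last first.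
    by apply/seteqP; split => z /=; rewrite in_itv.
  apply: measurableI; first by rewrite -[X in measurable X]setTI; exact: measurable_snd.
  by rewrite -[X in measurable X]setTI; exact: measurable_quasi_distance.
have mF (C : set V) r : measurable C ->
    measurable_fun setT (fun x => leb (C `&` ellipsoid rho x r)).
  move=> mC; have := measurable_fun_xsection leb (mW C r mC).
  congr measurable_fun; apply/funext => x /=; congr (leb _).
  by apply/seteqP; split => y; rewrite /xsection /= inE.
set N := [set x | _].
have mN : measurable N.
  rewrite (_ : N = B `&` \bigcap_j (fun x => leb (B `&` ellipsoid rho x (s j))) @^-1`
      `]-oo, (2^-1%:E * (v * s j `^ g)%:E)%E[%classic).
    apply: measurableI => //; apply: bigcap_measurable => // j _.
    rewrite -[X in measurable X]setTI; apply: mF => //.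
    exact: emeasurable_itv.
  apply/seteqP; split => x [Bx Hx]; split => // j; [move=> _|]; have := Hx j; rewrite /= Hv// in_itv/=.
  by apply.
apply/negligibleP => //.
apply/eqP; rewrite eq_le measure_ge0 andbT leNgt; apply/negP => N0.
have [m Nm] : exists m : nat, (0 < leb (N `&` cube m%:R))%E.
  apply: contrapT => /forallNP F0; move: N0.
  suff /(negligibleP _ mN) -> : leb.-negligible N by rewrite ltxx.
  apply: (@negligibleS _ _ _ _ (\bigcup_m (N `&` cube m%:R))).
    move=> x Nx; exists (Num.truncn `|x|).+1 => //; split => //.
    by apply/cube_normP => //; exact: truncnS_gt.
  apply: negligible_bigcup => m; apply/negligibleP.
    by apply: measurableI => //; exact: measurable_cube.
  by apply/eqP; rewrite eq_le measure_ge0 andbT leNgt; apply/negP/F0.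
set M := N `&` cube m%:R in Nm.
have mM : measurable M by apply: measurableI => //; exact: measurable_cube.
have Moo : (leb M < +oo)%E.
  apply: le_lt_trans (cube_fin n m%:R); apply: le_measure; rewrite ?inE//; last by move=> x [].
  exact: measurable_cube.
pose c := fine (leb M).
have cE : leb M = c%:E by rewrite fineK// ge0_fin_numE.
have c0 : 0 < c by rewrite -lte_fin -cE.
have [d d0 Hd] := shift_overlap m%:R mN (ltac:(by rewrite divr_gt0) : 0 < c / 4).
(* Below this radius an ellipsoid about 0 lies in the cube of admissible shifts. *)
have [c' c'0 Hc'] := lower d0.
have [j sj] := s_0 _ c'0.
pose e := v * s j `^ g; have e0 : 0 < e by rewrite mulr_gt0// powR_gt0.
pose W := [set z : V * V | M z.1 /\ (M (z.1 + z.2) /\ rho z.2 < s j)].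
have mW' : measurable W.
  have mS : measurable_fun [set: V * V] (fun z => z.1 + z.2).
    apply: measurable_fun_coordP => i.
    rewrite (_ : (fun _ => _) = (fun z : V * V => z.1 i ord0 + z.2 i ord0)); last first.
      by apply/funext => z; rewrite !mxE.
    apply: measurable_funD.
      exact: (measurableT_comp (measurable_coord i) measurable_fst).
    exact: (measurableT_comp (measurable_coord i) measurable_snd).
  rewrite (_ : W = fst @^-1` M `&` ((fun z => z.1 + z.2) @^-1` M `&`
     snd @^-1` [set y | rho y < s j]))//.
  apply: measurableI; first by rewrite -[X in measurable X]setTI; exact: measurable_fst.
  apply: measurableI; first by rewrite -[X in measurable X]setTI; exact: mS.
  rewrite -[X in measurable X]setTI; apply: measurable_snd => //.
  exact: (measurable_sublevel mrho).
have := indic_fubini_tonelli leb leb mW'.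
rewrite indic_fubini_tonelli_FE// indic_fubini_tonelli_GE// => FG.
have U : (\int[leb]_x (leb \o xsection W) x <= (2^-1 * e * c)%:E)%E.
  rewrite EFinM -cE -integral_cst// [leRHS]integral_mkcond.
  apply: ge0_le_integral => //.
  - exact: measurable_fun_xsection.
  - apply: (measurable_restrictT (cst (2^-1 * e)%:E) _).1 => //; exact: measurable_cst.
  move=> x _; rewrite patchE /=; case: ifPn => [|xM]; last first.
    rewrite (_ : xsection W x = set0) ?measure0//; apply/seteqP; split => // y.
    by rewrite /xsection /= inE => -[/= Mx]; move: xM; rewrite notin_setE.
  rewrite inE => -[[Bx /(_ j)]]; rewrite Hv// -EFinM => /ltW Hx xm.
  apply: le_trans Hx.
  rewrite -(@lebesgue_cV_shift _ _ x (B `&` _)); last first.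
    by apply: measurableI => //; exact: measurable_ellipsoid.
  apply: le_measure; rewrite ?inE.
  - exact: measurable_xsection.
  - by apply: measurable_preshift; apply: measurableI => //; exact: measurable_ellipsoid.
  move=> y; rewrite /xsection /= inE => -[/= _ [[[Bxy _] _] ry]]; split.
    by rewrite addrC.
  by rewrite /ellipsoid /= opprD addrCA subrr addr0 rhoN.
have L : ((3 / 4 * e * c)%:E <= \int[leb]_y (leb \o ysection W) y)%E.
  have -> : (3 / 4 * e * c)%:E = ((3 / 4 * c)%:E * leb [set y | (rho y < s j)%R])%E.
    by rewrite -(lebesgue_ellipsoid 0) Hv// -EFinM; congr (_%:E); rewrite mulrAC.
  rewrite -integral_cst//; last exact: (measurable_sublevel mrho).
  rewrite integral_mkcond; apply: ge0_le_integral => //.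
  - by move=> x _; rewrite patchE; case: ifP => // _; rewrite lee_fin mulr_ge0// ltW.
  - apply: (measurable_restrictT (cst (3 / 4 * c)%:E) _).1; last exact: measurable_cst.
    exact: (measurable_sublevel mrho).
  - exact: measurable_fun_ysection.
  move=> y _; rewrite patchE /=; case: ifPn => [|_]; last exact: measure_ge0.
  rewrite inE/= => ry.
  have yd : cube d y by apply: contrapT => /Hc'; rewrite leNgt (lt_trans ry sj).
  have := Hd y yd; rewrite -/M cE -leeBlDr// -EFinB.
  have -> : c - c / 4 = 3 / 4 * c by field.
  move=> /le_trans; apply; apply: le_measure; rewrite ?inE.
  - by apply: measurableI => //; exact: measurable_preshift.
  - exact: measurable_ysection.
  by move=> x [Mx Mxy]; rewrite /ysection /= inE.
have : ((3 / 4 * e * c)%:E <= (2^-1 * e * c)%:E)%E by apply: le_trans L _; rewrite -FG.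
rewrite lee_fin -!(mulrA _ e c) ler_pM2r ?mulr_gt0 ?powR_gt0//.
by move=> H; have : (3 / 4 : R) <= 2^-1 by []; lra.
Qed.

End quasi_distance_geometry.

(** * Integrals of nonnegative functions *)

Lemma le_poweR {R : realType} (p : R) (x y : \bar R) : 0 <= p ->
  (0 <= x)%E -> (x <= y)%E -> (x `^ p <= y `^ p)%E.
Proof.
move=> p0 x0 xy; apply: gt0_ler_poweR => //; rewrite in_itv /= ?x0 leey//.
by rewrite andbT (le_trans x0).
Qed.

Section nonnegative_integrals.
Local Open Scope ereal_scope.
Context d (X : measurableType d) (R : realType) (mu : {measure set X -> \bar R}).
Implicit Types (f g : X -> \bar R) (D : set X).

(* Unlike [ge0_le_integral], no measurability is required. *)
Lemma le_integral_ge0 D f g : (forall x, D x -> 0 <= f x) ->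
  (forall x, D x -> f x <= g x) -> \int[mu]_(x in D) f x <= \int[mu]_(x in D) g x.
Proof.
move=> f0 fg.
have g0 x : D x -> 0 <= g x by move=> Dx; apply: le_trans (f0 x Dx) (fg x Dx).
rewrite !ge0_integralE//; apply: le_ereal_sup => _ [h /= hf <-]; exists h => //= x.
apply: le_trans (hf x) _; rewrite !patchE; case: ifPn => [|//]; rewrite inE; exact: fg.
Qed.

Lemma le_integral_subset D E f : D `<=` E -> (forall x, E x -> 0 <= f x) ->
  \int[mu]_(x in D) f x <= \int[mu]_(x in E) f x.
Proof.
move=> DE f0; rewrite integral_mkcond [leRHS]integral_mkcond.
apply: le_integral_ge0 => x _; rewrite !patchE; case: ifPn; rewrite ?inE.
- by move=> Dx; apply: f0; exact: DE.
- by [].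
- by move=> Dx; rewrite ifT ?inE//; exact: DE.
- by move=> _; case: ifPn => //; rewrite inE; exact: f0.
Qed.

Lemma integral_le_nondecreasing D (F : (X -> \bar R)^nat) f c :
  measurable D -> (forall n, measurable_fun D (F n)) ->
  (forall n x, D x -> 0 <= F n x) ->
  (forall x, D x -> {homo F^~ x : m n / (m <= n)%N >-> m <= n}) ->
  (forall x, D x -> 0 <= f x) ->
  (forall x, D x -> f x <= limn (F^~ x)) ->
  (forall n, \int[mu]_(x in D) F n x <= c) -> \int[mu]_(x in D) f x <= c.
Proof.
move=> mD mF F0 nF f0 fF Fc.
apply: (@le_trans _ _ (\int[mu]_(x in D) limn (F^~ x))).
  exact: le_integral_ge0.
have := @cvg_monotone_convergence _ _ _ mu _ mD _ mF F0 nF => cF.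
rewrite -(cvg_lim _ cF)//; apply: lime_le; first by apply/cvgP: cF.
exact: nearW.
Qed.

(** Monotone convergence reduces an estimate to truncations. This provides a top level in layer-cake
    sums, and a finite left-hand side where a term has to be absorbed. *)
Lemma integral_poweR_trunc D f (p : R) (c : \bar R) : measurable D ->
  measurable_fun D f -> (forall x, D x -> 0 <= f x) -> (0 < p)%R ->
  (forall n : nat, \int[mu]_(x in D) (mine (f x) n%:R%:E) `^ p <= c) ->
  \int[mu]_(x in D) f x `^ p <= c.
Proof.
move=> mD mf f0 p0; apply: integral_le_nondecreasing => //.
- move=> n; apply: (measurableT_comp (measurable_poweR p)).
  by apply: measurable_mine.
- by move=> *; exact: poweR_ge0.
- move=> x Dx m n mn; apply: le_poweR; first exact: ltW.
    by rewrite le_min f0//= lee_fin.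
  by rewrite le_min ge_min lexx/= ge_min lee_fin ler_nat mn orbT.
- by move=> *; exact: poweR_ge0.
move=> x Dx; rewrite le_eqVlt; apply/orP; left; apply/eqP/esym/cvg_lim => //.
case: (f x) (f0 x Dx) => [r| |//] r0.
  apply: cvg_near_cst; exists (Num.truncn r).+1 => // n /= rn.
  have -> : mine r%:E n%:R%:E = r%:E; last by [].
  by apply/min_idPl; rewrite lee_fin ltW// (lt_le_trans (truncnS_gt _))// ler_nat.
rewrite poweRyr ?gt_eqF//.
under eq_fun do rewrite minEle leye_eq /= -/(poweR _ _).
apply/cvgeyPge => A; near=> n; rewrite lee_fin.
have : (`|A| `^ p^-1 <= n%:R)%R by near: n; exact: nbhs_infty_ger.
move=> /(ge0_ler_powR (ltW p0)); rewrite !nnegrE => /(_ (powR_ge0 _ _) (ler0n _ _)).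
by rewrite -powRrM mulVf ?gt_eqF// powRr1//; apply: le_trans; exact: ler_norm.
Unshelve. all: by end_near. Qed.

Lemma measure_bigcup_le (F : (set X)^nat) c : (forall n, measurable (F n)) ->
  (forall n, mu (\big[setU/set0]_(i < n) F i) <= c) -> mu (\bigcup_n F n) <= c.
Proof.
move=> mF Fc.
pose U n := \big[setU/set0]_(i < n.+1) F i.
have mU n : measurable (U n) by exact: bigsetU_measurable.
have nU : nondecreasing_seq U.
  by move=> i j ij; apply/subsetPset; apply: subset_bigsetU; rewrite ltnS.
have UE : \bigcup_n U n = \bigcup_n F n by exact: bigcup_bigsetU_bigcup.
have := @nondecreasing_cvg_mu _ _ _ mu U mU.
rewrite UE => /(_ (bigcup_measurable (fun i _ => mF i)) nU) cF.
rewrite -(cvg_lim _ cF)//; apply: lime_le; first by apply/cvgP: cF.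
by apply: nearW => n; exact: Fc.
Qed.

End nonnegative_integrals.

(** * Geometric sums over scales *)

Section geometric_sums.
Context {R : realType}.
Implicit Types (a e x y : R).

Lemma sum_geometric_le x n : 0 <= x < 1 -> \sum_(i < n) x ^+ i <= (1 - x)^-1.
Proof.
move=> /andP[x0 x1]; have x10 : 0 < 1 - x by rewrite subr_gt0.
elim: n => [|n IH]; first by rewrite big_ord0 invr_ge0 ltW.
rewrite big_ord_recl expr0 /=.
under eq_bigr do rewrite /bump /= add1n exprS.
rewrite -mulr_sumr; apply: le_trans (lerD (lexx 1) (ler_wpM2l x0 IH)) _.
by rewrite le_eqVlt; apply/orP; left; apply/eqP; field; rewrite gt_eqF.
Qed.

(* The level sum in the layer-cake decomposition over the levels [a * l ^ i]. *)
Lemma sum_geometric_below_le l e : 0 < l < 1 -> 0 < e ->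
  exists2 C, 0 < C & forall n a y, 0 < a -> 0 <= y ->
  \sum_(i < n) (a * l ^+ i) `^ e *+ (a * l ^+ i < y)%R <= C * y `^ e.
Proof.
move=> /andP[l0 l1] e0; set x := (l `^ e : R).
have x01 : 0 <= x < 1.
  have -> : (1 : R) = 1 `^ e by rewrite powR1.
  by rewrite powR_ge0 /=; apply: gt0_ltr_powR => //; rewrite nnegrE// ltW.
have x10 : 0 < 1 - x by case/andP: x01 => _; rewrite subr_gt0.
exists (1 - x)^-1; first by rewrite invr_gt0.
elim=> [|n IH] a y a0 y0.
  by rewrite big_ord0 mulr_ge0 ?powR_ge0// invr_ge0 ltW.
have [ay|ya] := ltP a y; last first.
  rewrite big_ord_recl expr0 mulr1 ltNge ya mulr0n add0r.
  under eq_bigr do rewrite lift0 exprS mulrA.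
  by apply: IH => //; rewrite mulr_gt0.
apply: (@le_trans _ _ (\sum_(i < n.+1) a `^ e * x ^+ i)).
  apply: ler_sum => i _.
  have -> : (a * l ^+ i) `^ e = a `^ e * x ^+ i.
    rewrite powRM ?exprn_ge0// ?ltW//; congr (_ * _).
    rewrite -[x ^+ i]powR_mulrn ?powR_ge0// -powRrM mulrC powRrM.
    by rewrite powR_mulrn// ltW.
  case: ltP => _; rewrite ?mulr1n// mulr0n mulr_ge0 ?powR_ge0// exprn_ge0//.
  exact: powR_ge0.
rewrite -mulr_sumr mulrC; apply: ler_pM; rewrite ?powR_ge0//.
- by apply: sumr_ge0 => i _; rewrite exprn_ge0// powR_ge0.
- exact: sum_geometric_le.
- by apply: ge0_ler_powR; rewrite ?nnegrE //; exact: ltW.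
Qed.

(** The terms grow with [i] until [a * l ^+ i] drops to 1, so the sum is controlled by its last
    term, uniformly in [a]. *)
Lemma sum_geometric_above_le l e : 0 < l < 1 -> 0 < e ->
  exists2 C, 0 < C & forall n a, 0 < a ->
  \sum_(i < n) (a * l ^+ i) `^ (- e) *+ (1 < a * l ^+ i)%R <= C.
Proof.
move=> /andP[l0 l1] e0; set x := (l `^ (- e) : R).
have x1 : 1 < x.
  rewrite /x powRN -[ltLHS]invr1 ltf_pV2 ?posrE ?powR_gt0//.
  have -> : (1 : R) = 1 `^ e by rewrite powR1.
  by apply: gt0_ltr_powR => //; rewrite nnegrE// ltW.
pose D := (x - 1)^-1; have D0 : 0 < D by rewrite invr_gt0 subr_gt0.
(* The correction [- D * a ^ (- e)] absorbs the first term in the induction. *)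
have H n : forall a, 1 < a -> \sum_(i < n) (a * l ^+ i) `^ (- e) *+ (1 < a * l ^+ i)%R <=
    1 + D - D * a `^ (- e).
  elim: n => [|n IH] a a1; have a0 : 0 < a by apply: lt_trans a1.
    have ae1 : a `^ (- e) <= 1.
      rewrite powRN -[leRHS]invr1 lef_pV2 ?posrE ?powR_gt0//.
      have -> : (1 : R) = 1 `^ e by rewrite powR1.
      by apply: ge0_ler_powR; rewrite ?nnegrE//; exact: ltW.
    rewrite big_ord0 -addrA -{1}[D]mulr1 -mulrBr addr_ge0// mulr_ge0 ?subr_ge0//.
    exact: ltW.
  rewrite big_ord_recl expr0 mulr1 a1 mulr1n.
  under eq_bigr do rewrite lift0 exprS mulrA.
  have ae0 : 0 <= a `^ (- e) by exact: powR_ge0.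
  have [al1|al1] := ltP 1 (a * l); last first.
    rewrite big1 ?addr0; last first.
      move=> i _; rewrite ltNge (le_trans _ al1)//.
      by rewrite ler_piMr ?mulr_ge0 ?exprn_ile1// ltW.
    have ae1 : a `^ (- e) <= 1.
      rewrite powRN -[leRHS]invr1 lef_pV2 ?posrE ?powR_gt0//.
      have -> : (1 : R) = 1 `^ e by rewrite powR1.
      by apply: ge0_ler_powR; rewrite ?nnegrE//; exact: ltW.
    by move: D0 ae1 ae0; nra.
  apply: le_trans (lerD (lexx _) (IH _ al1)) _.
  rewrite powRM; [|exact: ltW|exact: ltW]; rewrite -/x.
  have -> : D * (a `^ (- e) * x) = D * a `^ (- e) + a `^ (- e).
    by rewrite /D; field; rewrite subr_eq0 gt_eqF.
  lra.
exists (1 + D) => [|n a a0]; first by rewrite addr_gt0.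
have [a1|a1] := ltP 1 a.
  apply: le_trans (H n a a1) _; rewrite lerBlDr lerDl mulr_ge0 ?powR_ge0//.
  exact: ltW.
rewrite big1 => [|i _]; first by rewrite addr_ge0// ltW.
rewrite ltNge (le_trans _ a1)// ler_piMr ?exprn_ile1//; exact: ltW.
Qed.

(** The summation in Hedberg's inequality: one bound increases with the scale and the other
    decreases, so the sum of their minima is comparable with the common value at the radius where
    they cross. *)
Lemma sum_min_le (al be l : R) : 0 < al -> 0 < be -> 0 < l < 1 ->
  exists2 K, 0 < K & forall n r m N, 0 < r -> 0 <= m -> 0 < N ->
  \sum_(i < n) Num.min (m * (r * l ^+ i) `^ al) (N * (r * l ^+ i) `^ (- be)) <=
    K * (m `^ (be / (al + be)) * N `^ (1 - be / (al + be))).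
Proof.
move=> al0 be0 l01; have [l0 _] := andP l01.
have [C1 C10 H1] := sum_geometric_below_le l01 al0.
have [C2 C20 H2] := sum_geometric_above_le l01 be0.
have k0 : 0 < al + be by rewrite addr_gt0.
have th0 : 0 < be / (al + be) by rewrite divr_gt0.
exists (C1 * 2 `^ al + C2); first by rewrite addr_gt0// mulr_gt0// powR_gt0.
move=> n r m N r0; rewrite le_eqVlt => /predU1P[<-|m0] N0.
  rewrite powR0 ?gt_eqF// mul0r mulr0 big1// => i _; rewrite mul0r.
  by apply/min_idPl; rewrite mulr_ge0 ?powR_ge0// ltW.
(* [r1] is the radius at which the two bounds agree. *)
pose r1 := (N / m) `^ (al + be)^-1.
have r10 : 0 < r1 by rewrite powR_gt0// divr_gt0.
pose t := r / r1; have t0 : 0 < t by rewrite divr_gt0.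
have tE i : r * l ^+ i = r1 * (t * l ^+ i) by rewrite /t; field; rewrite gt_eqF.
have r1k : r1 `^ (al + be) = N / m.
  by rewrite /r1 -powRrM mulVf ?gt_eqF// powRr1// divr_ge0// ltW.
set M := m `^ _ * N `^ _.
have M1 : m * r1 `^ al = M.
  have -> : al = (al + be) * (1 - be / (al + be)) by field; rewrite gt_eqF.
  rewrite powRrM r1k powRM ?invr_ge0; [|exact: ltW|exact: ltW].
  rewrite -[m^-1]powR_inv1; last exact: ltW.
  rewrite -powRrM mulrCA -{1}(powRr1 (ltW m0)) -powRD; last by rewrite (gt_eqF m0) implybT.
  rewrite mulrC /M; congr (_ `^ _ * _ `^ _); field; rewrite ?gt_eqF//.
have M2 : N * r1 `^ (- be) = M.
  rewrite -M1 powRN; apply: (@mulIf _ (r1 `^ be)); first by rewrite gt_eqF// powR_gt0.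
  have rb : r1 `^ be != 0 by rewrite gt_eqF// powR_gt0.
  rewrite (divfK rb) -(mulrA m) -powRD; last by rewrite (gt_eqF r10) implybT.
  by rewrite r1k mulrCA mulfV ?mulr1// gt_eqF.
have M0 : 0 <= M by rewrite mulr_ge0 ?powR_ge0.
have tl0 i : 0 < t * l ^+ i by rewrite mulr_gt0// exprn_gt0.
(* The cut-off in [sum_geometric_below_le] is strict; taking it at 2 includes the scale equal to
   1. *)
apply: (@le_trans _ _ (\sum_(i < n) M * ((t * l ^+ i) `^ al *+ (t * l ^+ i < 2)%R +
    (t * l ^+ i) `^ (- be) *+ (1 < t * l ^+ i)%R))).
  apply: ler_sum => i _; have tli := ltW (tl0 i).
  rewrite tE (powRM al (ltW r10) tli) (powRM (- be) (ltW r10) tli) !mulrA.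
  rewrite M1 M2.
  rewrite ge_min; have [t1|t1] := ltP 1 (t * l ^+ i).
    apply/orP; right; apply: ler_wpM2l => //; rewrite mulr1n lerDr.
    by rewrite mulrn_wge0// powR_ge0.
  apply/orP; left; apply: ler_wpM2l => //.
  by rewrite mulr0n addr0 (le_lt_trans t1) ?ltr1n// mulr1n.
rewrite -mulr_sumr mulrC; apply: ler_wpM2r => //.
rewrite big_split /=; apply: lerD; last exact: H2.
exact: H1.
Qed.

End geometric_sums.

(** * Homogeneous spaces and Vitali coverings *)

Definition qball {X : Type} {R : realType} (d : X -> X -> R) (x : X) (r : R) : set X :=
  [set y | d x y < r].

(** The interface between the geometry of rho and the harmonic analysis: maximal function and
    John-Nirenberg inequality are derived from these fields. [hs_density] stands in for Lebesgue
    differentiation; [hs_dense] makes countably many balls suffice. *)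
Record homogeneous_space disp (X : measurableType disp) (R : realType)
    (mu : {sigma_finite_measure set X -> \bar R}) (d : X -> X -> R) (k g v : R)
    (c : nat -> X) : Prop := HomogeneousSpace {
  hs_measurable : measurable_fun [set: X * X] (fun z => d z.1 z.2) ;
  hs_sym : forall x y, d x y = d y x ;
  hs_refl : forall x, d x x = 0 ;
  hs_ge0 : forall x y, 0 <= d x y ;
  hs_k : 1 <= k ;
  hs_triangle : forall x y z, d x y <= k * (d x z + d z y) ;
  hs_g : 0 < g ;
  hs_v : 0 < v ;
  hs_volume : forall x r, 0 < r -> mu (qball d x r) = (v * r `^ g)%:E ;
  hs_dense : forall x r, 0 < r -> exists i, d x (c i) < r ;
  hs_density : forall (B : set X) (s : nat -> R), measurable B ->
    (forall j, 0 < s j) -> (forall e, 0 < e -> exists j, s j < e) ->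
    mu.-negligible [set x | B x /\ forall j, (mu (B `&` qball d x (s j))
      < 2^-1%:E * mu (qball d x (s j)))%E] }.

Section covering.
Context disp (X : measurableType disp) (R : realType)
  (mu : {sigma_finite_measure set X -> \bar R}) (d : X -> X -> R) (k g v : R)
  (c : nat -> X).
Hypothesis HS : homogeneous_space mu d k g v c.
Variable L : R.
Hypothesis kL : 4 * k ^+ 2 <= L.

Let k1 := hs_k HS.
Let v0 := hs_v HS.
Let g0 := hs_g HS.

Lemma L_gt1 : 1 < L.
Proof.
apply: lt_le_trans kL; have : 1 <= k ^+ 2 by rewrite exprn_ege1.
lra.
Qed.

Let L0 : 0 < L. Proof. by apply: lt_trans L_gt1. Qed.

Lemma qtriangle x y z r s : d x z < r -> d z y < s -> d x y < k * (r + s).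
Proof.
move=> xz zy; apply: le_lt_trans (hs_triangle HS x y z) _.
by rewrite ltr_pM2l ?ltrD// (lt_le_trans _ k1).
Qed.

Lemma qball_sym x y r : qball d x r y = qball d y r x.
Proof. by rewrite /qball /= (hs_sym HS). Qed.

Lemma measurable_qball x r : measurable (qball d x r).
Proof.
have m1 : measurable_fun [set: X] (fun y => (x, y)).
  by apply/measurable_fun_pair => //; exact: measurable_cst.
rewrite (_ : qball d x r = (fun y => d x y) @^-1` `]-oo, r[%classic); last first.
  by apply/seteqP; split => y /=; rewrite in_itv.
rewrite -[X in measurable X]setTI.
exact: (measurableT_comp (hs_measurable HS) m1).
Qed.

Lemma qball_fin x r : (mu (qball d x r) < +oo)%E.
Proof.
have [r0|r0] := ltP 0 r; first by rewrite (hs_volume HS)// ltry.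
rewrite (_ : qball d x r = set0) ?measure0//; apply/seteqP; split => // y.
rewrite /qball /= => xy; have := hs_ge0 HS x y.
by rewrite leNgt (lt_le_trans xy).
Qed.

Lemma mu_qball_scale x y r t : 0 < r -> 0 < t ->
  mu (qball d x (t * r)) = ((t `^ g)%:E * mu (qball d y r))%E.
Proof.
move=> r0 t0; rewrite !(hs_volume HS)//; last by rewrite mulr_gt0.
by rewrite powRM ?ltW// -EFinM mulrCA.
Qed.

(** Decodes a number into a centre of the dense sequence and an exponent [j] for the radius L^j. The
    standard balls are thus a sequence, which makes suprema over them measurable and turns coverings
    into limits of finite ones. Numbers that encode nothing are read as (0, 0). *)
Definition index (m : nat) : nat * int := odflt (0%N, 0) (unpickle m).
Definition radius (m : nat) : R := L ^ (index m).2.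
Definition stdball (m : nat) : set X := qball d (c (index m).1) (radius m).
Definition dilball (m : nat) : set X := qball d (c (index m).1) (L * radius m).

Lemma stdballE m : stdball m = qball d (c (index m).1) (radius m). Proof. by []. Qed.

Lemma radius_gt0 m : 0 < radius m. Proof. exact: exprz_gt0. Qed.

Lemma measurable_stdball m : measurable (stdball m). Proof. exact: measurable_qball. Qed.
Lemma measurable_dilball m : measurable (dilball m). Proof. exact: measurable_qball. Qed.

Lemma mu_dilball m : mu (dilball m) = ((L `^ g)%:E * mu (stdball m))%E.
Proof. exact: mu_qball_scale (radius_gt0 m) L0. Qed.

Lemma mu_stdball_gt0 m : (0 < mu (stdball m))%E.
Proof.
by rewrite /stdball (hs_volume HS) ?radius_gt0// lte_fin mulr_gt0// powR_gt0 ?radius_gt0.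
Qed.

Lemma stdball_dil m : exists m', stdball m' = dilball m /\ radius m' = L * radius m.
Proof.
exists (pickle ((index m).1, (index m).2 + 1)).
have E : index (pickle ((index m).1, (index m).2 + 1)) = ((index m).1, (index m).2 + 1).
  by rewrite /index pickleK.
have RE : radius (pickle ((index m).1, (index m).2 + 1)) = L * radius m.
  by rewrite /radius E /= exprzDr ?unitfE ?gt_eqF// expr1z mulrC.
by split => //; rewrite /stdball /dilball RE E.
Qed.

(** Two uses of the quasi-triangle inequality cost the factor k + 2k^2, which is at most [L]. *)
Lemma stdball_meet i j : radius i <= radius j -> stdball i `&` stdball j !=set0 ->
  stdball i `<=` dilball j.
Proof.
move=> ij [z [zi zj]] y yi; rewrite /dilball /qball /=.
have k0 : 0 < k by apply: lt_le_trans k1.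
have zy : d z y < k * (radius j + radius j).
  by apply: (@qtriangle _ _ (c (index i).1)); [rewrite (hs_sym HS)|]; apply: lt_le_trans ij.
apply: lt_le_trans (qtriangle zj zy) _.
have -> : k * (radius j + k * (radius j + radius j)) = (k + 2 * k ^+ 2) * radius j by ring.
rewrite ler_pM2r ?radius_gt0//; apply: le_trans kL.
have : k <= k ^+ 2 by rewrite expr2 ler_peMr// ltW.
have : 0 <= k ^+ 2 by rewrite exprn_ge0// ltW.
lra.
Qed.

(* Every ball is contained in a standard ball of comparable size. *)
Lemma qball_sub_stdball x (j : int) : exists m,
  [/\ stdball m x, qball d x (L ^ j) `<=` stdball m & radius m = L ^ (j + 1)].
Proof.
have Lj0 : 0 < L ^ j by exact: exprz_gt0.
have [i xi] := hs_dense HS x Lj0.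
have E : index (pickle (i, j + 1)) = (i, j + 1) by rewrite /index pickleK.
have kk : k <= k ^+ 2 by rewrite expr2 ler_peMr// (le_trans _ k1).
have kL2 : 2 * k <= L by apply: le_trans kL; move: k1; lra.
have kLj : k * (L ^ j + L ^ j) <= L ^ (j + 1).
  rewrite exprzDr ?unitfE ?gt_eqF// expr1z (_ : k * _ = (2 * k) * L ^ j); last by ring.
  by rewrite [leRHS]mulrC ler_pM2r.
exists (pickle (i, j + 1)); rewrite /stdball /radius E /=; split => //.
  rewrite /qball /= (hs_sym HS); apply: lt_le_trans xi _.
  rewrite exprzDr ?unitfE ?gt_eqF// expr1z ler_peMr//; [exact: ltW|exact/ltW/L_gt1].
move=> y xy; rewrite /qball /=; apply: lt_le_trans kLj.
by apply: qtriangle xy; rewrite (hs_sym HS).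
Qed.

(** Greedy selection: keep a ball of largest radius, drop every ball that meets it, as these lie in
    its dilate, and recurse on the rest. *)
Lemma vitali (s : seq nat) : exists s', [/\ uniq s', {subset s' <= s},
  trivIset [set` s'] stdball & \bigcup_(i in [set` s]) stdball i `<=`
     \bigcup_(i in [set` s']) dilball i].
Proof.
have [m] := ubnP (size s); elim: m s => // m IH [_|i0 s sm].
  by exists [::]; split => //; rewrite set_nil bigcup_set0.
have [i is_ imax] : exists2 i, i \in i0 :: s & forall j, j \in i0 :: s -> radius j <= radius i.
  elim: s i0 {sm} => [|j s IHs] i0.
    by exists i0; rewrite ?inE// => j; rewrite inE => /eqP ->.
  have [i is_ Hi] := IHs j.
  have [i0i|/ltW ii0] := leP (radius i0) (radius i).
    exists i; first by rewrite inE is_ orbT.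
    by move=> l; rewrite inE => /orP[/eqP -> //|]; exact: Hi.
  exists i0; first by rewrite mem_head.
  move=> l; rewrite inE => /orP[/eqP -> //|/Hi]; move/le_trans; exact.
pose t := [seq j <- i0 :: s | `[< stdball j `&` stdball i = set0 >]].
have ci : stdball i (c (index i).1).
  by rewrite /stdball /qball /= (hs_refl HS) radius_gt0.
have tm : (size t < m)%N.
  rewrite -ltnS; apply: leq_trans sm; rewrite ltnS size_filter.
  rewrite -(count_predC (fun j => `[< stdball j `&` stdball i = set0 >]) (i0 :: s)) -addn1 leq_add2l.
  rewrite -has_count; apply/hasP; exists i => //=; apply/asboolP => E.
  by have : (stdball i `&` stdball i) (c (index i).1) by []; rewrite E.
have [s' [us' st tr cov]] := IH t tm.
have tP j : j \in t -> j \in i0 :: s /\ stdball j `&` stdball i = set0.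
  by rewrite mem_filter => /andP[/asboolP].
exists (i :: s'); split.
- rewrite /= us' andbT; apply/negP => /st/tP[_ E].
  by have : (stdball i `&` stdball i) (c (index i).1) by []; rewrite E.
- by move=> j; rewrite inE => /orP[/eqP -> //|/st/tP[]].
- apply/trivIsetP => p q; rewrite /= !inE => /orP[/eqP ->|ps] /orP[/eqP ->|qs]; rewrite ?eqxx//.
  + by move=> _; rewrite setIC; have [_ ->] := tP _ (st _ qs).
  + by move=> _; have [_ ->] := tP _ (st _ ps).
  + by move=> pq; move/trivIsetP: tr; apply.
move=> x [j /= js jx].
have [E|NE] := pselect (stdball j `&` stdball i = set0).
  have jt : j \in t by rewrite mem_filter js andbT; apply/asboolP.
  have [l /= ls lx] : (\bigcup_(i in [set` s']) dilball i) x by apply: cov; exists j.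
  by exists l => //=; rewrite inE ls orbT.
exists i => /=; first by rewrite mem_head.
by move: jx; apply: stdball_meet; [exact: imax|exact/set0P/eqP].
Qed.

Local Open Scope ereal_scope.

(** [th] bounds the share of [Z] in the dilated balls. With [Z] the whole space and th = 1 this is
    the covering estimate behind the weak type inequality; with [Z] a level set of an oscillation it
    is the induction step of the John-Nirenberg inequality. *)
Lemma vitali_sum (f : X -> \bar R) (lam : R) (s : seq nat) (Z : set X) (th : R) :
  measurable_fun setT f -> (forall x, 0 <= f x) -> (0 < lam)%R -> measurable Z -> (0 <= th)%R ->
  (forall i, i \in s -> lam%:E * mu (stdball i) <= \int[mu]_(x in stdball i) f x) ->
  (forall i, i \in s -> mu (dilball i `&` Z) <= th%:E * mu (dilball i)) ->
  mu (\bigcup_(i in [set` s]) stdball i `&` Z) <= (th * L `^ g / lam)%:E * \int[mu]_x f x.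
Proof.
move=> mf f0 lam0 mZ th0 Hs HZ.
have [s' [us' ss' tr cov]] := vitali s.
have mD i : measurable (dilball i `&` Z) by apply: measurableI => //; exact: measurable_dilball.
have fs (F : nat -> set X) (t : seq nat) : \bigcup_(i in [set` t]) F i = \big[setU/set0]_(i <- t) F i.
  by rewrite bigcup_seq.
apply: (@le_trans _ _ (mu (\big[setU/set0]_(i <- s') (dilball i `&` Z)))).
  apply: le_measure; rewrite ?inE.
  - apply: measurableI => //; rewrite fs; apply: bigsetU_measurable => i _.
    exact: measurable_stdball.
  - by apply: bigsetU_measurable => i _; exact: mD.
  by move=> x [/cov [i is_ xi] Zx]; rewrite -fs; exists i.
apply: (@le_trans _ _ (\sum_(i <- s') mu (dilball i `&` Z))).
  elim: (s') => [|i t IH]; first by rewrite !big_nil measure0.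
  rewrite !big_cons; apply: (@le_trans _ _ (mu (dilball i `&` Z) +
    mu (\big[setU/set0]_(j <- t) (dilball j `&` Z)))); last exact: leeD.
  apply: measureU2 => //.
  by apply: bigsetU_measurable => j _; exact: mD.
apply: (@le_trans _ _ (\sum_(i <- s') (th * L `^ g / lam)%:E * \int[mu]_(x in stdball i) f x)).
  rewrite big_seq [leRHS]big_seq; apply: lee_sum => i /ss' is_.
  apply: le_trans (HZ i is_) _.
  rewrite mu_dilball -mulrA EFinM -muleA lee_wpmul2l ?lee_fin//.
  by rewrite EFinM -muleA lee_wpmul2l ?lee_fin ?powR_ge0// lee_pdivlMl//; exact: Hs.
rewrite -ge0_sume_distrr; last first.
  by move=> i _; apply: integral_ge0.
apply: lee_wpmul2l; first by rewrite lee_fin divr_ge0 ?mulr_ge0 ?powR_ge0// ltW.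
rewrite -ge0_integral_bigsetU//=.
- exact: le_integral_subset.
- by move=> i; exact: measurable_stdball.
- exact: measurable_funTS.
Qed.

Lemma vitali_cover (f : X -> \bar R) (lam : R) (I : set nat) (Z : set X) (th : R) :
  measurable_fun setT f -> (forall x, 0 <= f x) -> (0 < lam)%R -> measurable Z -> (0 <= th)%R ->
  (forall i, I i -> lam%:E * mu (stdball i) <= \int[mu]_(x in stdball i) f x) ->
  (forall i, I i -> mu (dilball i `&` Z) <= th%:E * mu (dilball i)) ->
  mu (\bigcup_(i in I) stdball i `&` Z) <= (th * L `^ g / lam)%:E * \int[mu]_x f x.
Proof.
move=> mf f0 lam0 mZ th0 HI HZ.
pose F i := if i \in I then stdball i `&` Z else set0.
have mF i : measurable (F i).
  rewrite /F; case: ifP => // _; apply: measurableI => //; exact: measurable_stdball.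
have -> : \bigcup_(i in I) stdball i `&` Z = \bigcup_i F i.
  apply/seteqP; split => x.
    by move=> [[i Ii xi] Zx]; exists i => //; rewrite /F mem_set.
  by move=> [i _]; rewrite /F; case: ifPn => //; rewrite inE => Ii [xi Zx]; split => //; exists i.
apply: measure_bigcup_le => // n.
pose s := [seq i <- iota 0 n | i \in I].
have -> : \big[setU/set0]_(i < n) F i = \bigcup_(i in [set` s]) stdball i `&` Z.
  rewrite -bigcup_mkord; apply/seteqP; split => x.
    move=> [i /= ni]; rewrite /F; case: ifPn => // iI [xi Zx]; split => //.
    by exists i => //=; rewrite mem_filter iI mem_iota.
  move=> [[i /=]]; rewrite mem_filter mem_iota /= => /andP[iI ni] xi Zx.
  by exists i => //; rewrite /F iI.
by apply: vitali_sum => // i; rewrite mem_filter => /andP[/set_mem Ii _]; [exact: HI|exact: HZ].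
Qed.

End covering.

(** * The Hardy-Littlewood maximal function *)

Section maximal_function.
Local Open Scope ereal_scope.
Context disp (X : measurableType disp) (R : realType)
  (mu : {sigma_finite_measure set X -> \bar R}) (d : X -> X -> R) (k g v : R)
  (c : nat -> X).
Hypothesis HS : homogeneous_space mu d k g v c.
Variable L : R.
Hypothesis kL : (4 * k ^+ 2 <= L)%R.
Local Notation stdball := (stdball d c L).
Local Notation dilball := (dilball d c L).
Implicit Types f : X -> \bar R.

Definition average (f : X -> \bar R) (m : nat) : \bar R :=
  (fine (mu (stdball m)))^-1%:E * \int[mu]_(x in stdball m) f x.

(** The supremum runs over standard balls containing [x], hence is countable and measurable;
    [qball_integral_le] recovers arbitrary balls up to a constant. *)
Definition maximal (f : X -> \bar R) (x : X) : \bar R :=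
  esups (fun m => average f m * (\1_(stdball m) x)%:E) 0%N.

Let L0 : (0 < L)%R. Proof. by apply: lt_trans (L_gt1 HS kL). Qed.

Lemma mu_stdball_fin m : mu (stdball m) \is a fin_num.
Proof. by rewrite ge0_fin_numE// (qball_fin HS). Qed.

Lemma fine_mu_stdball_gt0 m : (0 < fine (mu (stdball m)))%R.
Proof.
by apply: fine_gt0; rewrite (mu_stdball_gt0 HS kL) -ge0_fin_numE ?mu_stdball_fin.
Qed.

Lemma average_ge0 f m : (forall x, 0 <= f x) -> 0 <= average f m.
Proof.
move=> f0; apply: mule_ge0; last by apply: integral_ge0.
by rewrite lee_fin invr_ge0 ltW// fine_mu_stdball_gt0.
Qed.

Lemma integral_stdball f m :
  \int[mu]_(x in stdball m) f x = mu (stdball m) * average f m.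
Proof.
rewrite /average muleA -{1}(fineK (mu_stdball_fin m)) -EFinM mulfV ?mul1e//.
by rewrite gt_eqF// fine_mu_stdball_gt0.
Qed.

Lemma measurable_maximal f : measurable_fun setT (maximal f).
Proof.
apply: measurable_fun_esups => m; apply: emeasurable_funM => //.
apply/measurable_EFinP; apply: measurable_indic; exact: (measurable_stdball HS).
Qed.

Lemma maximal_ge0 f x : (forall x, 0 <= f x) -> 0 <= maximal f x.
Proof.
move=> f0; apply: le_trans (ereal_sup_ubound _); last by exists 0%N.
by apply: mule_ge0; [exact: average_ge0|rewrite lee_fin].
Qed.

Lemma average_le_maximal f m x : stdball m x -> average f m <= maximal f x.
Proof.
move=> mx; apply: ereal_sup_ubound; exists m => //=.
by rewrite indicE mem_set// mule1.
Qed.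

Lemma lt_maximal f x (lam : R) : (0 <= lam)%R -> lam%:E < maximal f x ->
  exists2 m, stdball m x & lam%:E < average f m.
Proof.
move=> lam0 /ereal_sup_gt[_ [m _ <-]]; rewrite indicE.
case: (boolP (x \in stdball m)) => [|_]; last by rewrite mule0 lte_fin ltNge lam0.
by rewrite inE mule1; exists m.
Qed.

Lemma scale_exists (r : R) : (0 < r)%R -> exists j : int, (r <= L ^ j < L * r)%R.
Proof.
move=> r0; have L1 := L_gt1 HS kL.
have lnL : (0 < ln L)%R by exact: ln_gt0.
exists (Num.ceil (ln r / ln L)).
set j := Num.ceil _.
have E : (L ^ j = expR (j%:~R * ln L))%R.
  by rewrite -powR_intmul ?ltW// /powR gt_eqF.
rewrite -[in X in (X <= _)%R](lnK r0) E ler_expR -ler_pdivrMr// ceil_ge//=.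
rewrite -[ltRHS](@lnK R (L * r)%R) ?posrE ?mulr_gt0// ltr_expR lnM ?posrE//.
rewrite -ltrBDl -[X in (_ - X < _)%R]mul1r -mulrBl -ltr_pdivlMr//.
by have := @ceilB1_lt R (ln r / ln L)%R; rewrite intrB.
Qed.

(** The ball lies in a standard ball that contains [x] and has radius below L^2 r. *)
Lemma qball_integral_le x (r : R) f : (0 < r)%R -> (forall x, 0 <= f x) ->
  \int[mu]_(y in qball d x r) f y <= (v * (L ^+ 2 * r) `^ g)%:E * maximal f x.
Proof.
move=> r0 f0; have [j /andP[rj jr]] := scale_exists r0.
have [m [mx sub rm]] := qball_sub_stdball HS kL x j.
have sub' : qball d x r `<=` stdball m.
  by move=> y xy; apply: sub; apply: lt_le_trans rj.
apply: le_trans (le_integral_subset mu sub' (fun y _ => f0 y)) _.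
rewrite integral_stdball; apply: lee_pmul => //; first exact: average_ge0.
- have Lm0 := radius_gt0 HS kL m; rewrite (hs_volume HS)// lee_fin.
  rewrite ler_pM2l ?(hs_v HS)//; apply: ge0_ler_powR; rewrite ?nnegrE ?ltW ?(hs_g HS)//.
  + by rewrite mulr_gt0// exprn_gt0.
  + rewrite rm exprzDr ?unitfE ?gt_eqF// expr1z mulrC expr2 -mulrA ltr_pM2l//.
- exact: average_le_maximal.
Qed.

(** The part of [f] below lam/2 contributes at most lam/2 to any average. So a ball with average
    above [lam] still has average at least lam/2 after [f] is cut to the set where it exceeds lam/2,
    and the Vitali estimate applies to the cut function. *)
Lemma maximal_weak f (lam : R) : measurable_fun setT f -> (forall x, 0 <= f x) ->
  (0 < lam)%R ->
  mu [set x | lam%:E < maximal f x] <=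
    (2 * L `^ g / lam)%:E * \int[mu]_(x in [set x | (lam / 2)%:E < f x]) f x.
Proof.
move=> mf f0 lam0; set A := [set x | (lam / 2)%:E < f x].
have mA : measurable A.
  rewrite (_ : A = f @^-1` `](lam / 2)%:E, +oo[%classic).
    by rewrite -[X in measurable X]setTI; apply: mf => //; exact: emeasurable_itv.
  by apply/seteqP; split => x /=; rewrite in_itv/= andbT.
have lam20 : (0 < lam / 2)%R by rewrite divr_gt0.
pose I := [set m | lam%:E < average f m].
have mh : measurable_fun setT (f \_ A).
  by apply: (measurable_restrictT _ _).1 => //; exact: measurable_funTS.
have h0 x : 0 <= (f \_ A) x by rewrite patchE; case: ifP.
have HI m : I m -> (lam / 2)%:E * mu (stdball m) <= \int[mu]_(x in stdball m) (f \_ A) x.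
  move=> Im; have mB := measurable_stdball HS L m.
  have H1 : lam%:E * mu (stdball m) <= \int[mu]_(x in stdball m) f x.
    by rewrite integral_stdball muleC; apply: lee_wpmul2l => //; exact: ltW.
  have H2 : \int[mu]_(x in stdball m) f x <=
      \int[mu]_(x in stdball m) (f \_ A) x + (lam / 2)%:E * mu (stdball m).
    rewrite -integral_cst// -ge0_integralD//; last 2 first.
    - exact: measurable_funTS.
    - by move=> *; rewrite lee_fin ltW.
    apply: le_integral_ge0 => // x _; rewrite patchE; case: ifPn => xA.
      by rewrite leeDl// lee_fin ltW.
    by rewrite add0e leNgt; apply: contra xA; rewrite inE.
  have := le_trans H1 H2; rewrite -(fineK (mu_stdball_fin m)) -!EFinM.
  rewrite -leeBlDr// -EFinB; apply: le_trans; rewrite lee_fin -mulrBl.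
  by have -> : (lam - lam / 2 = lam / 2)%R by field.
have := vitali_cover HS kL (I := I) (Z := setT) (th := 1%R) mh h0 lam20 measurableT ler01 HI.
rewrite setIT mul1r => H.
apply: (@le_trans _ _ (mu (\bigcup_(i in I) stdball i))).
  apply: le_measure; rewrite ?inE.
  - rewrite (_ : [set _ | _] = maximal f @^-1` `]lam%:E, +oo[%classic).
      rewrite -[X in measurable X]setTI; apply: measurable_maximal => //.
      exact: emeasurable_itv.
    by apply/seteqP; split => x /=; rewrite in_itv/= andbT.
  - apply: bigcup_measurable => m _; exact: (measurable_stdball HS).
  - by move=> x /(lt_maximal (ltW lam0))[m mx Im]; exists m.
apply: le_trans (H _) _; first by move=> i _; rewrite setIT mul1e.
rewrite -integral_mkcond; apply: lee_wpmul2r.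
  by apply: integral_ge0.
by rewrite lee_fin invfM invrK mulrA (mulrC 2%R) mulrAC.
Qed.

Lemma dyadic_level (a y : R) : (0 < y)%R -> (y <= a)%R ->
  exists i, (a * 2^-1 ^+ i.+1 < y)%R /\ (y <= a * 2^-1 ^+ i)%R.
Proof.
move=> y0 ya; have a0 : (0 < a)%R by apply: lt_le_trans ya.
have H : exists i, (a * 2^-1 ^+ i.+1 < y)%R.
  exists (Num.truncn (a / y)); rewrite exprVn -ltr_pdivlMr ?invr_gt0 ?exprn_gt0//.
  rewrite invrK mulrC -ltr_pdivrMr//; apply: lt_trans (truncnS_gt _) _.
  by rewrite -natrX ltr_nat ltn_expl.
case: (ex_minnP H) => -[|i] Hi Hm; first by exists 0%N; rewrite expr0 mulr1.
exists i.+1; split => //; rewrite leNgt; apply/negP => /Hm.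
by rewrite ltnn.
Qed.

(** Layer cake over dyadic levels. The weak type bound at each level, summed under the integral,
    leaves for each [x] the sum of lev^(p-1) over the levels below 4 f(x); this geometric sum is
    comparable with f(x)^(p-1) because p > 1. *)
Lemma maximal_strong (p : R) : (1 < p)%R -> exists2 C : R, (0 < C)%R &
  forall f, measurable_fun setT f -> (forall x, 0 <= f x) ->
  \int[mu]_x (maximal f x) `^ p <= C%:E * \int[mu]_x f x `^ p.
Proof.
move=> p1; have p10 : (0 < p - 1)%R by rewrite subr_gt0.
have p0 : (0 < p)%R by apply: lt_trans p1.
have h01 : (0 < (2^-1 : R) < 1)%R by rewrite invr_gt0 ltr0n invf_lt1 ?ltr1n.
have [C0 C00 HC0] := sum_geometric_below_le h01 p10.
have Lg0 : (0 < L `^ g)%R by rewrite powR_gt0.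
pose C := (4 * L `^ g * (C0 * 4 `^ (p - 1)))%R.
exists C; first by rewrite !mulr_gt0// powR_gt0.
move=> f mf f0.
have M0 x := maximal_ge0 x f0.
apply: integral_poweR_trunc => //; first exact: measurable_maximal.
case=> [|n].
  rewrite integral0_eq; first by apply: mule_ge0; [rewrite lee_fin ltW// !mulr_gt0// powR_gt0|apply: integral_ge0 => x _; exact: poweR_ge0].
  by move=> x _; rewrite (min_idPr _)// poweR0r// gt_eqF.
(* The truncation height is the top level; the levels halve from there. *)
pose a : R := n.+1%:R; have a0 : (0 < a)%R by [].
pose lev i : R := (a * 2^-1 ^+ i)%R.
have lev0 i : (0 < lev i)%R by rewrite mulr_gt0// exprn_gt0// invr_gt0.
pose A i := [set x | (lev i.+1)%:E < maximal f x].
have mA i : measurable (A i).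
  rewrite (_ : A i = maximal f @^-1` `](lev i.+1)%:E, +oo[%classic).
    rewrite -[X in measurable X]setTI; apply: measurable_maximal => //.
    exact: emeasurable_itv.
  by apply/seteqP; split => x /=; rewrite in_itv/= andbT.
pose F i x := (lev i `^ p)%:E * (\1_(A i) x)%:E.
have F0 i x : 0 <= F i x by rewrite /F mule_ge0// lee_fin// powR_ge0.
have mF i : measurable_fun setT (F i).
  by apply: emeasurable_funM => //; apply/measurable_EFinP; exact: measurable_indic.
apply: (@le_trans _ _ (\int[mu]_x (\sum_(i <oo) F i x))).
  apply: le_integral_ge0 => x _; first exact: poweR_ge0.
  have ya : mine (maximal f x) a%:E <= a%:E by rewrite ge_min lexx orbT.
  have y0 : 0 <= mine (maximal f x) a%:E by rewrite le_min M0 lee_fin ltW.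
  have yM : mine (maximal f x) a%:E <= maximal f x by rewrite ge_min lexx.
  move: (mine _ _) ya y0 yM => [y| |]//; rewrite !lee_fin => ya y0 yM.
  move: y0; rewrite le_eqVlt => /predU1P[<-|y0].
    rewrite poweR0r ?gt_eqF//; exact: nneseries_ge0.
  have [i [i1 i2]] := dyadic_level y0 ya.
  apply: (@le_trans _ _ (F i x)).
    rewrite /F indicE mem_set ?mule1 ?lee_fin.
      by apply: ge0_ler_powR; rewrite ?nnegrE// ltW.
    by rewrite /A /=; apply: lt_le_trans yM; rewrite lte_fin.
  apply: le_trans (@nneseries_lim_ge _ (F^~ x) xpredT 0 i.+1 _); last by [].
  by rewrite big_nat_recr//= leeDr//; apply: sume_ge0.
rewrite integral_nneseries//.
pose G i x := (4 * L `^ g * lev i `^ (p - 1))%:E * (f \_ [set x | (lev i / 4)%:E < f x]) x.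
have mS t : measurable [set x | t%:E < f x].
  rewrite (_ : [set _ | _] = f @^-1` `]t%:E, +oo[%classic).
    by rewrite -[X in measurable X]setTI; apply: mf => //; exact: emeasurable_itv.
  by apply/seteqP; split => x /=; rewrite in_itv/= andbT.
have mfS t : measurable_fun setT (f \_ [set x | t%:E < f x]).
  by apply: (measurable_restrictT _ _).1 => //; exact: measurable_funTS.
have fS0 (t : R) x : 0 <= (f \_ [set x | t%:E < f x]) x by rewrite patchE; case: ifP.
have cst0 i : (0 <= 4 * L `^ g * lev i `^ (p - 1))%R by rewrite !mulr_ge0// ?powR_ge0// ltW.
have mG i : measurable_fun setT (G i) by apply: emeasurable_funM.
have G0 i x : 0 <= G i x by apply: mule_ge0; rewrite ?lee_fin.
apply: (@le_trans _ _ (\sum_(i <oo) \int[mu]_x G i x)).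
  apply: lee_nneseries => i _; first by move=> _; apply: integral_ge0.
  rewrite /F ge0_integralZl_EFin//; [|by apply/measurable_EFinP; exact: measurable_indic|exact: powR_ge0].
  rewrite integral_indic// setIT /G ge0_integralZl_EFin// -integral_mkcond.
  have := maximal_weak mf f0 (lev0 i.+1).
  have -> : (lev i.+1 / 2 = lev i / 4)%R by rewrite /lev exprS; field.
  have lp0 : 0 <= (lev i `^ p)%:E by rewrite lee_fin powR_ge0.
  move=> W; apply: le_trans (lee_wpmul2l lp0 W) _; rewrite muleA -EFinM; apply: lee_wpmul2r; first exact: integral_ge0.
  rewrite lee_fin -(mulr_powRB1 (ltW (lev0 i)) p0).
  have -> : (lev i.+1 = lev i / 2)%R by rewrite /lev exprS mulrCA mulrC.
  rewrite le_eqVlt; apply/orP; left; apply/eqP; field.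
  by rewrite gt_eqF.
rewrite -integral_nneseries//.
apply: (@le_trans _ _ (\int[mu]_x (C%:E * f x `^ p))); last first.
  rewrite ge0_integralZl_EFin//.
  - by move=> x _; exact: poweR_ge0.
  - exact: (measurableT_comp (measurable_poweR p)).
  - by rewrite ltW// !mulr_gt0// powR_gt0.
apply: le_integral_ge0 => x _; first exact: nneseries_ge0.
have C00' : (0 < C)%R by rewrite !mulr_gt0// powR_gt0.
apply: lime_le; first exact: is_cvg_nneseries.
apply: nearW => N; rewrite big_mkord.
case E : (f x) => [y| |]; last 2 first.
- by rewrite poweRyr ?gt_eqF// gt0_muley// leey.
- by have := f0 x; rewrite E.
have y0 : (0 <= y)%R by rewrite -lee_fin -E.
have -> : \sum_(i < N) G i x =
    (4 * L `^ g * y * \sum_(i < N) (lev i `^ (p - 1) *+ (lev i < 4 * y)%R))%:E.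
  rewrite mulr_sumr -sumEFin; apply: eq_bigr => i _; rewrite /G patchE.
  have -> : (x \in [set x | (lev i / 4)%:E < f x]) = (lev i < 4 * y)%R.
    by apply/idP/idP; rewrite inE/= E lte_fin ltr_pdivrMr// mulrC.
  case: ifP => _; last by rewrite mule0 mulr0n mulr0.
  by rewrite mulr1n E -EFinM; congr (_%:E); rewrite -!mulrA (mulrC y).
rewrite poweR_EFin -EFinM lee_fin.
have y40 : (0 <= 4 * y)%R by rewrite mulr_ge0.
have := HC0 N a (4 * y)%R a0 y40; rewrite powRM// => H.
apply: le_trans (ler_wpM2l _ H) _; first by rewrite !mulr_ge0// ltW.
by rewrite -(mulr_powRB1 y0 p0) /C le_eqVlt; apply/orP; left; apply/eqP; ring.
Qed.

End maximal_function.

(** * Powers against exponentials *)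

Section polynomial_versus_exponential.
Context {R : realType}.

(** The inequality y <= exp y at y = e t / u, raised to the power [u]. *)
Lemma powR_le_expR (u e : R) : 0 < u -> 0 < e ->
  exists2 C, 0 < C & forall t, 0 <= t -> t `^ u <= C * expR (e * t).
Proof.
move=> u0 e0; exists ((u / e) `^ u); first by rewrite powR_gt0// divr_gt0.
move=> t t0; have ue : 0 <= u / e by rewrite divr_ge0// ltW.
have y0 : 0 <= e * t / u by rewrite divr_ge0 ?mulr_ge0// ltW.
have -> : t = (u / e) * (e * t / u) by field; rewrite !gt_eqF.
rewrite powRM// ler_wpM2l ?powR_ge0//.
have -> : expR (e * (u / e * (e * t / u))) = expR (e * t / u) `^ u.
  rewrite -[in RHS](expRK (e * t / u)) /powR gt_eqF ?expR_gt0// !expRK.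
  by congr expR; field; rewrite !gt_eqF.
apply: ge0_ler_powR; rewrite ?nnegrE ?expR_ge0//; first exact: ltW.
by apply: le_trans (expR_ge1Dx _); rewrite lerDr.
Qed.

Lemma sum_powR_geometric_le (u x : R) : 0 < u -> 0 < x < 1 ->
  exists2 C, 0 < C & forall n, \sum_(i < n) i.+1%:R `^ u * x ^+ i <= C.
Proof.
move=> u0 /andP[x0 x1].
have lx : 0 < - ln x / 2 by rewrite divr_gt0// oppr_gt0 ln_lt0// x0.
have [C C0 HC] := powR_le_expR u0 lx.
(* Here [y] is x^(-1/2) and [z] is the square root of [x]: half of the decay absorbs the power. *)
set y := expR (- ln x / 2) in HC *; pose z := x * y.
have y0 : 0 < y by exact: expR_gt0.
have z0 : 0 < z by rewrite mulr_gt0.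
have z1 : z < 1.
  rewrite /z -[x in x * _](lnK x0) -expRD.
  rewrite (_ : _ + _ = ln x / 2); last by field.
  rewrite -[ltRHS](@expR0 R) ltr_expR pmulr_llt0 ?invr_gt0//.
  by rewrite ln_lt0// x0.
exists (C * y * (1 - z)^-1); first by rewrite !mulr_gt0 ?invr_gt0 ?subr_gt0.
move=> n; apply: (@le_trans _ _ (C * y * \sum_(i < n) z ^+ i)); last first.
  apply: ler_wpM2l; first by rewrite mulr_ge0// ltW.
  apply: sum_geometric_le.
  by rewrite z1 ltW.
rewrite mulr_sumr; apply: ler_sum => i _.
apply: (@le_trans _ _ (C * y ^+ i.+1 * x ^+ i)).
  apply: ler_wpM2r; first by rewrite exprn_ge0// ltW.
  apply: le_trans (HC _ (ler0n _ _)) _.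
  by rewrite expRM_natr.
by rewrite /z exprMn exprS le_eqVlt; apply/orP; left; apply/eqP; ring.
Qed.

End polynomial_versus_exponential.

(** * The John-Nirenberg inequality *)

Section john_nirenberg.
Local Open Scope ereal_scope.
Context disp (X : measurableType disp) (R : realType)
  (mu : {sigma_finite_measure set X -> \bar R}) (d : X -> X -> R) (k g v : R)
  (c : nat -> X).
Hypothesis HS : homogeneous_space mu d k g v c.
Variable L : R.
Hypothesis kL : (4 * k ^+ 2 <= L)%R.
Variables (b : X -> R) (beta : X -> R -> R) (D : R).
Hypothesis mb : measurable_fun setT b.
Hypothesis D0 : (0 < D)%R.
Hypothesis bD : forall x r, (0 < r)%R ->
  \int[mu]_(y in qball d x r) `|b y - beta x r|%:E <= D%:E * mu (qball d x r).

Local Notation stdball := (stdball d c L).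
Local Notation dilball := (dilball d c L).
Local Notation radius := (radius L).
Let L0 : (0 < L)%R. Proof. by apply: lt_trans (L_gt1 HS kL). Qed.

Lemma measurable_dist_cst (a : R) : measurable_fun setT (fun y => `|b y - a|%R).
Proof. by apply: measurableT_comp => //; exact: measurable_funB. Qed.

(** Serves to compare two constants that both approximate [b] on [F], by integrating the triangle
    inequality. *)
Lemma close_constants (F : set X) (a1 a2 : R) : measurable F ->
  `|a1 - a2|%:E * mu F <= \int[mu]_(y in F) `|b y - a1|%:E + \int[mu]_(y in F) `|b y - a2|%:E.
Proof.
move=> mF; rewrite -integral_cst// -ge0_integralD//; last 2 first.
- by apply/measurable_EFinP; apply: measurable_funTS; exact: measurable_dist_cst.
- by apply/measurable_EFinP; apply: measurable_funTS; exact: measurable_dist_cst.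
apply: le_integral_ge0 => y _ //=; rewrite -EFinD lee_fin.
by rewrite -[X in (`|X| <= _)%R](subrKA (b y)) (le_trans (ler_normD _ _))// distrC.
Qed.

(** The constant of a ball serves, at bounded cost, on the ball enlarged by L^2. The larger ball is
    needed because stopping balls that meet the ball may stick out of it. *)
Lemma oscillation_dil (x : X) (r : R) : (0 < r)%R ->
  \int[mu]_(y in qball d x (L ^+ 2 * r)) `|b y - beta x r|%:E <=
  ((L ^+ 2) `^ g * (2 + (L ^+ 2) `^ g) * D)%:E * mu (qball d x r).
Proof.
move=> r0; set E := qball d x r; set E2 := qball d x _; set q := ((L ^+ 2) `^ g)%R.
have L20 : (0 < L ^+ 2)%R by rewrite exprn_gt0.
have q0 : (0 < q)%R by rewrite powR_gt0.
have mE : measurable E by exact: (measurable_qball HS).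
have mE2 : measurable E2 by exact: (measurable_qball HS).
pose m := (v * r `^ g)%R.
have EE : mu E = m%:E by exact: (hs_volume HS).
have m0 : (0 < m)%R by rewrite mulr_gt0 ?(hs_v HS)// powR_gt0.
have EE2 : mu E2 = (q * m)%:E by rewrite /E2 (mu_qball_scale HS x x)// -/E EE.
have sub : E `<=` E2.
  move=> y; rewrite /E /E2 /qball /= => xy; apply: lt_le_trans xy _.
  by apply: ler_peMl; [exact: ltW|apply: exprn_ege1; exact/ltW/(L_gt1 HS kL)].
pose a1 := beta x r; pose a2 := beta x (L ^+ 2 * r).
have H1 : (`|a2 - a1| <= (1 + q) * D)%R.
  rewrite -(ler_pM2r m0) -lee_fin EFinM -EE.
  apply: le_trans (close_constants a2 a1 mE) _.
  apply: (@le_trans _ _ (D%:E * mu E2 + D%:E * mu E)); last first.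
    by rewrite EE EE2 -!EFinM -EFinD lee_fin le_eqVlt; apply/orP; left; apply/eqP; ring.
  apply: leeD; last exact: bD.
  apply: le_trans (bD x (mulr_gt0 L20 r0)).
  exact: le_integral_subset.
apply: (@le_trans _ _ (\int[mu]_(y in E2) (`|b y - a2|%:E + `|a2 - a1|%:E))).
  apply: le_integral_ge0 => y _ //=; rewrite -EFinD lee_fin.
  by rewrite -[X in (`|X| <= _)%R](subrKA a2) (le_trans (ler_normD _ _)).
rewrite ge0_integralD//; last first.
  by apply/measurable_EFinP; apply: measurable_funTS; exact: measurable_dist_cst.
have -> : \int[mu]_(_ in E2) `|a2 - a1|%:E = `|a2 - a1|%:E * mu E2 by rewrite integral_cst.
rewrite EE2 EE.
apply: (@le_trans _ _ (D%:E * (q * m)%:E + ((1 + q) * D)%:E * (q * m)%:E)).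
  apply: leeD; first by rewrite -EE2; exact: (bD x (mulr_gt0 L20 r0)).
  by apply: lee_wpmul2r; rewrite lee_fin// mulr_ge0// ltW.
by rewrite -!EFinM -EFinD lee_fin le_eqVlt; apply/orP; left; apply/eqP; ring.
Qed.

(* Enlarge a ball by the factor [L] as long as its mean exceeds [lam]. *)
Lemma stopping_ball (f : X -> \bar R) (lam A : R) (m : nat) :
  measurable_fun setT f -> (forall x, 0 <= f x) -> (0 < lam)%R ->
  \int[mu]_x f x <= A%:E -> lam%:E * mu (stdball m) < \int[mu]_(x in stdball m) f x ->
  exists m', [/\ stdball m `<=` stdball m',
    lam%:E * mu (stdball m') <= \int[mu]_(x in stdball m') f x &
    \int[mu]_(x in dilball m') f x <= lam%:E * mu (dilball m')].
Proof.
move=> mf f0 lam0 fA.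
have L1 := L_gt1 HS kL.
have Lg1 : (1 < L `^ g)%R.
  have -> : (1 = 1 `^ g :> R)%R by rewrite powR1.
  by apply: gt0_ltr_powR; rewrite ?nnegrE ?ler01 ?(hs_g HS)// ltW.
pose w m := fine (mu (stdball m)).
have wE m' : mu (stdball m') = (w m')%:E by rewrite fineK// (mu_stdball_fin HS).
have w0 m' : (0 < w m')%R by exact: (fine_mu_stdball_gt0 HS kL).
(* Induction on the number of enlargements left: each multiplies the volume by L^g, and a volume
   with lam mu > A is incompatible with a total mass of at most [A]. *)
have H N : forall m, (A < lam * ((L `^ g) ^+ N * w m))%R ->
    lam%:E * mu (stdball m) < \int[mu]_(x in stdball m) f x ->
  exists m', [/\ stdball m `<=` stdball m',
    lam%:E * mu (stdball m') <= \int[mu]_(x in stdball m') f x &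
    \int[mu]_(x in dilball m') f x <= lam%:E * mu (dilball m')].
  elim: N => [|N IH] {}m.
    rewrite expr0 mul1r => Aw H; exfalso.
    have : lam%:E * mu (stdball m) < A%:E.
      apply: lt_le_trans H _; apply: le_trans fA; exact: le_integral_subset.
    by rewrite wE -EFinM lte_fin ltNge (ltW Aw).
  move=> Aw H.
  have [stop|go] := leP (\int[mu]_(x in dilball m) f x) (lam%:E * mu (dilball m)).
    by exists m; split => //; exact: ltW.
  have [m1 [m1E _]] := stdball_dil HS kL m.
  have [||m' [sub H1 H2]] := IH m1; last 1 first.
  - exists m'; split => //; apply: subset_trans sub; rewrite m1E.
    move=> y; rewrite stdballE /qball /=.
    move=> /lt_le_trans; apply; apply: ler_peMl; last exact: ltW.
    exact/ltW/(radius_gt0 HS kL).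
  - suff -> : w m1 = (L `^ g * w m)%R by rewrite (mulrA (_ ^+ N)%R) -exprSr.
    by apply: EFin_inj; rewrite -wE m1E (mu_dilball HS kL) wE.
  - by rewrite m1E.
have [N HN] : exists N : nat, (A / (lam * w m) < (L `^ g) ^+ N)%R.
  have l0 : (0 < ln (L `^ g))%R by exact: ln_gt0.
  exists (Num.truncn (A / (lam * w m) / ln (L `^ g))).+1.
  rewrite -[in ltRHS](lnK (lt_trans ltr01 Lg1)) -expRM_natl.
  apply: lt_le_trans (expR_ge1Dx _); rewrite ltr_wpDl// -ltr_pdivrMr//.
  rewrite expRK; exact: truncnS_gt.
move=> Hm; apply: (H N) => //.
by rewrite mulrCA -ltr_pdivrMr// mulr_gt0.
Qed.

(** Induction on [n], as in the Calderón-Zygmund proof. Stopping balls at level [lam] for |b - beta|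
    cover almost all points of the level set of order n + 1. On the dilate of such a ball the
    constant of [b] has moved by at most [Lam], so these points belong to the level set of order n
    of the dilate, of relative measure at most 2^(-n). The total measure of the stopping balls
    supplies the remaining factor 1/2. *)
Lemma exponential_decay : exists2 Lam : R, (0 < Lam)%R & forall n x r, (0 < r)%R ->
  mu [set y | qball d x r y /\ (n%:R * Lam < `|b y - beta x r|)%R] <=
  ((2^-1) ^+ n)%:E * mu (qball d x r).
Proof.
have L1 := L_gt1 HS kL.
pose q := ((L ^+ 2) `^ g)%R; pose C1 := (q * (2 + q) * D)%R.
have L20 : (0 < L ^+ 2)%R by rewrite exprn_gt0.
have q0 : (0 < q)%R by rewrite powR_gt0.
have C10 : (0 < C1)%R by rewrite !mulr_gt0// addr_gt0.
have Lg1 : (1 <= L `^ g)%R.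
  have -> : (1 = 1 `^ g :> R)%R by rewrite powR1.
  by apply: ge0_ler_powR; rewrite ?nnegrE ?ler01//; [apply/ltW/(hs_g HS)|exact: ltW|exact: ltW].
have Lg0 : (0 < L `^ g)%R by apply: lt_le_trans Lg1.
(* This value makes L^g C1 / lam equal to 1/2. In [Lam] below, D + lam covers the change of
   constants, and 2 L^g lam serves the density step: half of a small ball on which f > Lam raises
   the mean over the standard ball around it, L^g times larger, above [lam]. *)
pose lam := (2 * L `^ g * C1)%R; have lam0 : (0 < lam)%R by apply: mulr_gt0 => //; exact: mulr_gt0.
pose Lam := (D + (2 * L `^ g * lam + lam))%R.
have Lam0 : (0 < Lam)%R.
  by apply: addr_gt0 => //; apply: addr_gt0 => //; apply: mulr_gt0 => //; exact: mulr_gt0.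
have msub n x r : measurable [set y | qball d x r y /\ (n%:R * Lam < `|b y - beta x r|)%R].
  rewrite (_ : [set _ | _] = qball d x r `&` (fun y => `|b y - beta x r|%R) @^-1` `](n%:R * Lam)%R, +oo[).
    apply: measurableI; first exact: (measurable_qball HS).
    by rewrite -[X in measurable X]setTI; apply: measurable_dist_cst.
  by apply/seteqP; split => y /=; rewrite in_itv/= andbT.
exists Lam => //; elim=> [|n IH] x r r0.
  rewrite expr0 mul1e; apply: le_measure; rewrite ?inE//; first exact: (measurable_qball HS).
  by move=> y [].
set E := qball d x r; set a := beta x r.
pose E2 := qball d x (L ^+ 2 * r).
set Z := [set y | _].
have mZ : measurable Z by exact: msub.
have mE2 : measurable E2 by exact: (measurable_qball HS).
have EE2 : E `<=` E2.
  move=> y; rewrite /E /E2 /qball /= => /lt_le_trans; apply.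
  by apply: ler_peMl; [exact: ltW|apply: exprn_ege1; exact/ltW].
pose f := (fun y => `|b y - a|%:E) \_ E2.
have mf : measurable_fun setT f.
  apply: (measurable_restrictT _ _).1 => //; apply/measurable_EFinP; apply: measurable_funTS.
  exact: measurable_dist_cst.
have f0 y : 0 <= f y by rewrite /f patchE; case: ifP.
pose w := (v * r `^ g)%R.
have EE : mu E = w%:E by exact: (hs_volume HS).
have w0 : (0 < w)%R by rewrite mulr_gt0 ?(hs_v HS)// powR_gt0.
have If : \int[mu]_y f y <= (C1 * w)%:E.
  by rewrite /f -integral_mkcond EFinM -EE; exact: oscillation_dil.
pose I := [set m | [/\ lam%:E * mu (stdball m) <= \int[mu]_(x in stdball m) f x,
   \int[mu]_(x in dilball m) f x <= lam%:E * mu (dilball m) &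
   stdball m `&` E !=set0]].
have fin_std m : mu (stdball m) = (fine (mu (stdball m)))%:E by rewrite fineK// (mu_stdball_fin HS).
have w_std m := fine_mu_stdball_gt0 HS kL m.
(* A ball at least as large as [E] cannot have mean [lam], since [f] has total mass at most C1 w <
   lam w. *)
have small m : I m -> (radius m < r)%R.
  move=> [H _ _]; rewrite ltNge; apply/negP => rm.
  have wm : (w <= fine (mu (stdball m)))%R.
    rewrite -lee_fin -fin_std (hs_volume HS) ?(radius_gt0 HS kL)// lee_fin.
    apply: ler_wpM2l; first exact/ltW/(hs_v HS).
    by apply: ge0_ler_powR; rewrite ?nnegrE//; [apply/ltW/(hs_g HS)|exact: ltW|apply/ltW/(radius_gt0 HS kL)].
  have : (lam * fine (mu (stdball m)) <= C1 * w)%R.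
    rewrite -lee_fin EFinM -fin_std; apply: le_trans H _; apply: le_trans If.
    exact: le_integral_subset.
  rewrite leNgt => /negP; apply; apply: (@lt_le_trans _ _ (lam * w)%R); last by rewrite ler_pM2l.
  rewrite ltr_pM2r// /lam -[ltLHS]mul1r ltr_pM2r//.
  by rewrite (lt_le_trans (ltr1n _ 2))// ler_peMr.
have dil_sub m : I m -> dilball m `<=` E2.
  move=> Im; have rm := small m Im; case: Im => _ _ [z [zm zE]] y ym.
  rewrite /E2 /qball /=.
  have k1 := hs_k HS; have k0 : (0 < k)%R by apply: lt_le_trans k1.
  have zc : (d z (c (index m).1) < r)%R by rewrite (hs_sym HS); apply: lt_trans zm _.
  have cy : (d (c (index m).1) y < L * r)%R.
    by apply: lt_trans ym _; rewrite ltr_pM2l.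
  have zy := qtriangle HS zc cy.
  apply: lt_le_trans (qtriangle HS zE zy) _.
  have -> : (k * (r + k * (r + L * r)) = (k + k ^+ 2 + k ^+ 2 * L) * r)%R by ring.
  rewrite ler_pM2r//.
  have kk : (k <= k ^+ 2)%R by rewrite expr2 ler_peMr// ltW.
  have : (4 * k ^+ 2 * L <= L ^+ 2)%R by rewrite expr2 ler_pM2r.
  have : (k ^+ 2 <= k ^+ 2 * L)%R by rewrite ler_peMr ?exprn_ge0// ltW.
  by move: kk; lra.
have HZ m : I m -> mu (dilball m `&` Z) <= ((2^-1) ^+ n)%:E * mu (dilball m).
  move=> Im; have sub := dil_sub m Im.
  have Lr0 : (0 < L * radius m)%R by rewrite mulr_gt0// (radius_gt0 HS kL).
  pose a' := beta (c (index m).1) (L * radius m).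
  apply: le_trans (IH (c (index m).1) (L * radius m)%R Lr0).
  have mD : measurable (dilball m) by exact: (measurable_dilball HS).
  apply: le_measure; rewrite ?inE//; first exact: measurableI.
  move=> y [ym [yE yZ]]; split => //.
  have fd : mu (dilball m) = (v * (L * radius m) `^ g)%:E by exact: (hs_volume HS).
  have fd0 : (0 < v * (L * radius m) `^ g)%R by rewrite mulr_gt0 ?(hs_v HS)// powR_gt0.
  have aa : (`|a' - a| <= D + lam)%R.
    rewrite -(ler_pM2r fd0) -lee_fin EFinM -fd.
    apply: le_trans (close_constants a' a mD) _; rewrite mulrDl EFinD EFinM (EFinM lam) -fd.
    apply: leeD; first exact: bD.
    case: Im => _ H _; apply: le_trans H.
    apply: le_integral_ge0 => // z /sub zE2; rewrite /f patchE ifT// inE//.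
  rewrite -(ltrD2r `|a' - a|%R) -/a'.
  apply: (@lt_le_trans _ _ `|b y - a|%R); last first.
    by rewrite -[X in (`|X| <= _)%R](subrKA a') (le_trans (ler_normD _ _)).
  apply: le_lt_trans yZ; rewrite mulrSr mulrDl mul1r lerD2l.
  by apply: le_trans aa _; rewrite /Lam lerD2l lerDr; apply: mulr_ge0; apply: ltW => //; exact: mulr_gt0.
have HI m : I m -> lam%:E * mu (stdball m) <= \int[mu]_(x in stdball m) f x by case.
have := vitali_cover HS kL mf f0 lam0 mZ (exprn_ge0 n (ltW (_ : (0 < 2^-1 :> R)%R))) HI HZ.
rewrite invr_gt0 ltr0n => /(_ isT) cov.
(* Off this null set a point of [Z] has a ball of radius L^(-j) at least half filled by [Z]; the
   standard ball around it can then be enlarged to a stopping ball. *)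
pose Null := [set y | Z y /\ forall j : nat, (mu (Z `&` qball d y (L ^- j))
      < 2^-1%:E * mu (qball d y (L ^- j)))].
have Lj0 j : (0 < L ^- j)%R by rewrite invr_gt0 exprn_gt0.
have N0 : mu.-negligible Null.
  apply: (hs_density HS) => // e e0.
  have := @cvg_geometric R 1%R L^-1%R; rewrite ger0_norm ?invr_ge0 ?(ltW L0)// invf_lt1//.
  move=> /(_ L1) /cvgrPdist_lt /(_ e e0) [j _ /(_ j (leqnn j))] /=.
  by rewrite sub0r normrN mul1r exprVn gtr0_norm//; exists j.
pose U := \bigcup_(i in I) stdball i.
have mU : measurable U.
  by apply: bigcup_measurable => i _; exact: (measurable_stdball HS).
have ZU : mu (Z `\` U) = 0.
  apply/negligibleP; first exact: measurableD.
  apply: negligibleS N0 => y [Zy nUy]; split => // j; rewrite ltNge; apply/negP => H.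
  have [m [my subm rm]] := qball_sub_stdball HS kL y (- (j%:Z))%R.
  apply: nUy.
  have H2 : lam%:E * mu (stdball m) < \int[mu]_(x in stdball m) f x.
    apply: (@lt_le_trans _ _ (Lam%:E * mu (Z `&` qball d y (L ^- j)))); last first.
      rewrite -integral_cst//; last first.
        by apply: measurableI => //; exact: (measurable_qball HS).
      apply: (@le_trans _ _ (\int[mu]_(x in Z `&` qball d y (L ^- j)) f x)).
        apply: le_integral_ge0 => z [[zE zL] _]; first by rewrite lee_fin ltW.
        rewrite /f patchE ifT ?inE; last exact: EE2.
        rewrite lee_fin; apply: ltW; apply: le_lt_trans zL.
        by apply: ler_peMl; [exact: ltW|rewrite ler1n].
      apply: le_integral_subset => // z [_ zy]; apply: subm.
      by rewrite -exprnN in zy *.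
    apply: (@lt_le_trans _ _ (Lam%:E * (2^-1%:E * mu (qball d y (L ^- j))))); last first.
      by apply: lee_wpmul2l => //; rewrite lee_fin ltW.
    have -> : mu (stdball m) = ((L `^ g)%:E * mu (qball d y (L ^- j))).
      rewrite -(mu_qball_scale HS (c (index m).1))// stdballE rm exprzDr ?unitfE ?gt_eqF//.
      by rewrite expr1z mulrC exprnN.
    rewrite (hs_volume HS)// -!EFinM lte_fin !mulrA ltr_pM2r; last first.
      by rewrite powR_gt0.
    rewrite ltr_pM2r ?(hs_v HS)// /Lam.
    by move: D0 (mulr_gt0 Lg0 lam0); rewrite (mulrC lam); lra.
  have [m' [sub' H1' H2']] := stopping_ball mf f0 lam0 If H2.
  exists m'; last exact: sub'.
  split => //; exists y; split; first exact: sub'.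
  by case: Zy.
apply: (@le_trans _ _ (mu (U `&` Z) + mu (Z `\` U))).
  apply: (@le_trans _ _ (mu ((U `&` Z) `|` (Z `\` U)))); last first.
    by apply: measureU2; [exact: measurableI|exact: measurableD].
  apply: le_measure; rewrite ?inE//.
    by apply: measurableU; [exact: measurableI|exact: measurableD].
  by move=> y Zy; have [Uy|nUy] := pselect (U y); [left|right].
rewrite ZU adde0; apply: le_trans cov _.
apply: le_trans (lee_wpmul2l _ If) _.
  by rewrite lee_fin; apply: divr_ge0; [apply: mulr_ge0; [exact: exprn_ge0|exact: ltW]|exact: ltW].
rewrite EE -!EFinM lee_fin le_eqVlt; apply/orP; left; apply/eqP.
by rewrite /lam exprS; field; rewrite !gt_eqF.
Qed.

(** Layer cake over the levels n Lam: the measure bound 2^(-n) beats the weight (n+1)^u. *)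
Lemma john_nirenberg (u : R) : (0 < u)%R -> exists2 B : R, (0 < B)%R &
  forall x r, (0 < r)%R ->
  \int[mu]_(y in qball d x r) (`|b y - beta x r| `^ u)%:E <= B%:E * mu (qball d x r).
Proof.
move=> u0; have [Lam Lam0 H] := exponential_decay.
have h01 : (0 < (2^-1 : R) < 1)%R by rewrite invr_gt0 ltr0n invf_lt1 ?ltr1n.
have [C C0 HC] := sum_powR_geometric_le u0 h01.
exists (Lam `^ u * C)%R; first by rewrite mulr_gt0// powR_gt0.
move=> x r r0; set E := qball d x r.
have mE : measurable E by exact: (measurable_qball HS).
pose A n := [set y | E y /\ (n%:R * Lam < `|b y - beta x r|)%R].
have mA n : measurable (A n).
  rewrite (_ : A n = E `&` (fun y => `|b y - beta x r|%R) @^-1` `](n%:R * Lam)%R, +oo[).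
    apply: measurableI => //.
    by rewrite -[X in measurable X]setTI; apply: measurable_dist_cst.
  by apply/seteqP; split => y /=; rewrite in_itv/= andbT.
pose F n y := ((n.+1%:R * Lam) `^ u)%:E * (\1_(A n) y)%:E.
have F0 n y : 0 <= F n y by rewrite /F mule_ge0// lee_fin// powR_ge0.
have mF n : measurable_fun E (F n).
  by apply: emeasurable_funM => //; apply/measurable_EFinP; exact: measurable_indic.
apply: (@le_trans _ _ (\int[mu]_(y in E) (\sum_(n <oo) F n y))).
  apply: le_integral_ge0 => y Ey; first by rewrite lee_fin powR_ge0.
  set t := `|b y - beta x r|%R; have : (0 <= t)%R by exact: normr_ge0.
  rewrite le_eqVlt => /predU1P[<-|t0].
    by rewrite powR0 ?gt_eqF//; exact: nneseries_ge0.
  have ex : exists n : nat, (t <= n.+1%:R * Lam)%R.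
    exists (Num.truncn (t / Lam)); rewrite -ler_pdivrMr//; apply: ltW; exact: truncnS_gt.
  have [n [n1 n2]] : exists n : nat, (n%:R * Lam < t <= n.+1%:R * Lam)%R /\ True.
    case: (ex_minnP ex) => -[|n] Hn Hm; first by exists 0%N; rewrite mul0r t0 Hn.
    by exists n.+1; rewrite Hn andbT; split => //; rewrite ltNge; apply/negP => /Hm; rewrite ltnn.
  case/andP: n1 => n1 n3.
  apply: (@le_trans _ _ (F n y)).
    rewrite /F indicE mem_set ?mule1 ?lee_fin//.
    apply: ge0_ler_powR; [exact: ltW|by rewrite nnegrE ltW| |exact: n3].
    by rewrite nnegrE mulr_ge0// ltW.
  apply: le_trans (@nneseries_lim_ge _ (F^~ y) xpredT 0 n.+1 _); last by [].
  by rewrite big_nat_recr//= leeDr//; apply: sume_ge0.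
rewrite integral_nneseries//.
apply: lime_le.
  by apply: is_cvg_nneseries => n _ _; apply: integral_ge0.
apply: nearW => N; rewrite big_mkord.
apply: (@le_trans _ _ (\sum_(n < N) ((Lam `^ u * (n.+1%:R `^ u * 2^-1 ^+ n))%:E * mu E))).
  apply: lee_sum => n _; rewrite /F ge0_integralZl_EFin//; last 2 first.
  - by apply/measurable_EFinP; exact: measurable_indic.
  - exact: powR_ge0.
  rewrite integral_indic//; rewrite (_ : A n `&` E = A n); last first.
    by apply/seteqP; split => y; [case|move=> Ay; split => //; case: Ay].
  apply: le_trans (lee_wpmul2l _ (H n x r r0)) _; first by rewrite lee_fin powR_ge0.
  rewrite muleA -EFinM; apply: lee_wpmul2r => //.
  rewrite lee_fin powRM//; last exact: ltW.
  by rewrite le_eqVlt; apply/orP; left; apply/eqP; ring.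
rewrite -ge0_sume_distrl; last first.
  by move=> n _; rewrite lee_fin !mulr_ge0 ?powR_ge0// exprn_ge0// invr_ge0.
apply: lee_wpmul2r => //; rewrite sumEFin lee_fin -mulr_sumr.
by apply: ler_wpM2l => //; exact: powR_ge0.
Qed.

End john_nirenberg.

(** * Hölder's inequality on a set *)

Section hoelder_on_sets.
Local Open Scope ereal_scope.
Context disp (X : measurableType disp) (R : realType)
  (mu : {measure set X -> \bar R}).
Variables (u s : R).
Hypotheses (u0 : (0 < u)%R) (s0 : (0 < s)%R) (us : (u^-1 + s^-1 = 1)%R).

Lemma hoelder_set (E : set X) (F G : X -> R) : measurable E ->
  measurable_fun setT F -> measurable_fun setT G ->
  (forall x, 0 <= F x)%R -> (forall x, 0 <= G x)%R ->
  \int[mu]_(x in E) (F x * G x)%:E <=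
  (\int[mu]_(x in E) (F x `^ u)%:E) `^ u^-1 * (\int[mu]_(x in E) (G x `^ s)%:E) `^ s^-1.
Proof.
move=> mE mF mG F0 G0.
have m1 (K : X -> R) : measurable_fun setT K -> measurable_fun setT (K \* \1_E)%R.
  by move=> mK; apply: measurable_funM => //; exact: measurable_indic.
have := hoelder mu (m1 F mF) (m1 G mG) u0 s0 us.
have N (K : X -> R) t : (0 < t)%R -> (forall x, 0 <= K x)%R ->
    'N[mu]_t%:E[EFin \o (K \* \1_E)%R] = (\int[mu]_(x in E) (K x `^ t)%:E) `^ t^-1.
  move=> t0 K0; rewrite unlock; congr (_ `^ _); rewrite [RHS]integral_mkcond.
  apply: eq_integral => x _; rewrite patchE /= indicE; case: ifPn => xE.
    by rewrite mulr1 ger0_norm.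
  by rewrite mulr0 normr0 powR0 ?gt_eqF.
rewrite !N//; apply: le_trans.
rewrite Lnorm1 integral_mkcond le_eqVlt; apply/orP; left; apply/eqP.
apply: eq_integral => x _; rewrite patchE /= indicE; case: ifPn => xE.
  by rewrite !mulr1 ger0_norm// mulr_ge0.
by rewrite !mulr0 normr0.
Qed.

Lemma hoelder_set1 (E : set X) (G : X -> R) : measurable E ->
  measurable_fun setT G -> (forall x, 0 <= G x)%R ->
  \int[mu]_(x in E) (G x)%:E <= mu E `^ u^-1 * (\int[mu]_(x in E) (G x `^ s)%:E) `^ s^-1.
Proof.
move=> mE mG G0; have := @hoelder_set E (cst 1%R) G mE (measurable_cst _) mG (fun=> ler01) G0.
under eq_integral do rewrite /= mul1r.
by under [X in _ <= X `^ _ * _ -> _]eq_integral do rewrite /= powR1; rewrite integral_cst// mul1e.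
Qed.

End hoelder_on_sets.

(** * One scale of the commutator, averaged over centres *)

Section averaging_argument.
Local Open Scope ereal_scope.
Context disp (X : measurableType disp) (R : realType)
  (mu : {sigma_finite_measure set X -> \bar R}) (d : X -> X -> R) (k g v : R)
  (c : nat -> X).
Hypothesis HS : homogeneous_space mu d k g v c.
Variable L : R.
Hypothesis kL : (4 * k ^+ 2 <= L)%R.
Variables (b f h : X -> R).
Hypotheses (mb : measurable_fun setT b) (mf : measurable_fun setT f)
  (mh : measurable_fun setT h).
Hypotheses (f0 : forall x, (0 <= f x)%R) (h0 : forall x, (0 <= h x)%R).
Let L0 : (0 < L)%R. Proof. by apply: lt_trans (L_gt1 HS kL). Qed.

Definition oscillation (E : set X) (x : X) : \bar R :=
  \int[mu]_(y in E) (`|b x - b y| * f y)%:E.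

Lemma oscillation_ge0 E x : 0 <= oscillation E x.
Proof. by apply: integral_ge0 => y _; rewrite lee_fin mulr_ge0. Qed.

Lemma measurable_oscillation_term x :
  measurable_fun setT (fun y => (`|b x - b y| * f y)%R).
Proof.
apply: measurable_funM => //; apply: measurableT_comp => //.
exact: measurable_funB.
Qed.

Lemma measurable_indic_qball r :
  measurable_fun [set: X * X] (fun z => \1_(qball d z.1 r) z.2 : R).
Proof.
rewrite (_ : (fun _ => _) = \1_[set z : X * X | (d z.1 z.2 < r)%R]); last first.
  by apply/funext => z; rewrite !indicE; congr ((nat_of_bool _)%:R); apply/idP/idP; rewrite !inE.
apply: measurable_indic.
rewrite (_ : [set _ | _] = (fun z => d z.1 z.2) @^-1` `]-oo, r[%classic); last first.
  by apply/seteqP; split => z /=; rewrite in_itv.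
by rewrite -[X in measurable X]setTI; exact: (hs_measurable HS).
Qed.

Lemma oscillation_indic (E : set X) x :
  oscillation E x = \int[mu]_y ((`|b x - b y| * f y) * \1_E y)%:E.
Proof.
rewrite /oscillation integral_mkcond; apply: eq_integral => y _.
by rewrite patchE indicE; case: ifPn => yE; rewrite ?mulr1 ?mulr0.
Qed.

(** The centre of the ball is decoupled from the point of evaluation because [average_over_centers]
    integrates over both. *)
Lemma measurable_oscillation2 r : measurable_fun [set: X * X]
  (fun z => oscillation (qball d z.2 r) z.1).
Proof.
pose F (w : (X * X) * X) : \bar R :=
  ((`|b w.1.1 - b w.2| * f w.2) * \1_(qball d w.1.2 r) w.2)%:E.
have m11 : measurable_fun [set: (X * X) * X] (fun w => w.1.1).
  exact: (measurableT_comp measurable_fst measurable_fst).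
have m12 : measurable_fun [set: (X * X) * X] (fun w => w.1.2).
  exact: (measurableT_comp measurable_snd measurable_fst).
have mF : measurable_fun setT F.
  apply/measurable_EFinP; apply: measurable_funM.
    apply: measurable_funM.
      apply: measurableT_comp => //; apply: measurable_funB.
        exact: (measurableT_comp mb m11).
      exact: (measurableT_comp mb measurable_snd).
    exact: (measurableT_comp mf measurable_snd).
  have mw : measurable_fun [set: (X * X) * X] (fun w => (w.1.2, w.2)).
    by apply/measurable_fun_pair => //; exact: measurable_snd.
  exact: (measurableT_comp (measurable_indic_qball r) mw).
have F0 w : 0 <= F w by rewrite lee_fin !mulr_ge0.
have := @measurable_fun_fubini_tonelli_F _ _ _ _ _ mu _ mF F0.
by congr measurable_fun; apply/funext => z; rewrite oscillation_indic.
Qed.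

Lemma measurable_oscillation r : measurable_fun setT (fun x => oscillation (qball d x r) x).
Proof.
have m : measurable_fun [set: X] (fun x => (x, x)) by exact/measurable_fun_pair.
exact: (measurableT_comp (measurable_oscillation2 r) m).
Qed.

(** Replaces balls centred at the moving point [x] by balls with a fixed centre [z], on which one
    constant approximates [b]. Every z in the ball about [x] has that ball inside its own L-fold
    ball; such z form a set of measure v r^g, and Tonelli exchanges x and z. *)
Lemma average_over_centers r : (0 < r)%R ->
  (v * r `^ g)%:E * \int[mu]_x ((h x)%:E * oscillation (qball d x r) x) <=
  \int[mu]_z \int[mu]_(x in qball d z (L * r)) ((h x)%:E * oscillation (qball d z (L * r)) x).
Proof.
move=> r0.
have vr0 : (0 <= v * r `^ g)%R by rewrite mulr_ge0 ?powR_ge0// ltW// (hs_v HS).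
rewrite -ge0_integralZl//; last 2 first.
- apply: emeasurable_funM; first exact/measurable_EFinP.
  exact: measurable_oscillation.
- by move=> x _; rewrite mule_ge0 ?lee_fin//; exact: oscillation_ge0.
pose Psi (w : X * X) : \bar R := (\1_(qball d w.1 r) w.2)%:E *
  ((h w.1)%:E * oscillation (qball d w.2 (L * r)) w.1).
have Psi0 w : 0 <= Psi w.
  by rewrite /Psi mule_ge0 ?lee_fin// mule_ge0 ?lee_fin//; exact: oscillation_ge0.
have mPsi : measurable_fun setT Psi.
  apply: emeasurable_funM; first by apply/measurable_EFinP; exact: measurable_indic_qball.
  apply: emeasurable_funM; last exact: measurable_oscillation2.
  by apply/measurable_EFinP; exact: (measurableT_comp mh measurable_fst).
have Lr x z : (d x z < r)%R -> qball d x r `<=` qball d z (L * r).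
  move=> xz y xy; rewrite /qball /=.
  have zx : (d z x < r)%R by rewrite (hs_sym HS).
  apply: lt_le_trans (qtriangle HS zx xy) _.
  have k1 := hs_k HS.
  have kk : (k <= k ^+ 2)%R by rewrite expr2 ler_peMr// (le_trans _ k1).
  rewrite -mulr2n -mulr_natl mulrA ler_pM2r//; apply: le_trans kL.
  by move: kk k1; lra.
apply: (@le_trans _ _ (\int[mu]_x \int[mu]_z Psi (x, z))).
  apply: le_integral_ge0 => x _.
    by rewrite mule_ge0 ?lee_fin// mule_ge0 ?lee_fin//; exact: oscillation_ge0.
  have mq := measurable_qball HS x r.
  rewrite -(hs_volume HS x r0) -[X in mu X]setIT -integral_indic// -ge0_integralZr//; last 2 first.
  - by apply/measurable_EFinP; exact: measurable_indic.
  - by rewrite mule_ge0 ?lee_fin//; exact: oscillation_ge0.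
  apply: le_integral_ge0 => z _.
    by rewrite mule_ge0 ?lee_fin// mule_ge0 ?lee_fin//; exact: oscillation_ge0.
  rewrite /Psi /= indicE; case: (boolP (z \in qball d x r)) => [|_]; last by rewrite !mul0e.
  rewrite inE => xz; rewrite !mul1e; apply: lee_wpmul2l; first by rewrite lee_fin.
  apply: le_integral_subset; first exact: Lr.
  by move=> y _; rewrite lee_fin mulr_ge0.
rewrite fubini_tonelli//; apply: le_integral_ge0 => z _; first exact: integral_ge0.
rewrite [leRHS]integral_mkcond; apply: le_integral_ge0 => x _ //.
rewrite /Psi /= indicE; case: (boolP (z \in qball d x r)) => [|_]; last first.
  rewrite mul0e patchE; case: ifP => // _.
  by rewrite mule_ge0 ?lee_fin//; exact: oscillation_ge0.
rewrite inE => xz; rewrite mul1e patchE ifT// inE /qball /= (hs_sym HS).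
by apply: lt_le_trans xz _; rewrite ler_peMl// ltW// (L_gt1 HS kL).
Qed.

Section one_ball.
Variables (u s B e a : R) (E : set X).
Hypotheses (u0 : (0 < u)%R) (s0 : (0 < s)%R) (us : (u^-1 + s^-1 = 1)%R).
Hypotheses (mE : measurable E) (Ee : mu E = e%:E) (e0 : (0 < e)%R) (B0 : (0 < B)%R).
Hypothesis bE : \int[mu]_(x in E) (`|b x - a| `^ u)%:E <= (B * e)%:E.

(** Going through the constant [a] splits |b x - b y| into two terms, so the double integral becomes
    two products of single integrals, each estimated by Hölder. The factor 2 and the power 2/u come
    from this symmetry. *)
Lemma integral_oscillation_le :
  \int[mu]_(x in E) ((h x)%:E * oscillation E x) <=
  (2 * B `^ u^-1 * e `^ (2 / u))%:E *
    ((\int[mu]_(x in E) (f x `^ s)%:E) `^ s^-1 *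
     (\int[mu]_(x in E) (h x `^ s)%:E) `^ s^-1).
Proof.
set Sf := _ `^ s^-1; set Sh := (X in _ * (Sf * X)).
have Sf0 : 0 <= Sf by exact: poweR_ge0.
have Sh0 : 0 <= Sh by exact: poweR_ge0.
pose Pc := ((B * e) `^ u^-1)%R; pose Qc := (e `^ u^-1)%R.
have Pc0 : (0 <= Pc)%R by exact: powR_ge0.
have Qc0 : (0 <= Qc)%R by exact: powR_ge0.
have mba := measurable_dist_cst mb a.
have H1 (w : X -> R) : measurable_fun setT w -> (forall x, 0 <= w x)%R ->
    \int[mu]_(x in E) (`|b x - a| * w x)%:E <=
    Pc%:E * (\int[mu]_(x in E) (w x `^ s)%:E) `^ s^-1.
  move=> mw w0; apply: le_trans (hoelder_set mu u0 s0 us mE mba mw _ w0) _ => //.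
  apply: lee_wpmul2r; first exact: poweR_ge0.
  rewrite /Pc -poweR_EFin; apply: le_poweR => //; first by rewrite invr_ge0 ltW.
  by apply: integral_ge0 => x _; rewrite lee_fin powR_ge0.
have H2 (w : X -> R) : measurable_fun setT w -> (forall x, 0 <= w x)%R ->
    \int[mu]_(x in E) (w x)%:E <= Qc%:E * (\int[mu]_(x in E) (w x `^ s)%:E) `^ s^-1.
  move=> mw w0; apply: le_trans (hoelder_set1 mu u0 s0 us mE mw w0) _.
  by rewrite /Qc -poweR_EFin -Ee; exact: lexx.
pose If := \int[mu]_(y in E) (f y)%:E; pose Jf := \int[mu]_(y in E) (`|b y - a| * f y)%:E.
have If0 : 0 <= If by apply: integral_ge0 => y _; rewrite lee_fin.
have Jf0 : 0 <= Jf by apply: integral_ge0 => y _; rewrite lee_fin mulr_ge0.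
have osc x : oscillation E x <= `|b x - a|%:E * If + Jf.
  rewrite -ge0_integralZl//; last 2 first.
  - by apply/measurable_EFinP; exact: measurable_funTS.
  - by move=> y _; rewrite lee_fin.
  rewrite -ge0_integralD//.
  - apply: le_integral_ge0 => y _; first by rewrite lee_fin mulr_ge0.
    rewrite -EFinM -EFinD lee_fin -mulrDl; apply: ler_wpM2r => //.
    by rewrite -[X in (`|X| <= _)%R](subrKA a) (le_trans (ler_normD _ _))// (distrC a).
  - by move=> y _; rewrite mule_ge0 ?lee_fin.
  - by apply: emeasurable_funM => //; apply/measurable_EFinP; exact: measurable_funTS.
  - by move=> y _; rewrite lee_fin mulr_ge0.
  - by apply/measurable_EFinP; apply: measurable_funTS; exact: measurable_funM.
have mhE : measurable_fun E (EFin \o h) by apply/measurable_EFinP; exact: measurable_funTS.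
apply: (@le_trans _ _ (\int[mu]_(x in E) ((`|b x - a| * h x)%:E * If + (h x)%:E * Jf))).
  apply: le_integral_ge0 => x _; first by rewrite mule_ge0 ?lee_fin//; exact: oscillation_ge0.
  apply: le_trans (lee_wpmul2l _ (osc x)) _; first by rewrite lee_fin.
  rewrite ge0_muleDr//; last by rewrite mule_ge0.
  by rewrite muleA -EFinM mulrC.
have mbh : measurable_fun E (fun x => (`|b x - a| * h x)%:E).
  by apply/measurable_EFinP; apply: measurable_funTS; exact: measurable_funM.
rewrite ge0_integralD//; last 4 first.
- by move=> x _; rewrite mule_ge0 ?lee_fin// mulr_ge0.
- exact: emeasurable_funM.
- by move=> x _; rewrite mule_ge0 ?lee_fin.
- exact: emeasurable_funM.
rewrite ge0_integralZr//; last by move=> x _; rewrite lee_fin mulr_ge0.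
rewrite ge0_integralZr//; last by move=> x _; rewrite lee_fin.
apply: (@le_trans _ _ ((Pc%:E * Sh) * (Qc%:E * Sf) + (Qc%:E * Sh) * (Pc%:E * Sf))).
  apply: leeD; apply: lee_pmul => //.
  - by apply: integral_ge0 => x _; rewrite lee_fin mulr_ge0.
  - exact: H1.
  - exact: H2.
  - by apply: integral_ge0 => x _; rewrite lee_fin.
  - exact: H2.
  - exact: H1.
have E1 : (Pc%:E * Sh) * (Qc%:E * Sf) = (Pc * Qc)%:E * (Sf * Sh).
  by rewrite muleACA -EFinM (muleC Sh).
have E2 : (Qc%:E * Sh) * (Pc%:E * Sf) = (Pc * Qc)%:E * (Sf * Sh).
  by rewrite muleACA -EFinM (muleC Sh) (mulrC Qc).
rewrite E1 E2 -ge0_muleDl ?lee_fin ?mulr_ge0// -EFinD.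
rewrite le_eqVlt; apply/orP; left; apply/eqP; congr (_%:E * _).
rewrite /Pc /Qc powRM; [|exact: ltW|exact: ltW].
have -> : (e `^ (2 / u) = e `^ u^-1 * e `^ u^-1)%R.
  rewrite -powRD; last by rewrite (gt_eqF e0) implybT.
  by congr (_ `^ _)%R; field; rewrite gt_eqF.
ring.
Qed.

End one_ball.
End averaging_argument.

(** * Scale decomposition of the potential near its singularity *)

Section near_estimate.
Local Open Scope ereal_scope.
Context disp (X : measurableType disp) (R : realType)
  (mu : {sigma_finite_measure set X -> \bar R}) (d : X -> X -> R) (k g v : R)
  (c : nat -> X).
Hypothesis HS : homogeneous_space mu d k g v c.
Variable L : R.
Hypothesis kL : (4 * k ^+ 2 <= L)%R.
Variables (b : X -> R) (beta : X -> R -> R).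
Hypothesis mb : measurable_fun setT b.
Variable al : R.
Hypotheses (al0 : (0 < al)%R) (alg : (al < g)%R).
Let L0 : (0 < L)%R. Proof. by apply: lt_trans (L_gt1 HS kL). Qed.
Let L1 : (1 < L)%R. Proof. exact: (L_gt1 HS kL). Qed.
Let Li01 : (0 < L^-1 < 1)%R. Proof. by rewrite invr_gt0 L0 invf_lt1. Qed.
Local Notation maximal := (maximal mu d c L).

Definition potential (f : X -> R) (E : set X) (x : X) : \bar R :=
  \int[mu]_(y in E) ((`|b x - b y| * f y) * d x y `^ (al - g))%:E.

Lemma potential_ge0 f E x : (forall y, (0 <= f y)%R) -> 0 <= potential f E x.
Proof. by move=> f0; apply: integral_ge0 => y _; rewrite lee_fin !mulr_ge0 ?powR_ge0. Qed.

Lemma powR_anti (e x y : R) : (0 <= e)%R -> (0 < x)%R -> (x <= y)%R -> (y `^ (- e) <= x `^ (- e))%R.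
Proof.
move=> e0 x0 xy; have y0 : (0 < y)%R by apply: lt_le_trans xy.
rewrite !powRN lef_pV2 ?posrE ?powR_gt0//; apply: ge0_ler_powR => //; rewrite nnegrE; exact: ltW.
Qed.

Lemma Ladic_level (r t : R) : (0 < t)%R -> (t < r)%R ->
  exists i, (r * L^-1 ^+ i.+1 <= t)%R /\ (t < r * L^-1 ^+ i)%R.
Proof.
move=> t0 tr; have r0 : (0 < r)%R by apply: lt_trans tr.
have H : exists i, (r * L^-1 ^+ i.+1 <= t)%R.
  have l0 : (0 < ln L)%R by exact: ln_gt0.
  exists (Num.truncn (r / t / ln L)); rewrite exprVn ler_pdivrMr ?exprn_gt0// mulrC.
  rewrite -ler_pdivrMr// -[X in (_ <= X ^+ _)%R](lnK L0) -expRM_natl.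
  apply: le_trans (expR_ge1Dx _); apply: ltW; rewrite ltr_wpDl//.
  by rewrite -[ltLHS](@divfK _ (ln L)) ?gt_eqF// ltr_pM2r//; exact: truncnS_gt.
case: (ex_minnP H) => -[|i] Hi Hm; first by exists 0%N; rewrite expr0 mulr1.
exists i.+1; split => //; rewrite ltNge; apply/negP => /Hm.
by rewrite ltnn.
Qed.

(** On the shell between r L^(-i-1) and r L^(-i) the kernel weight is at most the stated
    coefficient; each shell is then enlarged to its ball. *)
Lemma potential_near_le (f : X -> R) (r : R) x : measurable_fun setT f ->
  (forall y, (0 <= f y)%R) -> (0 < r)%R ->
  potential f (qball d x r) x <= \sum_(i <oo)
   ((L `^ (g - al) * (r * L^-1 ^+ i) `^ (al - g))%:E *
     oscillation mu b f (qball d x (r * L^-1 ^+ i)) x).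
Proof.
move=> mf f0 r0; pose rd i := (r * L^-1 ^+ i)%R.
have rd0 i : (0 < rd i)%R by rewrite mulr_gt0// exprn_gt0// invr_gt0.
have mq t := measurable_qball HS x t.
have co0 i : (0 <= L `^ (g - al) * rd i `^ (al - g))%R by rewrite mulr_ge0 ?powR_ge0.
have mt := measurable_oscillation_term mb mf x.
pose F i y : \bar R := (L `^ (g - al) * rd i `^ (al - g))%:E *
  ((`|b x - b y| * f y) * \1_(qball d x (rd i)) y)%:E.
have F0 i y : 0 <= F i y by rewrite /F mule_ge0 ?lee_fin// !mulr_ge0.
have mt1 i : measurable_fun setT (fun y => ((`|b x - b y| * f y) * \1_(qball d x (rd i)) y)%:E).
  by apply/measurable_EFinP; apply: measurable_funM => //; exact: measurable_indic.
have mF i : measurable_fun setT (F i) by apply: emeasurable_funM.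
apply: (@le_trans _ _ (\int[mu]_y (\sum_(i <oo) F i y))); last first.
  rewrite integral_nneseries//; apply: lee_nneseries => i _.
    by move=> _; apply: integral_ge0.
  by rewrite ge0_integralZl_EFin// ?oscillation_indic// => y _; rewrite lee_fin !mulr_ge0.
rewrite /potential integral_mkcond; apply: le_integral_ge0 => y _.
  by rewrite patchE; case: ifP => // _; rewrite lee_fin !mulr_ge0 ?powR_ge0.
rewrite patchE; case: ifPn => [|_]; last exact: nneseries_ge0.
(* At distance 0 the weight is a nonzero power of 0, which is 0 by convention. *)
rewrite inE => xy; have := hs_ge0 HS x y; rewrite le_eqVlt => /predU1P[<-|t0].
  rewrite powR0 ?mulr0; first exact: nneseries_ge0.
  by rewrite subr_eq0 lt_eqF.
have [i [i1 i2]] := Ladic_level t0 xy.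
apply: (@le_trans _ _ (F i y)); last first.
  apply: le_trans (@nneseries_lim_ge _ (F^~ y) xpredT 0 i.+1 _); last by [].
  by rewrite big_nat_recr//= leeDr//; apply: sume_ge0.
rewrite /F indicE mem_set// mulr1 -EFinM lee_fin mulrC; apply: ler_wpM2r; first by rewrite mulr_ge0.
have -> : (al - g = - (g - al))%R by rewrite opprB.
have ga0 : (0 <= g - al)%R by rewrite subr_ge0 ltW.
apply: le_trans (powR_anti ga0 (rd0 i.+1) i1) _.
have -> : rd i.+1 = (L^-1 * rd i)%R by rewrite /rd exprS mulrCA.
rewrite powRM ?(ltW (rd0 _)) ?invr_ge0 ?(ltW L0)//.
by rewrite -[X in (X `^ _ * _ <= _)%R]powR_inv1 ?(ltW L0)// -powRrM mulN1r opprK.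
Qed.

Lemma measurable_potential (f : X -> R) (D : set X) : measurable_fun setT f ->
  (forall y, (0 <= f y)%R) -> measurable D ->
  measurable_fun setT (fun x => potential f D x).
Proof.
move=> mf f0 mD.
pose F (w : X * X) : \bar R :=
  (((`|b w.1 - b w.2| * f w.2) * d w.1 w.2 `^ (al - g)) * \1_D w.2)%:E.
have mF : measurable_fun setT F.
  apply/measurable_EFinP; apply: measurable_funM.
    apply: measurable_funM.
      apply: measurable_funM.
        apply: measurableT_comp => //; apply: measurable_funB.
          exact: (measurableT_comp mb measurable_fst).
        exact: (measurableT_comp mb measurable_snd).
      exact: (measurableT_comp mf measurable_snd).
    exact: (measurableT_comp (measurable_powR _) (hs_measurable HS)).
  have mI : measurable_fun setT (\1_D : X -> R) by exact: measurable_indic.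
  exact: (measurableT_comp mI measurable_snd).
have F0 w : 0 <= F w by rewrite lee_fin !mulr_ge0 ?powR_ge0.
have := @measurable_fun_fubini_tonelli_F _ _ _ _ _ mu _ mF F0.
congr measurable_fun; apply/funext => x.
rewrite /potential [RHS]integral_mkcond; apply: eq_integral => y _.
by rewrite patchE /F /= indicE; case: ifPn => yD; rewrite ?mulr1 ?mulr0.
Qed.

Lemma measurable_potential_qball (f : X -> R) (r : R) : measurable_fun setT f ->
  (forall y, (0 <= f y)%R) ->
  measurable_fun setT (fun x => potential f (qball d x r) x).
Proof.
move=> mf f0.
pose F (w : X * X) : \bar R :=
  (((`|b w.1 - b w.2| * f w.2) * d w.1 w.2 `^ (al - g)) * \1_(qball d w.1 r) w.2)%:E.
have mF : measurable_fun setT F.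
  apply/measurable_EFinP; apply: measurable_funM; last exact: (measurable_indic_qball HS).
  apply: measurable_funM.
    apply: measurable_funM.
      apply: measurableT_comp => //; apply: measurable_funB.
        exact: (measurableT_comp mb measurable_fst).
      exact: (measurableT_comp mb measurable_snd).
    exact: (measurableT_comp mf measurable_snd).
  exact: (measurableT_comp (measurable_powR _) (hs_measurable HS)).
have F0 w : 0 <= F w by rewrite lee_fin !mulr_ge0 ?powR_ge0.
have := @measurable_fun_fubini_tonelli_F _ _ _ _ _ mu _ mF F0.
congr measurable_fun; apply/funext => x.
rewrite /potential [RHS]integral_mkcond; apply: eq_integral => y _.
by rewrite patchE /F /= indicE; case: ifPn => yD; rewrite ?mulr1 ?mulr0.
Qed.

Lemma measurable_integral_qball (F : X -> R) (r : R) : measurable_fun setT F ->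
  (forall y, (0 <= F y)%R) ->
  measurable_fun setT (fun z => \int[mu]_(y in qball d z r) (F y)%:E).
Proof.
move=> mF0 F0.
pose G (w : X * X) : \bar R := (F w.2 * \1_(qball d w.1 r) w.2)%:E.
have mG : measurable_fun setT G.
  apply/measurable_EFinP; apply: measurable_funM; last exact: (measurable_indic_qball HS).
  exact: (measurableT_comp mF0 measurable_snd).
have G0 w : 0 <= G w by rewrite lee_fin mulr_ge0.
have := @measurable_fun_fubini_tonelli_F _ _ _ _ _ mu _ mG G0.
congr measurable_fun; apply/funext => x.
rewrite [RHS]integral_mkcond; apply: eq_integral => y _.
by rewrite patchE /G /= indicE; case: ifPn => yD; rewrite ?mulr1 ?mulr0.
Qed.

End near_estimate.

(** * Duality estimate of the near part *)

Section near_duality.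
Local Open Scope ereal_scope.
Context disp (X : measurableType disp) (R : realType)
  (mu : {sigma_finite_measure set X -> \bar R}) (d : X -> X -> R) (k g v : R)
  (c : nat -> X).
Hypothesis HS : homogeneous_space mu d k g v c.
Variable L : R.
Hypothesis kL : (4 * k ^+ 2 <= L)%R.
Variables (b : X -> R) (beta : X -> R -> R).
Hypothesis mb : measurable_fun setT b.
Variables (al be u s B : R).
Hypotheses (al0 : (0 < al)%R) (alg : (al < g)%R) (be0 : (0 < be)%R).
Hypotheses (u0 : (0 < u)%R) (s0 : (0 < s)%R) (us : (u^-1 + s^-1 = 1)%R).
Hypothesis B0 : (0 < B)%R.
Hypothesis bB : forall x r, (0 < r)%R ->
  \int[mu]_(y in qball d x r) (`|b y - beta x r| `^ u)%:E <= B%:E * mu (qball d x r).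
Let L0 : (0 < L)%R. Proof. by apply: lt_trans (L_gt1 HS kL). Qed.
Let L1 : (1 < L)%R. Proof. exact: (L_gt1 HS kL). Qed.
Let Li01 : (0 < L^-1 < 1)%R. Proof. by rewrite invr_gt0 L0 invf_lt1. Qed.
Let v0 : (0 < v)%R. Proof. exact: (hs_v HS). Qed.
Local Notation maximal := (maximal mu d c L).
Local Notation th := (be / (al + be))%R.

Lemma powR_split (w l t a e : R) : (0 <= w)%R -> (0 <= l)%R -> (0 <= t)%R ->
  ((w * (l * t) `^ a) `^ e = (w * l `^ a) `^ e * t `^ (a * e))%R.
Proof. by move=> w0 l0 t0; rewrite (powRM a l0 t0) mulrA powRM ?mulr_ge0 ?powR_ge0// -powRrM. Qed.

Lemma mean_le_maximal (F : X -> R) z t : (0 < t)%R -> measurable_fun setT F ->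
  (forall x, 0 <= F x)%R ->
  (\int[mu]_(y in qball d z (L * t)) (F y `^ s)%:E) `^ s^-1 <=
  ((v * (L ^+ 3) `^ g) `^ s^-1 * t `^ (g / s))%:E *
    maximal (fun y => (F y `^ s)%:E) z `^ s^-1.
Proof.
move=> t0 mF F0.
have Fs0 y : 0 <= (F y `^ s)%:E by rewrite lee_fin powR_ge0.
have Lt0 : (0 < L * t)%R by rewrite mulr_gt0.
have := qball_integral_le HS kL z Lt0 Fs0.
have si0 : (0 <= s^-1)%R by rewrite invr_ge0 ltW.
have I0 : 0 <= \int[mu]_(y in qball d z (L * t)) (F y `^ s)%:E by apply: integral_ge0.
move=> /(le_poweR si0 I0) /le_trans; apply.
rewrite poweRM; last 2 first.
- by rewrite lee_fin mulr_ge0 ?powR_ge0// ltW.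
- by apply: (maximal_ge0 HS kL).
apply: lee_wpmul2r; first exact: poweR_ge0.
rewrite poweR_EFin lee_fin mulrA -exprSr powR_split//; [exact: ltW|exact/ltW/exprn_gt0|exact: ltW].
Qed.

(** Bookkeeping of the powers of the scale: with 1/u + 1/s = 1 they add up to al - g/s. *)
Lemma scale_constant t : (0 < t)%R ->
  (L `^ (g - al) * t `^ (al - g) * (v * t `^ g)^-1 *
   (2 * B `^ u^-1 * (v * (L * t) `^ g) `^ (2 / u)) *
   ((v * (L ^+ 3) `^ g) `^ s^-1 * t `^ (g / s)) =
   (L `^ (g - al) * v^-1 * (2 * B `^ u^-1 * (v * L `^ g) `^ (2 / u)) *
     (v * (L ^+ 3) `^ g) `^ s^-1) * t `^ (al - g / s))%R.
Proof.
move=> t0; rewrite powR_split; [|exact: ltW|exact: ltW|exact: ltW].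
have -> : (t `^ (al - g / s) = t `^ (al - g) * (t `^ g)^-1 * t `^ (g * (2 / u)) * t `^ (g / s))%R.
  have tn x : (x == 0)%R ==> (t != 0)%R by rewrite (gt_eqF t0) implybT.
  rewrite -powRN -!powRD ?tn//; congr (_ `^ _)%R.
  have -> : (u^-1 = 1 - s^-1)%R by rewrite -us addrK.
  ring.
move: (L `^ (g - al))%R (t `^ (al - g))%R (t `^ g)%R (B `^ u^-1)%R ((v * L `^ g) `^ (2 / u))%R
  (t `^ (g * (2 / u)))%R ((v * (L ^+ 3) `^ g) `^ s^-1)%R (t `^ (g / s))%R => x1 x2 x3 x4 x5 x6 x7 x8.
by rewrite invfM; move: (v^-1)%R (x3^-1)%R => y1 y2; ring.
Qed.

(** At each scale, averaging over centres and Hölder with [bB] leave the s-norms of f and h on one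
    ball. That of h is replaced by its maximal function. That of f has two bounds, giving in all
    t^al times a maximal function or t^(-be) times [N], and [sum_min_le] sums the smaller ones over
    the scales. *)
Lemma near_duality : exists2 K : R, (0 < K)%R & forall (f h : X -> R) (r N : R),
  measurable_fun setT f -> measurable_fun setT h ->
  (forall x, 0 <= f x)%R -> (forall x, 0 <= h x)%R -> (0 < r)%R -> (0 < N)%R ->
  (forall z t, (0 < t)%R -> \int[mu]_(y in qball d z t) (f y `^ s)%:E <=
      (N `^ s * t `^ (g - s * (al + be)))%:E) ->
  \int[mu]_x ((h x)%:E * potential mu d g b al f (qball d x r) x) <=
  (K * N `^ (1 - th))%:E *
    \int[mu]_z (maximal (fun y => (f y `^ s)%:E) z `^ (th / s) *
                maximal (fun y => (h y `^ s)%:E) z `^ s^-1).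
Proof.
have k0 : (0 < al + be)%R by rewrite addr_gt0.
have th0 : (0 < th)%R by rewrite divr_gt0.
have [K2 K20 HK2] := sum_min_le al0 be0 Li01.
have Lg0 e : (0 < L `^ e)%R by rewrite powR_gt0.
have c30 : (0 < (v * (L ^+ 3) `^ g) `^ s^-1)%R.
  by rewrite powR_gt0// mulr_gt0// powR_gt0// exprn_gt0.
have [K1 K10 K1E] : exists2 K1, (0 < K1)%R & forall t, (0 < t)%R ->
  (L `^ (g - al) * t `^ (al - g) * (v * t `^ g)^-1 *
   (2 * B `^ u^-1 * (v * (L * t) `^ g) `^ (2 / u)) *
   ((v * (L ^+ 3) `^ g) `^ s^-1 * t `^ (g / s)) = K1 * t `^ (al - g / s))%R.
  eexists; last exact: scale_constant.
  apply: mulr_gt0 => //; apply: mulr_gt0; first by rewrite mulr_gt0 ?invr_gt0.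
  by rewrite mulr_gt0 ?powR_gt0 ?mulr_gt0// ?powR_gt0.
pose c1 := ((v * (L ^+ 3) `^ g) `^ s^-1)%R; pose c2 := (L `^ (g / s - (al + be)))%R.
have c20 : (0 < c2)%R by exact: powR_gt0.
have K0 : (0 < K1 * (K2 * (c1 `^ th * c2 `^ (1 - th))))%R.
  by apply: mulr_gt0 => //; apply: mulr_gt0 => //; apply: mulr_gt0; exact: powR_gt0.
exists (K1 * (K2 * (c1 `^ th * c2 `^ (1 - th))))%R => //.
move=> f h r N mf mh f0 h0 r0 N0 HN.
set Mf := maximal _; set Mh := maximal _.
pose rd i := (r * L^-1 ^+ i)%R.
have rd0 i : (0 < rd i)%R by rewrite mulr_gt0// exprn_gt0// invr_gt0.
have fs0 y : 0 <= (f y `^ s)%:E by rewrite lee_fin powR_ge0.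
have hs0 y : 0 <= (h y `^ s)%:E by rewrite lee_fin powR_ge0.
have mfs : measurable_fun setT (fun y => (f y `^ s)%R).
  exact: (measurableT_comp (measurable_powR s) mf).
have Mf0 z : 0 <= Mf z by apply: (maximal_ge0 HS kL).
have Mh0 z : 0 <= Mh z by apply: (maximal_ge0 HS kL).
have mMf : measurable_fun setT Mf by apply: (measurable_maximal HS).
have mMh : measurable_fun setT Mh by apply: (measurable_maximal HS).
have mpow (F : X -> \bar R) e : measurable_fun setT F -> measurable_fun setT (fun z => F z `^ e).
  by move=> mF; exact: (measurableT_comp (measurable_poweR e) mF).
(* This norm is kept exact until the scales are summed, since its better bound depends on the
   scale. *)
pose Sf i z := (\int[mu]_(y in qball d z (L * rd i)) (f y `^ s)%:E) `^ s^-1.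
have Sf0 i z : 0 <= Sf i z by exact: poweR_ge0.
have mSf i : measurable_fun setT (Sf i).
  by apply: mpow; apply: (measurable_integral_qball HS) => // y; exact: powR_ge0.
have osc0 i x : 0 <= oscillation mu b f (qball d x (rd i)) x by exact: oscillation_ge0.
have mosc i : measurable_fun setT (fun x => (h x)%:E * oscillation mu b f (qball d x (rd i)) x).
  apply: emeasurable_funM; first exact/measurable_EFinP.
  exact: (measurable_oscillation HS).
pose co i := (L `^ (g - al) * rd i `^ (al - g))%R.
have co0 i : (0 <= co i)%R by rewrite mulr_ge0 ?powR_ge0.
(* one scale *)
have scale i : (co i)%:E * \int[mu]_x ((h x)%:E * oscillation mu b f (qball d x (rd i)) x) <=
    \int[mu]_z ((K1 * rd i `^ (al - g / s))%:E * Sf i z * Mh z `^ s^-1).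
  have vr0 : (0 < v * rd i `^ g)%R by rewrite mulr_gt0// powR_gt0.
  have av := average_over_centers HS kL mb mf mh f0 h0 (rd0 i).
  have vi0 : 0 <= ((co i) * (v * rd i `^ g)^-1)%:E.
    by rewrite lee_fin mulr_ge0// invr_ge0 ltW.
  have -> : (co i)%:E * \int[mu]_x ((h x)%:E * oscillation mu b f (qball d x (rd i)) x) =
    ((co i) * (v * rd i `^ g)^-1)%:E * ((v * rd i `^ g)%:E *
      \int[mu]_x ((h x)%:E * oscillation mu b f (qball d x (rd i)) x)).
    by rewrite [RHS]muleA -EFinM divfK// gt_eqF.
  apply: le_trans (lee_wpmul2l vi0 av) _.
  have cc0 : (0 <= 2 * B `^ u^-1 * (v * (L * rd i) `^ g) `^ (2 / u) * (c1 * rd i `^ (g / s)))%R.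
    by apply: mulr_ge0; [apply: mulr_ge0; [apply: mulr_ge0|]|apply: mulr_ge0]; rewrite ?powR_ge0.
  have SM0 z : 0 <= Sf i z * Mh z `^ s^-1 by apply: mule_ge0; [exact: Sf0|exact: poweR_ge0].
  apply: (@le_trans _ _ (((co i) * (v * rd i `^ g)^-1)%:E * \int[mu]_z
     ((2 * B `^ u^-1 * (v * (L * rd i) `^ g) `^ (2 / u) * (c1 * rd i `^ (g / s)))%:E *
      (Sf i z * Mh z `^ s^-1)))).
    apply: lee_wpmul2l => //; apply: le_integral_ge0 => z _.
      by apply: integral_ge0 => x _; rewrite mule_ge0 ?lee_fin//; exact: oscillation_ge0.
    have Lr0 : (0 < L * rd i)%R by rewrite mulr_gt0.
    have e0 : (0 < v * (L * rd i) `^ g)%R by rewrite mulr_gt0// powR_gt0.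
    have mE := measurable_qball HS z (L * rd i).
    have Ee := hs_volume HS z Lr0.
    have bE := bB z Lr0; rewrite Ee -EFinM in bE.
    apply: le_trans (integral_oscillation_le mb mf mh f0 h0 u0 s0 us mE Ee e0 B0 bE) _.
    rewrite (EFinM _ (c1 * _)) -muleA; apply: lee_wpmul2l.
      by rewrite lee_fin; apply: mulr_ge0; rewrite ?powR_ge0//; apply: mulr_ge0; rewrite ?powR_ge0.
    rewrite muleCA; apply: lee_wpmul2l; first exact: poweR_ge0.
    exact: mean_le_maximal.
  rewrite -ge0_integralZl//; last 2 first.
  - apply: emeasurable_funM; first exact: measurable_cst.
    by apply: emeasurable_funM; [exact: mSf|exact: mpow].
  - by move=> z _; apply: mule_ge0; [rewrite lee_fin|exact: SM0].
  apply: le_integral_ge0 => z _.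
    by apply: mule_ge0 => //; apply: mule_ge0; [rewrite lee_fin|exact: SM0].
  rewrite muleA -EFinM -muleA le_eqVlt; apply/orP; left; apply/eqP; congr (_%:E * _).
  by etransitivity; last exact: (K1E _ (rd0 i)); exact: mulrA.
apply: (@le_trans _ _ (\int[mu]_x (\sum_(i <oo)
    ((co i)%:E * ((h x)%:E * oscillation mu b f (qball d x (rd i)) x))))).
  apply: le_integral_ge0 => x _; first by rewrite mule_ge0 ?lee_fin//; exact: potential_ge0.
  have hx0 : 0 <= (h x)%:E by rewrite lee_fin.
  apply: le_trans (lee_wpmul2l hx0 (potential_near_le HS kL mb alg x mf f0 r0)) _.
  rewrite -nneseriesZl; last by move=> i _; apply: mule_ge0; [rewrite lee_fin; exact: co0|exact: osc0].
  apply: lee_nneseries => i _; last by rewrite muleCA.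
  by move=> _; apply: mule_ge0 => //; apply: mule_ge0; [rewrite lee_fin; exact: co0|exact: osc0].
have hosc0 i x : 0 <= (h x)%:E * oscillation mu b f (qball d x (rd i)) x.
  by apply: mule_ge0; [rewrite lee_fin|exact: osc0].
have chosc0 i x : 0 <= (co i)%:E * ((h x)%:E * oscillation mu b f (qball d x (rd i)) x).
  by apply: mule_ge0; [rewrite lee_fin|exact: hosc0].
rewrite integral_nneseries//; last first.
  by move=> i; apply: emeasurable_funM.
apply: (@le_trans _ _ (\sum_(i <oo)
    \int[mu]_z ((K1 * rd i `^ (al - g / s))%:E * Sf i z * Mh z `^ s^-1))).
  apply: lee_nneseries => i _.
    by move=> _; apply: integral_ge0.
  by apply: le_trans (scale i); rewrite ge0_integralZl_EFin.
have T0 i z : 0 <= (K1 * rd i `^ (al - g / s))%:E * Sf i z * Mh z `^ s^-1.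
  apply: mule_ge0; last exact: poweR_ge0.
  by apply: mule_ge0; [rewrite lee_fin; apply: mulr_ge0; [exact: ltW|exact: powR_ge0]|exact: Sf0].
rewrite -integral_nneseries//; last first.
  move=> i; apply: emeasurable_funM; last exact: mpow.
  by apply: emeasurable_funM.
rewrite -ge0_integralZl//; last 3 first.
- by apply: emeasurable_funM; exact: mpow.
- by move=> z _; rewrite mule_ge0// poweR_ge0.
- by rewrite lee_fin mulr_ge0 ?powR_ge0// ltW.
apply: le_integral_ge0 => z _; first exact: nneseries_ge0.
apply: lime_le; first exact: is_cvg_nneseries.
apply: nearW => n; rewrite big_mkord.
rewrite -ge0_sume_distrl; last first.
  move=> i _; apply: mule_ge0; last exact: Sf0.
  by rewrite lee_fin; apply: mulr_ge0; [exact: ltW|exact: powR_ge0].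
rewrite muleA; apply: lee_wpmul2r; first exact: poweR_ge0.
have Kc0 : (0 < K1 * (K2 * (c1 `^ th * c2 `^ (1 - th))) * N `^ (1 - th))%R.
  by apply: mulr_gt0 => //; exact: powR_gt0.
case E : (Mf z) (Mf0 z) => [m| |//] m0; last first.
  by rewrite poweRyr ?mulf_neq0 ?invr_neq0 ?gt_eqF// gt0_muley ?leey// lte_fin.
have {}m0 : (0 <= m)%R by rewrite -lee_fin.
rewrite poweR_EFin -EFinM.
pose S i := fine (Sf i z).
have SE i : Sf i z = (S i)%:E /\ (S i <= c1 * rd i `^ (g / s) * m `^ s^-1)%R /\
    (S i <= N * (L * rd i) `^ (g / s - (al + be)))%R.
  have H1 : Sf i z <= (c1 * rd i `^ (g / s) * m `^ s^-1)%:E.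
    rewrite EFinM -poweR_EFin -E; exact: mean_le_maximal.
  have H2 : Sf i z <= (N * (L * rd i) `^ (g / s - (al + be)))%:E.
    have Lr0 : (0 < L * rd i)%R by rewrite mulr_gt0.
    have si0 : (0 <= s^-1)%R by rewrite invr_ge0 ltW.
    have I0 : 0 <= \int[mu]_(y in qball d z (L * rd i)) (f y `^ s)%:E by apply: integral_ge0.
    apply: le_trans (le_poweR si0 I0 (HN z _ Lr0)) _.
    rewrite poweR_EFin lee_fin powRM ?powR_ge0// -!powRrM mulfV ?gt_eqF// powRr1 ?(ltW N0)//.
    by rewrite mulrBl mulrAC mulfV ?gt_eqF// mul1r.
  have Sfin : Sf i z \is a fin_num by rewrite ge0_fin_numE// (le_lt_trans H1)// ltry.
  by rewrite /S -!lee_fin fineK.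
have -> : \sum_(i < n) (K1 * rd i `^ (al - g / s))%:E * Sf i z =
    (K1 * \sum_(i < n) (rd i `^ (al - g / s) * S i))%:E.
  rewrite mulr_sumr -sumEFin; apply: eq_bigr => i _.
  by rewrite (SE i).1 -EFinM mulrA.
rewrite lee_fin -2!(mulrA K1); apply: ler_wpM2l; first exact: ltW.
pose m' := (c1 * m `^ s^-1)%R; pose N' := (N * c2)%R.
have m'0 : (0 <= m')%R by rewrite mulr_ge0 ?powR_ge0.
have N'0 : (0 < N')%R by rewrite mulr_gt0.
apply: (@le_trans _ _ (\sum_(i < n) Num.min (m' * rd i `^ al) (N' * rd i `^ (- be)))%R).
  apply: ler_sum => i _; have [_ [S1 S2]] := SE i.
  have tn x : (x == 0)%R ==> (rd i != 0)%R by rewrite (gt_eqF (rd0 i)) implybT.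
  rewrite le_min; apply/andP; split.
    apply: le_trans (ler_wpM2l (powR_ge0 _ _) S1) _.
    rewrite le_eqVlt; apply/orP; left; apply/eqP.
    have -> : (rd i `^ al = rd i `^ (al - g / s) * rd i `^ (g / s))%R.
      by rewrite -powRD ?tn// subrK.
    rewrite /m'; move: (m `^ _)%R (rd i `^ (al - g / s))%R (rd i `^ (g / s))%R (c1).
    by move=> y1 y2 y3 y4; ring.
  apply: le_trans (ler_wpM2l (powR_ge0 _ _) S2) _.
  rewrite le_eqVlt; apply/orP; left; apply/eqP.
  have -> : (rd i `^ (- be) = rd i `^ (al - g / s) * rd i `^ (g / s - (al + be)))%R.
    have tE : (- be = (al - g / s) + (g / s - (al + be)))%R by ring.
    by rewrite [in LHS]tE powRD ?tn.
  rewrite powRM; [|exact: ltW|exact: ltW].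
  by rewrite /N' /c2; move: (N) (L `^ _)%R (rd i `^ _)%R (rd i `^ _)%R => y1 y2 y3 y4; ring.
apply: le_trans (HK2 n r m' N' r0 m'0 N'0) _; rewrite -2!(mulrA K2).
apply: ler_wpM2l; first exact: ltW.
rewrite /m' /N' powRM ?powR_ge0//.
rewrite powRM; [|exact: ltW|exact: ltW].
rewrite -powRrM (mulrC s^-1)%R le_eqVlt; apply/orP; left; apply/eqP.
by move: (c1 `^ _)%R (m `^ _)%R (N `^ _)%R (c2 `^ _)%R => y1 y2 y3 y4; ring.
Qed.

End near_duality.

(** * L^q bound of the near part by absorption *)

Section near_bound.
Local Open Scope ereal_scope.

Lemma young_ereal {R : realType} (p q : R) (x y : \bar R) : (0 < p)%R -> (0 < q)%R ->
  (p^-1 + q^-1 = 1)%R -> 0 <= x -> 0 <= y ->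
  x * y <= x `^ p * p^-1%:E + y `^ q * q^-1%:E.
Proof.
move=> p0 q0 pq x0 y0.
have pi0 : (0 < p^-1)%R by rewrite invr_gt0.
have qi0 : (0 < q^-1)%R by rewrite invr_gt0.
case: x x0 => [x| |//] x0; last first.
  have -> : +oo `^ p * p^-1%:E = +oo :> \bar R.
    by rewrite poweRyr ?gt_eqF// gt0_mulye// lte_fin.
  rewrite addye ?leey// gt_eqF// (lt_le_trans (ltNyr 0))//.
  by rewrite mule_ge0 ?poweR_ge0// lee_fin ltW.
case: y y0 => [y| |//] y0; last first.
  have -> : +oo `^ q * q^-1%:E = +oo :> \bar R.
    by rewrite poweRyr ?gt_eqF// gt0_mulye// lte_fin.
  by rewrite addey ?leey// poweR_EFin -EFinM.
rewrite !poweR_EFin -!EFinM -EFinD lee_fin; exact: conjugate_powR.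
Qed.

Context disp (X : measurableType disp) (R : realType)
  (mu : {sigma_finite_measure set X -> \bar R}) (d : X -> X -> R) (k g v : R)
  (c : nat -> X).
Hypothesis HS : homogeneous_space mu d k g v c.
Variable L : R.
Hypothesis kL : (4 * k ^+ 2 <= L)%R.
Variables (b : X -> R) (beta : X -> R -> R).
Hypothesis mb : measurable_fun setT b.
Variables (al be u s B q q' : R).
Hypotheses (al0 : (0 < al)%R) (alg : (al < g)%R) (be0 : (0 < be)%R).
Hypotheses (u0 : (0 < u)%R) (s0 : (0 < s)%R) (us : (u^-1 + s^-1 = 1)%R).
Hypothesis B0 : (0 < B)%R.
Hypothesis bB : forall x r, (0 < r)%R ->
  \int[mu]_(y in qball d x r) (`|b y - beta x r| `^ u)%:E <= B%:E * mu (qball d x r).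
Local Notation th := (be / (al + be))%R.
Local Notation p := (th * q)%R.
Hypotheses (q0 : (0 < q)%R) (q'0 : (0 < q')%R) (qq' : (q^-1 + q'^-1 = 1)%R).
Hypotheses (sp : (s < p)%R) (sq' : (s < q')%R).

(** The pairing of the potential with its own power q - 1 is bounded through [near_duality]; Young's
    inequality separates the two maximal functions, to which the maximal theorem applies with
    exponents p/s and q'/s. The term in [h] returns half of the left-hand side and is absorbed. *)
Lemma near_bound : exists2 K : R, (0 < K)%R & forall (f : X -> R) (r N : R) (E : set X),
  measurable_fun setT f -> (forall x, 0 <= f x)%R -> (0 < r)%R -> (0 < N)%R ->
  measurable E -> mu E < +oo ->
  (forall z t, (0 < t)%R -> \int[mu]_(y in qball d z t) (f y `^ s)%:E <=
      (N `^ s * t `^ (g - s * (al + be)))%:E) ->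
  \int[mu]_(x in E) potential mu d g b al f (qball d x r) x `^ q <=
  (K * N `^ (q - p))%:E * \int[mu]_x (f x `^ p)%:E.
Proof.
have [K K0 HK] := near_duality HS kL mb al0 alg be0 u0 s0 us B0 bB.
have ps1 : (1 < p / s)%R by rewrite ltr_pdivlMr// mul1r.
have qs1 : (1 < q' / s)%R by rewrite ltr_pdivlMr// mul1r.
have [C1 C10 HC1] := maximal_strong HS kL ps1.
have [C2 C20 HC2] := maximal_strong HS kL qs1.
(* The weight in Young's inequality for which the term with constant [C2] comes out as exactly one
   half. *)
pose tau := ((q' / (2 * C2)) `^ q'^-1)%R.
have tau0 : (0 < tau)%R by rewrite powR_gt0// divr_gt0// mulr_gt0.
have tauE : (tau `^ q' = q' / (2 * C2))%R.
  by rewrite /tau -powRrM mulVf ?gt_eqF// powRr1// divr_ge0// ltW// mulr_gt0.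
exists (2 * (K / tau) `^ q * C1 / q)%R.
  by rewrite !mulr_gt0 ?invr_gt0// powR_gt0// divr_gt0.
move=> f r N E mf f0 r0 N0 mE Eoo HN.
pose T x := potential mu d g b al f (qball d x r) x.
have T0 x : 0 <= T x by exact: potential_ge0.
have mT : measurable_fun setT T by exact: (measurable_potential_qball HS).
apply: (integral_poweR_trunc mE (measurable_funTS mT) (fun x _ => T0 x) q0) => n.
pose t x := fine (mine (T x) n%:R%:E).
have tE x : mine (T x) n%:R%:E = (t x)%:E.
  have m0 : 0 <= mine (T x) n%:R%:E by rewrite le_min T0 lee_fin ler0n.
  rewrite /t fineK// ge0_fin_numE//.
  by rewrite (@le_lt_trans _ _ n%:R%:E) ?ltry// ge_min lexx orbT.
have t0 z : (0 <= t z)%R.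
  by rewrite -lee_fin -tE le_min T0 lee_fin ler0n.
have tn z : (t z <= n%:R)%R by rewrite -lee_fin -tE ge_min lexx orbT.
have tT z : (t z)%:E <= T z by rewrite -tE ge_min lexx.
have mt : measurable_fun setT t.
  apply: measurableT_comp; first exact: fine_measurable.
  by apply: measurable_mine.
rewrite (eq_integral (fun x => (t x `^ q)%:E)); last by move=> x _; rewrite tE poweR_EFin.
(* The extremal test function: its q'-th power integrates to the quantity to be bounded, which is
   finite because [t] is bounded by n and [E] has finite measure. *)
pose h x := (t x `^ (q - 1) * \1_E x)%R.
have h0 x : (0 <= h x)%R by rewrite mulr_ge0 ?powR_ge0.
have mh : measurable_fun setT h.
  apply: measurable_funM; last exact: measurable_indic.
  exact: (measurableT_comp (measurable_powR _) mt).
set Y := \int[mu]_x (f x `^ p)%:E.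
have Y0 : 0 <= Y by apply: integral_ge0 => x _; rewrite lee_fin powR_ge0.
set I := \int[mu]_(x in E) (t x `^ q)%:E.
have I0 : 0 <= I by apply: integral_ge0 => x _; rewrite lee_fin powR_ge0.
have Ifin : I \is a fin_num.
  rewrite ge0_fin_numE//; apply: (@le_lt_trans _ _ (\int[mu]_(x in E) (n%:R `^ q)%:E)).
    apply: le_integral_ge0 => x _; rewrite lee_fin ?powR_ge0//.
    by apply: ge0_ler_powR; rewrite ?nnegrE//; exact: ltW.
  by rewrite integral_cst// lte_mul_pinfty// lee_fin powR_ge0.
pose cN := (K * N `^ (1 - th))%R.
have cN0 : (0 < cN)%R by rewrite mulr_gt0// powR_gt0.
set Mf := maximal mu d c L (fun y => (f y `^ s)%:E).
set Mh := maximal mu d c L (fun y => (h y `^ s)%:E).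
have Ppow0 (F : X -> R) (e : R) x : 0 <= (F x `^ e)%:E by rewrite lee_fin powR_ge0.
have mpow (F : X -> R) (e : R) : measurable_fun setT F -> measurable_fun setT (fun x => (F x `^ e)%:E).
  by move=> mF; apply/measurable_EFinP; exact: (measurableT_comp (measurable_powR e) mF).
have mepow (F : X -> \bar R) e : measurable_fun setT F -> measurable_fun setT (fun z => F z `^ e).
  by move=> mF; exact: (measurableT_comp (measurable_poweR e) mF).
have Mf0 z : 0 <= Mf z by apply: (maximal_ge0 HS kL).
have Mh0 z : 0 <= Mh z by apply: (maximal_ge0 HS kL).
have mMf : measurable_fun setT Mf by apply: (measurable_maximal HS).
have mMh : measurable_fun setT Mh by apply: (measurable_maximal HS).
have IT : I <= \int[mu]_x ((h x)%:E * T x).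
  rewrite /I integral_mkcond; apply: le_integral_ge0 => x _.
    by rewrite patchE; case: ifP => // _; rewrite lee_fin powR_ge0.
  rewrite patchE /h indicE; case: ifPn => xE; last by rewrite mulr0 mul0e.
  rewrite mulr1 -(mulr_powRB1 (t0 x) q0) mulrC EFinM.
  by apply: lee_wpmul2l; rewrite ?lee_fin ?powR_ge0.
have II : \int[mu]_x (h x `^ q')%:E = I.
  rewrite /I [RHS]integral_mkcond; apply: eq_integral => x _.
  rewrite patchE /h indicE; case: ifPn => xE; last by rewrite mulr0 powR0// gt_eqF.
  rewrite mulr1 -powRrM; congr ((_ `^ _)%:E).
  have E1 : (q' + q = q * q')%R by rewrite -[RHS]mulr1 -qq'; field; rewrite !gt_eqF.
  by rewrite mulrBl mul1r -E1 addrAC subrr add0r.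
have Hn := HK f h r N mf mh f0 h0 r0 N0 HN.
have MfE z : (cN%:E * tau^-1%:E * Mf z `^ (th / s)) `^ q =
    ((cN / tau) `^ q)%:E * Mf z `^ (p / s).
  rewrite -EFinM poweRM ?poweR_ge0//; last by rewrite lee_fin divr_ge0// ltW.
  by rewrite poweR_EFin -poweRrM (mulrAC th).
have MhE z : (tau%:E * Mh z `^ s^-1) `^ q' = (tau `^ q')%:E * Mh z `^ (q' / s).
  rewrite poweRM ?poweR_ge0//; last by rewrite lee_fin ltW.
  by rewrite poweR_EFin -poweRrM (mulrC s^-1)%R.
have main : I <= ((cN / tau) `^ q / q)%:E * (C1%:E * Y) + (tau `^ q' / q')%:E * (C2%:E * I).
  apply: le_trans IT _; apply: le_trans Hn _; rewrite -/cN -/Mf -/Mh.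
  rewrite -ge0_integralZl//; last 3 first.
  - by apply: emeasurable_funM; exact: mepow.
  - by move=> z _; rewrite mule_ge0// poweR_ge0.
  - by rewrite lee_fin ltW.
  apply: (@le_trans _ _ (\int[mu]_z (((cN / tau) `^ q / q)%:E * Mf z `^ (p / s) +
     (tau `^ q' / q')%:E * Mh z `^ (q' / s)))).
    apply: le_integral_ge0 => z _.
      by rewrite mule_ge0// ?lee_fin ?(ltW cN0)// mule_ge0 ?poweR_ge0.
    have -> : cN%:E * (Mf z `^ (th / s) * Mh z `^ s^-1) =
        (cN%:E * tau^-1%:E * Mf z `^ (th / s)) * (tau%:E * Mh z `^ s^-1).
      by rewrite [RHS]muleACA -!EFinM divfK// gt_eqF.
    have X1 : 0 <= cN%:E * tau^-1%:E * Mf z `^ (th / s).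
      by rewrite mule_ge0 ?poweR_ge0// -EFinM lee_fin divr_ge0// ltW.
    have X2 : 0 <= tau%:E * Mh z `^ s^-1.
      by rewrite mule_ge0 ?poweR_ge0// lee_fin ltW.
    apply: le_trans (young_ereal q0 q'0 qq' X1 X2) _.
    by rewrite MfE MhE muleAC -EFinM [X in _ + X <= _]muleAC -EFinM.
  have ca0 : (0 <= (cN / tau) `^ q / q)%R by rewrite divr_ge0 ?powR_ge0// ltW.
  have cb0 : (0 <= tau `^ q' / q')%R by rewrite divr_ge0 ?powR_ge0// ltW.
  rewrite ge0_integralD//; last 4 first.
  - by move=> z _; rewrite mule_ge0 ?poweR_ge0.
  - by apply: emeasurable_funM => //; exact: mepow.
  - by move=> z _; rewrite mule_ge0 ?poweR_ge0.
  - by apply: emeasurable_funM => //; exact: mepow.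
  rewrite ge0_integralZl_EFin//; [|by move=> z _; exact: poweR_ge0|exact: mepow].
  rewrite ge0_integralZl_EFin//; [|by move=> z _; exact: poweR_ge0|exact: mepow].
  apply: leeD; apply: lee_wpmul2l; rewrite ?lee_fin//.
    apply: le_trans (HC1 _ (mpow f s mf) (Ppow0 f s)) _.
    rewrite le_eqVlt; apply/orP; left; apply/eqP; congr (_ * _).
    by apply: eq_integral => x _; rewrite poweR_EFin -powRrM mulrCA mulfV ?mulr1// gt_eqF.
  apply: le_trans (HC2 _ (mpow h s mh) (Ppow0 h s)) _.
  rewrite le_eqVlt; apply/orP; left; apply/eqP; congr (_ * _); rewrite -II.
  by apply: eq_integral => x _; rewrite poweR_EFin -powRrM mulrCA mulfV ?mulr1// gt_eqF.
have half : ((tau `^ q' / q') * C2 = 2^-1)%R.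
  by rewrite tauE; field; rewrite !gt_eqF.
have Hc : ((cN / tau) `^ q = (K / tau) `^ q * N `^ (q - p))%R.
  have Kt0 : (0 <= K / tau)%R by rewrite divr_ge0// ltW.
  by rewrite /cN (mulrAC K) (powRM q Kt0 (powR_ge0 _ _)) -powRrM mulrBl mul1r.
case: (Y) Y0 main => [y| |//] y0; last first.
  have c0 : (0 < 2 * (K / tau) `^ q * C1 / q * N `^ (q - p))%R.
    by rewrite !mulr_gt0 ?invr_gt0 ?powR_gt0// divr_gt0.
  have -> : (2 * (K / tau) `^ q * C1 / q * N `^ (q - p))%:E * +oo = +oo :> \bar R.
    by rewrite gt0_muley// lte_fin.
  by move=> _; exact: leey.
rewrite -(fineK Ifin) -!EFinM -EFinD !lee_fin mulrA (mulrA _ C2) half => H.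
have : (fine I <= 2 * ((cN / tau) `^ q / q * (C1 * y)))%R by move: H; lra.
move/le_trans; apply; rewrite Hc le_eqVlt; apply/orP; left; apply/eqP.
by move: (_ `^ q)%R (N `^ _)%R (q^-1)%R => y1 y2 y3; ring.
Qed.

End near_bound.

(** * Essential infima over half-lines *)

Section essential_infimum_above.
Context {R : realType}.
Implicit Types (f : R -> R) (t : R) (y : \bar R).

Lemma ess_inf_above_ge f t y (N : set (measurableTypeR R)) : measurable N -> lebesgue_measure N = 0%E ->
  (forall tau, t < tau -> ~ N tau -> (y <= (f tau)%:E)%E) -> (y <= ess_inf_above t f)%E.
Proof.
move=> mN N0 H; apply/ess_infP; exists (N `|` `]-oo, t]%classic); split.
- by apply: measurableU => //; exact: measurable_itv.
- change (lebesgue_measure ((N `|` `]-oo, t]%classic) `&` `]t, +oo[%classic) = 0%E).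
  apply/eqP; rewrite eq_le measure_ge0 andbT -N0.
  apply: le_measure; rewrite ?inE//.
    by apply: measurableI; [apply: measurableU => //|]; exact: measurable_itv.
  move=> z [[//|]] /=; rewrite !in_itv/= andbT => zt.
  by rewrite ltNge zt.
- move=> tau /= H1; apply: contrapT => /not_orP[H2 H3]; apply: H1; apply: H => //.
  by move: H3; rewrite in_itv/= => /negP; rewrite -ltNge.
Qed.

Lemma ess_inf_above_le f t : exists N : set (measurableTypeR R),
  [/\ measurable N, lebesgue_measure N = 0%E &
   forall tau, t < tau -> ~ N tau -> (ess_inf_above t f <= (f tau)%:E)%E].
Proof.
have [N [mN N0 H]] := ess_inf_le (mrestr (@lebesgue_measure R) (measurable_itv `]t, +oo[)) (EFin \o f).
exists (N `&` `]t, +oo[%classic); split.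
- by apply: measurableI => //; exact: measurable_itv.
- exact: N0.
- move=> tau ttau nN; apply: contrapT => H1; apply: nN; split; first exact: H.
  by rewrite /= in_itv/= ttau.
Qed.

End essential_infimum_above.

(** * Consequences of the two conditions on phi *)

Section growth_condition.
Context {R : realType}.
Variables (g p C : R).
Hypotheses (g0 : 0 < g) (p0 : 0 < p) (C1 : 1 <= C).

Let C0 : 0 < C. Proof. by apply: lt_le_trans C1. Qed.

Definition growth_sup (phi : R -> R) := forall r, 0 < r ->
  (ereal_sup [set (t `^ (- g) * (1 + ln (t / r)) `^ p)%:E *
               ess_inf_above t (fun tau => phi tau * tau `^ g)%R | t in `]r, +oo[]
   <= (C * phi r)%:E)%E.

Lemma growth_supP (phi : R -> R) (r t : R) : growth_sup phi -> 0 < r -> r < t ->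
  ((t `^ (- g) * (1 + ln (t / r)) `^ p)%:E * ess_inf_above t (fun tau => phi tau * tau `^ g)%R
    <= (C * phi r)%:E)%E.
Proof.
move=> H r0 rt; apply: le_trans (H r r0); apply: ereal_sup_ubound; exists t => //=.
by rewrite in_itv/= rt.
Qed.

(* Iterating [phi_sup] once upgrades its logarithm to a power: the essential
   infimum gains a factor 2 per scale once the scale ratio is large. *)
Lemma ess_inf_above_decay : exists2 L0, 1 < L0 & forall L, L0 <= L ->
  forall phi : R -> R, (forall t, 0 < t -> 0 < phi t) -> growth_sup phi ->
  forall r, 0 < r ->
  (2%:E * ess_inf_above (L * r) (fun tau => phi tau * tau `^ g)%R <=
   (L `^ g)%:E * ess_inf_above r (fun tau => phi tau * tau `^ g)%R)%E.
Proof.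
pose C2 := 2 * C; have C20 : 0 < C2 by rewrite mulr_gt0.
have C21 : 1 <= C2 by rewrite /C2; move: C1; lra.
(* Chosen so that ln L >= l0 gives both (ln L / 2)^p >= 2C and L^(g/2) >= 2C. *)
pose l0 := Num.max (2 * (C2 `^ p^-1)) (2 / g * ln C2) + 1.
have lnC20 : 0 <= ln C2 by exact: ln_ge0.
have l00 : 0 < l0 by rewrite ltr_wpDl// le_max mulr_ge0 ?powR_ge0.
exists (expR l0); first by rewrite -expR0 ltr_expR.
move=> L L0L phi phi0 Hphi r r0.
have L0 : 0 < L by apply: lt_le_trans L0L; exact: expR_gt0.
have lL : l0 <= ln L by rewrite -[leLHS]expRK ler_ln ?posrE ?expR_gt0.
have l1 : 2 * (C2 `^ p^-1) <= ln L.
  by apply: le_trans lL; rewrite /l0 ler_wpDr// le_max lexx.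
have l2 : 2 / g * ln C2 <= ln L.
  by apply: le_trans lL; rewrite /l0 ler_wpDr// le_max lexx orbT.
have l3 : ln C2 <= g / 2 * ln L.
  by move: l2; rewrite -ler_pdivlMl ?divr_gt0// invf_div.
have h1 w : ln L / 2 <= w -> C2 <= (1 + w) `^ p.
  move=> Lw; rewrite -[leLHS](powRr1 (ltW C20)) -[X in _ `^ X <= _](@mulVf _ p) ?gt_eqF// powRrM.
  have Cp0 : 0 <= C2 `^ p^-1 by exact: powR_ge0.
  by apply: ge0_ler_powR; rewrite ?nnegrE//; [exact: ltW|move: l1 Lw; lra|move: l1 Lw; lra].
have h2 w : 0 < w -> ln L / 2 <= ln w -> C2 <= w `^ g.
  move=> w0 Lw; rewrite -(lnK C20) /powR gt_eqF// ler_expR; apply: le_trans l3 _.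
  by rewrite mulrAC -mulrA ler_pM2l// mulrC.
have Lg2 : 2 <= L `^ g.
  have : C2 <= L `^ g.
    by apply: h2 => //; rewrite ler_pdivrMr// ler_peMr ?ler1n// (le_trans _ lL)// ltW.
  by apply: le_trans; rewrite /C2 ler_peMr.
set f := (fun tau => phi tau * tau `^ g)%R.
have Lr0 : 0 < L * r by rewrite mulr_gt0.
set y := ess_inf_above (L * r) f.
have y0 : (0 <= y)%E.
  apply: (@ess_inf_above_ge _ _ _ _ set0) => // tau Lrt _.
  rewrite lee_fin mulr_ge0 ?powR_ge0// ltW// phi0//.
  by apply: lt_trans Lrt.
have yfin : y \is a fin_num.
  rewrite ge0_fin_numE// ltey; apply/eqP => yoo.
  have := growth_supP Hphi r0 (_ : r < L * r).
  have rL : r < L * r by rewrite ltr_pMl// -expR0 (lt_le_trans _ L0L)// ltr_expR.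
  rewrite -/f -/y yoo gt0_muley; first by rewrite leye_eq => /(_ rL).
  rewrite lte_fin mulr_gt0 ?powR_gt0// ltr_wpDr// ln_ge0// ler_pdivlMr// mul1r ltW//.
have [N [mN N0 HN]] := ess_inf_above_le f (L * r).
have Lgi0 : 0 < L `^ g by rewrite powR_gt0.
rewrite -lee_pdivrMl// muleA -EFinM.
(* The point L r is added to the null set so that the cases tau < L r and tau > L r suffice. *)
apply: (@ess_inf_above_ge _ _ _ _ (N `|` [set L * r])).
- by apply: measurableU => //; exact: (@measurable_set1 R).
- have mL : measurable [set L * r] by exact: measurable_set1.
  rewrite (measureU0 mN mL) //.
  exact: lebesgue_measure_set1.
move=> tau rtau /not_orP[nN nLr].
have tau0 : 0 < tau by apply: lt_trans rtau.
(* For r < tau < L r put a = L r / tau and c = tau / r, so a c = L. Either ln a >= ln L / 2, and the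
   logarithm in the condition between tau and L r gains the factor 2C; or ln c >= ln L / 2, and c^g
   does. *)
have [tL|tL|tL] := ltgtP tau (L * r); last by [].
  have := growth_supP Hphi tau0 tL; rewrite -/f -/y.
  have [Y yY] : exists Y, y = Y%:E by exists (fine y); rewrite fineK.
  rewrite yY !lee_fin in y0 *.
  have [a aE] : exists a, a = L * r / tau by exists (L * r / tau).
  have [c cE] : exists c, c = tau / r by exists (tau / r).
  have a1 : 1 < a by rewrite aE ltr_pdivlMr// mul1r.
  have a0 : 0 < a by apply: lt_trans a1.
  have c0 : 0 < c by rewrite cE divr_gt0.
  have acL : a * c = L by rewrite aE cE mulrA divfK ?gt_eqF// mulfK ?gt_eqF.
  have lnac : ln a + ln c = ln L by rewrite -acL lnM ?posrE.
  have lna : 0 < ln a by rewrite ln_gt0.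
  have Lra : L * r = a * tau by rewrite aE divfK// gt_eqF.
  rewrite -aE Lra.
  have ag0 : 0 < a `^ g by rewrite powR_gt0.
  have tg0 : 0 < tau `^ g by rewrite powR_gt0.
  have cg0 : 0 < c `^ g by rewrite powR_gt0.
  have LgE : L `^ g = a `^ g * c `^ g by rewrite -acL powRM// ltW.
  rewrite powRN (powRM g (ltW a0) (ltW tau0)) => H.
  have {}H : (1 + ln a) `^ p * Y <= C * f tau * a `^ g.
    move: H; rewrite -(mulrA _^-1) ler_pdivrMl ?mulr_gt0// /f.
    by move=> /le_trans; apply; rewrite le_eqVlt; apply/orP; left; apply/eqP; ring.
  have f0 : 0 < f tau by rewrite /f mulr_gt0// phi0.
  rewrite -mulrA ler_pdivrMl// LgE.
  have [h|h] := lerP (ln L / 2) (ln a).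
    have H1 : C2 * Y <= C * f tau * a `^ g by apply: le_trans H; rewrite ler_wpM2r// h1.
    have cg1 : 1 <= c `^ g.
      by rewrite -(powRr0 c); apply: ler_powR; rewrite ?ltW// cE ltr_pdivlMr// mul1r.
    rewrite -(ler_pM2l C0); move: H1; rewrite /C2.
    have := ler_wpM2l (ltW (mulr_gt0 C0 (mulr_gt0 f0 ag0))) cg1.
    by move: (a `^ g) (c `^ g) (f tau) => A D F; lra.
  have H1 : Y <= C * f tau * a `^ g.
    apply: le_trans H; rewrite ler_peMl// -[leLHS](powRr0 (1 + ln a)); apply: ler_powR; last exact: ltW.
    by rewrite lerDl ltW.
  have cg1 : C2 <= c `^ g by apply: h2 => //; move: lnac h; lra.
  have := ler_wpM2l (ltW (mulr_gt0 f0 ag0)) cg1; rewrite /C2.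
  by move: H1; move: (a `^ g) (c `^ g) (f tau) => A D F; nra.
have Lgy : 2 * fine y <= L `^ g * fine y.
  by rewrite ler_wpM2r ?fine_ge0.
have := HN tau tL nN; rewrite -/f -/y -(fineK yfin) -EFinM !lee_fin => H.
rewrite -mulrA ler_pdivrMl//; apply: le_trans Lgy _.
by rewrite ler_pM2l.
Qed.

(** The growth condition itself starts the induction; each further scale brings a factor 1/2 from
    [ess_inf_above_decay]. *)
Lemma ess_inf_above_geometric : exists2 L0, 1 < L0 & forall L, L0 <= L ->
  forall phi : R -> R, (forall t, 0 < t -> 0 < phi t) -> growth_sup phi ->
  forall r j, 0 < r ->
  (ess_inf_above (L ^+ j.+1 * r) (fun tau => phi tau * tau `^ g)%R <=
   (C * 2^-1 ^+ j * (L ^+ j.+1 * r) `^ g * phi r)%:E)%E.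
Proof.
have [L0 L01 H] := ess_inf_above_decay; exists L0 => // L LL0 phi phi0 Hphi r j r0.
have L1 : 1 < L by apply: lt_le_trans LL0.
have Lp : 0 < L by apply: lt_trans L1.
elim: j => [|j IH].
  rewrite expr1 expr0 mulr1.
  have Lr0 : 0 < L * r by rewrite mulr_gt0.
  set y := ess_inf_above _ _.
  have y0 : (0 <= y)%E.
    apply: (@ess_inf_above_ge _ _ _ _ set0) => // tau Lrt _.
    by rewrite lee_fin mulr_ge0 ?powR_ge0// ltW// phi0// (lt_trans Lr0).
  have := growth_supP Hphi r0 (_ : r < L * r); rewrite -/y mulfK ?gt_eqF//.
  rewrite ltr_pMl// => /(_ L1).
  have Lg0 : 0 < (L * r) `^ g by rewrite powR_gt0.
  rewrite powRN => H1.
  have H2 : ((((L * r) `^ g)^-1)%:E * y <= (C * phi r)%:E)%E.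
    apply: le_trans H1; rewrite lee_pmul// lee_fin ?invr_ge0 ?powR_ge0//.
    rewrite ler_pMr ?invr_gt0// -[leLHS](powRr0 (1 + ln L)); apply: ler_powR; last exact: ltW.
    by rewrite lerDl ln_ge0// ltW.
  rewrite lee_pdivrMl// in H2; apply: le_trans H2 _.
  by rewrite -EFinM lee_fin mulrCA mulrA.
have Lr0 : 0 < L ^+ j.+1 * r by rewrite mulr_gt0// exprn_gt0.
have := H L LL0 phi phi0 Hphi _ Lr0; rewrite mulrA -exprS => H1.
have {}H1 := le_trans H1 (lee_wpmul2l (_ : 0 <= (L `^ g)%:E)%E IH).
rewrite lee_fin powR_ge0 in H1.
have {}H1 := H1 isT.
rewrite -lee_pdivlMl// -EFinM in H1; apply: le_trans H1 _.
rewrite lee_fin [X in _ <= _ * X `^ g * _](_ : _ = L * (L ^+ j.+1 * r)); last by rewrite mulrA -exprS.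
rewrite (powRM g (ltW Lp) (ltW Lr0)) (exprS 2^-1).
by move: (_ ^+ j) (L `^ g) ((_ * r) `^ g) (phi r) => a1 a2 a3 a4; rewrite le_eqVlt; apply/orP; left; apply/eqP; ring.
Qed.

(** How the essential infimum enters: an increasing quantity bounded by A phi(u) u^g at every later
    u is bounded by the infimum. It is applied to the integral of f^p over growing balls. *)
Lemma ess_inf_above_dominates (phi I : R -> R) (A t : R) : 0 < A -> 0 < t ->
  (forall u, t < u -> I t <= I u) ->
  (forall u, 0 < u -> I u <= A * phi u * u `^ g) ->
  ((I t)%:E <= A%:E * ess_inf_above t (fun tau => phi tau * tau `^ g)%R)%E.
Proof.
move=> A0 t0 Imono HI; rewrite -lee_pdivrMl// -EFinM.
apply: (@ess_inf_above_ge _ _ _ _ set0) => // tau ttau _.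
rewrite lee_fin ler_pdivrMl// mulrA (le_trans (Imono _ ttau))// HI//.
exact: lt_trans ttau.
Qed.

(** Only the range (r,2r) of the integral is used. There I(r) <= I(t) <= A phi(t) t^g bounds
    phi(t)^(1/p) below by the constant [W], so the integral bounds [W], hence I(r), from above. *)
Lemma growth_int_bound (phi I : R -> R) (A al be r : R) : 0 < A -> 0 < r -> 0 <= al ->
  (forall t, 0 < t -> 0 < phi t) ->
  (forall u, r < u -> I r <= I u) -> 0 <= I r ->
  (forall u, 0 < u -> I u <= A * phi u * u `^ g) ->
  (\int[lebesgue_measure]_(t in `]r, +oo[)
    ((1 + ln (t / r)) * t `^ al * phi t `^ p^-1 / t)%:E <= (C * r `^ (- be))%:E)%E ->
  I r <= A * (2 `^ g * (2 * C) `^ p) * r `^ (g - p * (al + be)).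
Proof.
move=> A0 r0 al0 phi0 Imono I0 HI Hint.
have rr0 : 0 < 2 * r by rewrite mulr_gt0.
pose W := (I r / (A * (2 * r) `^ g)) `^ p^-1.
have W0 : 0 <= W by exact: powR_ge0.
have HW t : r < t -> t < 2 * r -> r `^ al * W / (2 * r) <= (1 + ln (t / r)) * t `^ al * phi t `^ p^-1 / t.
  move=> rt t2; have t0 : 0 < t by apply: lt_trans rt.
  have h1 : W <= phi t `^ p^-1.
    apply: ge0_ler_powR; rewrite ?nnegrE ?invr_ge0 ?(ltW p0)//.
    - by rewrite mulr_ge0// invr_ge0 mulr_ge0 ?powR_ge0// ltW.
    - exact/ltW/phi0.
    - rewrite ler_pdivrMr ?mulr_gt0 ?powR_gt0//.
      apply: (le_trans (Imono _ rt)); apply: (le_trans (HI _ t0)).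
      rewrite mulrCA mulrA ler_pM2l ?mulr_gt0 ?phi0//.
      by apply: ge0_ler_powR; rewrite ?nnegrE ?(ltW g0) ?(ltW t0) ?(ltW rr0) ?(ltW t2).
  have h2 : r `^ al <= t `^ al by apply: ge0_ler_powR; rewrite ?nnegrE ?(ltW t0) ?(ltW r0) ?(ltW rt).
  have h3 : (2 * r)^-1 <= t^-1 by rewrite lef_pV2 ?posrE// ltW.
  have h4 : 1 <= 1 + ln (t / r) by rewrite lerDl ln_ge0// ler_pdivlMr// mul1r ltW.
  apply: ler_pM; rewrite ?mulr_ge0 ?powR_ge0 ?invr_ge0 ?(ltW rr0)//.
  apply: ler_pM; rewrite ?mulr_ge0 ?powR_ge0//.
  by rewrite -[leLHS]mul1r; apply: ler_pM; rewrite ?powR_ge0.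
have H1 : (\int[@lebesgue_measure R]_(t in `]r, (2 * r)%R[) (r `^ al * W / (2 * r))%:E
    <= (C * r `^ (- be))%:E)%E.
  apply: le_trans Hint; apply: (@le_trans _ _ (\int[@lebesgue_measure R]_(t in `]r, (2 * r)%R[)
    ((1 + ln (t / r)) * t `^ al * phi t `^ p^-1 / t)%:E)%E).
    apply: le_integral_ge0 => t /=; rewrite in_itv/= => /andP[rt t2]; rewrite lee_fin; last exact: HW.
    by rewrite mulr_ge0 ?mulr_ge0 ?powR_ge0// invr_ge0 ltW.
  apply: le_integral_subset.
    by move=> t /=; rewrite !in_itv/= andbT => /andP[].
  move=> t; rewrite /= in_itv/= andbT => rt; rewrite lee_fin.
  have t0 : 0 < t by apply: lt_trans rt.
  rewrite !mulr_ge0 ?powR_ge0// ?invr_ge0 ?(ltW t0)//.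
  by rewrite addr_ge0// ln_ge0// ler_pdivlMr// mul1r ltW.
have {}H1 : r `^ al * W <= 2 * C * r `^ (- be).
  move: H1; rewrite integral_cst//= lebesgue_measure_itv/= lte_fin ltr_pMl// ltr1n.
  rewrite -EFinD -EFinM lee_fin => H1.
  have -> : r `^ al * W = 2 * (r `^ al * W / (2 * r) * (2 * r - r)).
    by move: (_ `^ al) (W) => a1 a2; field; rewrite gt_eqF.
  by rewrite -[leRHS]mulrA; apply: ler_wpM2l.
have {}H1 : W <= 2 * C * r `^ (- (al + be)).
  have -> : r `^ (- (al + be)) = r `^ (- be) / r `^ al.
    rewrite (_ : - (al + be) = - be + - al); last by ring.
    by rewrite powRD ?(gt_eqF r0) ?implybT// (powRN r al).
  rewrite mulrA.
  by rewrite ler_pdivlMr ?powR_gt0// mulrC.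
have H2 : I r / (A * (2 * r) `^ g) <= (2 * C) `^ p * r `^ (- (p * (al + be))).
  have -> : I r / (A * (2 * r) `^ g) = W `^ p.
    by rewrite /W -powRrM mulVf ?gt_eqF// powRr1// mulr_ge0// invr_ge0 mulr_ge0 ?powR_ge0// ltW.
  have -> : r `^ (- (p * (al + be))) = (r `^ (- (al + be))) `^ p by rewrite -powRrM mulNr mulrC.
  rewrite -powRM ?mulr_ge0 ?powR_ge0 ?(ltW C0)//.
  by apply: ge0_ler_powR; rewrite ?nnegrE ?(ltW p0)// !mulr_ge0 ?powR_ge0 ?(ltW C0).
move: H2; rewrite ler_pdivrMr ?mulr_gt0 ?powR_gt0// (powRM g _ (ltW r0))//.
move=> /le_trans; apply; rewrite powRD ?(gt_eqF r0) ?implybT// .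
move: (2 `^ g) ((2 * C) `^ p) (r `^ g) (r `^ _) => a1 a2 a3 a4.
by rewrite le_eqVlt; apply/orP; left; apply/eqP; ring.
Qed.

End growth_condition.

(** * The far part of the potential *)

Section far_estimate.
Local Open Scope ereal_scope.

(** Split the exponent 1/p as 1/q + (1/p - 1/q) and use one bound on [J] for each piece. *)
Lemma powR_interpolation {R : realType} (J A Y Z p q : R) : (0 < p)%R -> (p < q)%R ->
  (0 <= J)%R -> (0 <= A)%R -> (0 <= Y)%R -> (0 <= Z)%R -> (J <= A * Y)%R -> (J <= A * Z)%R ->
  (J `^ p^-1 <= A `^ p^-1 * (Y `^ q^-1 * Z `^ (p^-1 - q^-1)))%R.
Proof.
move=> p0 pq J0 A0 Y0 Z0 JY JZ; have q0 : (0 < q)%R by apply: lt_trans pq.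
have pi0 : (0 < p^-1)%R by rewrite invr_gt0.
have qi0 : (0 < q^-1)%R by rewrite invr_gt0.
have e0 : (0 <= p^-1 - q^-1)%R by rewrite subr_ge0 lef_pV2 ?posrE// ltW.
have pE : (p^-1 = q^-1 + (p^-1 - q^-1))%R by rewrite addrC subrK.
have S (z : R) : (z `^ p^-1 = z `^ q^-1 * z `^ (p^-1 - q^-1))%R.
  by rewrite {1}pE powRD// -pE gt_eqF.
rewrite !S mulrACA -!powRM//.
by apply: ler_pM; rewrite ?powR_ge0//; apply: ge0_ler_powR;
  rewrite ?nnegrE ?mulr_ge0// ltW.
Qed.

Context disp (X : measurableType disp) (R : realType)
  (mu : {sigma_finite_measure set X -> \bar R}) (d : X -> X -> R) (k g v : R)
  (c : nat -> X).
Hypothesis HS : homogeneous_space mu d k g v c.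
Variable L : R.
Hypothesis kL : (4 * k ^+ 2 <= L)%R.
Variables (b : X -> R) (beta : X -> R -> R) (D : R).
Hypothesis mb : measurable_fun setT b.
Hypothesis D0 : (0 < D)%R.
Hypothesis bD : forall x r, (0 < r)%R ->
  \int[mu]_(y in qball d x r) `|b y - beta x r|%:E <= D%:E * mu (qball d x r).
Let L1 : (1 < L)%R. Proof. exact: (L_gt1 HS kL). Qed.
Let L0 : (0 < L)%R. Proof. exact: lt_trans L1. Qed.
Let v0 := hs_v HS.
Let k1 := hs_k HS.

(** Telescoping over the scales: consecutive constants are compared on the smaller ball. This is the
    logarithmic growth of the means of a BMO function. *)
Lemma constants_drift x r m : (0 < r)%R ->
  (`|beta x (L ^+ m * r) - beta x r| <= m%:R * (D * (L `^ g + 1)))%R.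
Proof.
move=> r0; elim: m => [|m IH]; first by rewrite expr0 mul1r subrr normr0 mul0r.
have t0 : (0 < L ^+ m * r)%R by rewrite mulr_gt0// exprn_gt0.
set t := (L ^+ m * r)%R in IH t0 *.
have -> : (L ^+ m.+1 * r = L * t)%R by rewrite /t mulrA -exprS.
rewrite -(subrKA (beta x t)) (le_trans (ler_normD _ _))//.
rewrite -addn1 natrD mulrDl mul1r addrC; apply: lerD => //.
have Lt0 : (0 < L * t)%R by rewrite mulr_gt0.
have := @close_constants _ _ _ mu b mb (qball d x t) (beta x (L * t)) (beta x t)
  (measurable_qball HS _ _).
have m0 : (0 < v * t `^ g)%R by rewrite mulr_gt0// powR_gt0.
have H1 : \int[mu]_(y in qball d x t) `|b y - beta x (L * t)|%:E <=
    (D * L `^ g * (v * t `^ g))%:E.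
  apply: le_trans (le_trans (bD x Lt0) _).
    apply: le_integral_subset => // y; rewrite /qball /= => /lt_le_trans; apply.
    by rewrite ler_peMl// ltW.
  by rewrite (mu_qball_scale HS x x t0 L0) (hs_volume HS)// -!EFinM mulrA.
have H2 := bD x t0; rewrite (hs_volume HS)// -EFinM in H2.
rewrite (hs_volume HS)// -EFinM => /le_trans/(_ (leeD H1 H2)).
rewrite -EFinD lee_fin => H; rewrite -(ler_pM2r m0); apply: le_trans H _.
by rewrite le_eqVlt; apply/orP; left; apply/eqP; ring.
Qed.

Variables (p p' B : R).
Hypotheses (p0 : (0 < p)%R) (p'0 : (0 < p')%R) (pp' : (p'^-1 + p^-1 = 1)%R).
Hypothesis B0 : (0 < B)%R.
Hypothesis bB : forall x r, (0 < r)%R ->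
  \int[mu]_(y in qball d x r) (`|b y - beta x r| `^ p') %:E <= B%:E * mu (qball d x r).

(** Pass from b x to b y through [a] and the constant of the ball. The constant terms use Hölder
    against 1; the remaining one uses Hölder with the exponent p' of [bB]. *)
Lemma oscillation_le_Lnorm (f : X -> R) (a : R) (x z : X) (t : R) : measurable_fun setT f ->
  (forall y, (0 <= f y)%R) -> (0 < t)%R ->
  oscillation mu b f (qball d z t) x <=
  ((`|b x - a| + `|beta z t - a| + B `^ p'^-1) * (v * t `^ g) `^ p'^-1)%:E *
    (\int[mu]_(y in qball d z t) (f y `^ p)%:E) `^ p^-1.
Proof.
move=> mf f0 t0; have mE := measurable_qball HS z t.
set J := _ `^ p^-1.
have J0 : 0 <= J by exact: poweR_ge0.
have mbt := measurable_dist_cst mb (beta z t).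
have m0 : (0 <= v * t `^ g)%R by rewrite mulr_ge0 ?powR_ge0// ltW.
have [A AE] : exists A, (A = `|b x - a| + `|beta z t - a|)%R by eexists.
have A0 : (0 <= A)%R by rewrite AE addr_ge0.
rewrite -AE.
apply: (@le_trans _ _ (\int[mu]_(y in qball d z t) (A%:E * (f y)%:E + (`|b y - beta z t| * f y)%:E))).
  apply: le_integral_ge0 => y _; first by rewrite lee_fin mulr_ge0.
  rewrite -EFinM -EFinD lee_fin -mulrDl ler_wpM2r// AE.
  rewrite (_ : b x - b y = (b x - a) - (beta z t - a) - (b y - beta z t))%R; last by ring.
  by rewrite (le_trans (ler_normB _ _))// lerD2r ler_normB.
rewrite ge0_integralD//; last 4 first.
- by move=> y _; rewrite -EFinM lee_fin mulr_ge0.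
- by apply: emeasurable_funM => //; apply/measurable_EFinP; exact: measurable_funTS.
- by move=> y _; rewrite lee_fin mulr_ge0.
- by apply/measurable_EFinP; apply: measurable_funTS; exact: measurable_funM.
rewrite ge0_integralZl_EFin//; last 2 first.
- by move=> y _; rewrite lee_fin.
- by apply/measurable_EFinP; exact: measurable_funTS.
rewrite (mulrDl A) EFinD ge0_muleDl ?lee_fin ?mulr_ge0 ?powR_ge0//.
apply: leeD.
  rewrite EFinM -muleA; apply: lee_wpmul2l; first by rewrite lee_fin.
  have := hoelder_set1 mu p'0 p0 pp' mE mf f0.
  by rewrite -poweR_EFin -(hs_volume HS z t0).
have := hoelder_set mu p'0 p0 pp' mE mbt mf (fun=> normr_ge0 _) f0.
move=> /le_trans; apply; apply: lee_wpmul2r => //.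
rewrite -powRM ?(ltW B0)// -poweR_EFin; apply: le_poweR; rewrite ?invr_ge0 ?(ltW p'0)//.
  by apply: integral_ge0 => y _; rewrite lee_fin powR_ge0.
by apply: le_trans (bB z t0) _; rewrite (hs_volume HS)// -EFinM.
Qed.

Variables (al be q : R).
Hypotheses (alg : (al < g)%R) (pq : (p < q)%R).
Hypothesis bE : (be * (q - p) = al * p)%R.

Lemma geometric_level (r t : R) : (0 < r)%R -> (r <= t)%R ->
  exists j, (L ^+ j * r <= t)%R /\ (t < L ^+ j.+1 * r)%R.
Proof.
move=> r0 rt; have t0 : (0 < t)%R by apply: lt_le_trans rt.
have H : exists j, (t < L ^+ j * r)%R.
  have rt2 : (r < 2 * t)%R by move: rt t0; lra.
  have [i [Hi _]] := Ladic_level HS kL r0 rt2.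
  exists i.+1; move: Hi; rewrite exprVn ler_pdivrMr ?exprn_gt0// (mulrC r).
  by apply: lt_le_trans; rewrite ltr_pMl// ltr1n.
case: (ex_minnP H) => -[|j] Hj Hm; first by move: Hj; rewrite expr0 mul1r ltNge rt.
exists j; split => //; rewrite leNgt; apply/negP => /Hm.
by rewrite ltnn.
Qed.

(** If y is at distance at least L^(j+1) r from [x0] while [x] is within r, then y is at distance at
    least L^j r from [x], because 2k <= L. Hence the offset of two between the weight and the radius
    of the ball. *)
Lemma potential_far_le (f : X -> R) (x x0 : X) (r : R) : measurable_fun setT f ->
  (forall y, (0 <= f y)%R) -> (0 < r)%R -> qball d x0 r x ->
  potential mu d g b al f (~` qball d x0 (L * r)) x <= \sum_(j <oo)
   (((L ^+ j * r) `^ (al - g))%:E * oscillation mu b f (qball d x0 (L ^+ j.+2 * r)) x).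
Proof.
move=> mf f0 r0 x0x; pose rd j := (L ^+ j * r)%R.
have rd0 j : (0 < rd j)%R by rewrite mulr_gt0// exprn_gt0.
have mq t := measurable_qball HS x0 t.
have mt := measurable_oscillation_term mb mf x.
pose F j y : \bar R := (rd j `^ (al - g))%:E *
  ((`|b x - b y| * f y) * \1_(qball d x0 (rd j.+2)) y)%:E.
have F0 j y : 0 <= F j y by rewrite /F mule_ge0 ?lee_fin ?powR_ge0// !mulr_ge0.
have mt1 j : measurable_fun setT (fun y => ((`|b x - b y| * f y) * \1_(qball d x0 (rd j.+2)) y)%:E).
  by apply/measurable_EFinP; apply: measurable_funM => //; exact: measurable_indic.
have mF j : measurable_fun setT (F j) by apply: emeasurable_funM.
apply: (@le_trans _ _ (\int[mu]_y (\sum_(j <oo) F j y))); last first.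
  rewrite integral_nneseries//; apply: lee_nneseries => j _.
    by move=> _; apply: integral_ge0.
  by rewrite ge0_integralZl_EFin ?powR_ge0// ?oscillation_indic// => y _; rewrite lee_fin !mulr_ge0.
rewrite /potential integral_mkcond; apply: le_integral_ge0 => y _.
  by rewrite patchE; case: ifP => // _; rewrite lee_fin !mulr_ge0 ?powR_ge0.
rewrite patchE; case: ifPn => [|_]; last exact: nneseries_ge0.
rewrite inE /setC /qball /= => /negP; rewrite -leNgt => x0y.
have Lr0 : (0 < L * r)%R by rewrite mulr_gt0.
have [j [j1 j2]] := geometric_level Lr0 x0y.
apply: (@le_trans _ _ (F j y)); last first.
  apply: le_trans (@nneseries_lim_ge _ (F^~ y) xpredT 0 j.+1 _); last by [].
  by rewrite big_nat_recr//= leeDr//; apply: sume_ge0.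
rewrite mulrA -exprSr -/(rd _) in j1; rewrite mulrA -exprSr -/(rd _) in j2.
rewrite /F indicE mem_set//.
rewrite mulr1 -EFinM lee_fin mulrC; apply: ler_wpM2r; first by rewrite mulr_ge0.
have -> : (al - g = - (g - al))%R by rewrite opprB.
apply: powR_anti; [by rewrite subr_ge0 ltW|exact: rd0|].
rewrite leNgt; apply/negP => xy.
have := qtriangle HS (x0x : (d x0 x < r)%R) xy; rewrite ltNge => /negP; apply.
apply: le_trans j1; rewrite /rd exprS -mulrA -/(rd j).
have rj : (r <= rd j)%R by rewrite /rd ler_peMl ?(ltW r0)// exprn_ege1// ltW.
have k0 : (0 < k)%R by apply: lt_le_trans k1.
apply: (@le_trans _ _ (k * (2 * rd j)))%R; first by rewrite ler_pM2l//; move: rj; lra.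
rewrite mulrA ler_pM2r//; apply: le_trans kL; move: k1; nra.
Qed.

(** All powers of t cancel. The relation [bE] is equivalent to p(al + be) = q be, which makes p(al +
    be)(1/p - 1/q) equal to al. *)
Lemma far_constant (t W N Y : R) : (0 < t)%R -> (0 < N)%R ->
  ((t / L ^+ 2) `^ (al - g) * (W * (v * t `^ g) `^ p'^-1) *
   ((N `^ p * t `^ g) `^ p^-1 * (Y `^ q^-1 * (t `^ (- (p * (al + be)))) `^ (p^-1 - q^-1))) =
  W * ((L ^+ 2) `^ (g - al) * v `^ p'^-1) * N * Y `^ q^-1)%R.
Proof.
move=> t0 N0; have q0 : (0 < q)%R by apply: lt_trans pq.
have tn e : (e == 0)%R ==> (t != 0%R) by rewrite (gt_eqF t0) implybT.
have L20 : (0 < L ^+ 2)%R by rewrite exprn_gt0.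
have -> : ((t / L ^+ 2) `^ (al - g) = t `^ (al - g) * (L ^+ 2) `^ (g - al))%R.
  rewrite powRM ?invr_ge0 ?(ltW t0) ?(ltW L20)//; congr (_ * _)%R.
  by rewrite -powR_inv1 ?(ltW L20)// -powRrM mulN1r opprB.
rewrite (powRM _ (ltW v0) (powR_ge0 _ _)) (powRM _ (powR_ge0 _ _) (powR_ge0 _ _)).
rewrite -!powRrM mulfV ?gt_eqF// powRr1 ?(ltW N0)//.
have -> : (- (p * (al + be)) * (p^-1 - q^-1) = - al)%R.
  have h : (p * be = q * be - al * p)%R by rewrite -bE; ring.
  have -> : (p * (al + be) = q * be)%R by rewrite mulrDr h; ring.
  have -> : (be = al * p / (q - p))%R.
    by rewrite -bE mulfK// gt_eqF// subr_gt0.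
  by field; rewrite !gt_eqF ?subr_gt0.
have E : (t `^ (al - g) * t `^ (g * p'^-1) * (t `^ (g * p^-1) * t `^ (- al)) = 1)%R.
  rewrite -!powRD ?tn//.
  rewrite (_ : al - g + g * p'^-1 + (g * p^-1 - al) = g * (p'^-1 + p^-1) - g)%R; last by ring.
  by rewrite pp' mulr1 subrr powRr0.
move: E.
move: (t `^ (al - g))%R (t `^ (g * p'^-1))%R (t `^ (g * p^-1))%R (t `^ (- al))%R => y1 y2 y3 y4 E.
move: (v `^ _)%R (Y `^ _)%R (_ `^ (g - al))%R => z1 z2 z3.
transitivity (W * (z3 * z1) * N * z2 * (y1 * y2 * (y3 * y4)))%R; first by ring.
by rewrite E mulr1.
Qed.

(** Interpolating the geometric decay with the power bound leaves 2^(-j/q) on shell j, which beats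
    the linear drift of the constants of [b]. *)
Lemma far_pointwise : exists2 K : R, (0 < K)%R & forall (f : X -> R) (x0 x : X) (r N Phi : R),
  measurable_fun setT f -> (forall y, (0 <= f y)%R) -> (0 < r)%R -> (0 < N)%R -> (0 < Phi)%R ->
  qball d x0 r x ->
  (forall j, \int[mu]_(y in qball d x0 (L ^+ j.+1 * r)) (f y `^ p)%:E <=
     (N `^ p * (L ^+ j.+1 * r) `^ g * (2^-1 ^+ j * Phi))%:E) ->
  (forall t, (0 < t)%R -> \int[mu]_(y in qball d x0 t) (f y `^ p)%:E <=
     (N `^ p * t `^ g * t `^ (- (p * (al + be))))%:E) ->
  potential mu d g b al f (~` qball d x0 (L * r)) x <=
    (K * N * Phi `^ q^-1 * (`|b x - beta x0 r| + 1))%:E.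
Proof.
have q0 : (0 < q)%R by apply: lt_trans pq.
have qi0 : (0 < q^-1)%R by rewrite invr_gt0.
pose z : R := (2^-1 `^ q^-1)%R.
have z01 : (0 < z < 1)%R.
  rewrite powR_gt0 ?invr_gt0//=.
  have -> : 1%R = (1 `^ q^-1 : R)%R by rewrite powR1.
  by apply: gt0_ltr_powR => //; rewrite ?nnegrE ?invr_ge0// invf_lt1// ltr1n.
have [S S0 HS'] := sum_powR_geometric_le ltr01 z01.
pose C1 := (D * (L `^ g + 1))%R; pose B1 := (B `^ p'^-1)%R.
pose C2 := ((L ^+ 2) `^ (g - al) * v `^ p'^-1)%R.
pose C3 := (1 + 2 * C1 + B1)%R.
have Lg0 : (0 <= L `^ g)%R by exact: powR_ge0.
have C10 : (0 <= C1)%R by rewrite mulr_ge0 ?(ltW D0)// addr_ge0.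
have B10 : (0 <= B1)%R by exact: powR_ge0.
have C20 : (0 < C2)%R by rewrite mulr_gt0// powR_gt0// exprn_gt0.
have C30 : (0 < C3)%R by rewrite /C3; move: C10 B10; lra.
exists (C2 * C3 * S)%R; first by apply: mulr_gt0 => //; exact: mulr_gt0.
move=> f x0 x r N Phi mf f0 r0 N0 Phi0 x0x H1 H2.
apply: le_trans (potential_far_le mf f0 r0 x0x) _.
set w := (`|b x - beta x0 r|)%R; have w0 : (0 <= w)%R by exact: normr_ge0.
have Pq0 : (0 <= Phi `^ q^-1)%R by exact: powR_ge0.
have term j : ((L ^+ j * r) `^ (al - g))%:E * oscillation mu b f (qball d x0 (L ^+ j.+2 * r)) x
    <= (C2 * C3 * N * Phi `^ q^-1 * (w + 1) * (j.+1%:R * z ^+ j))%:E.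
  have t0 : (0 < L ^+ j.+2 * r)%R by rewrite mulr_gt0// exprn_gt0.
  set t := (L ^+ j.+2 * r)%R in t0 *.
  have tE : (L ^+ j * r = t / L ^+ 2)%R.
    by rewrite /t -addn2 exprD mulrAC mulfK// gt_eqF// exprn_gt0.
  set W := (w + `|beta x0 t - beta x0 r| + B1)%R.
  have W0 : (0 <= W)%R by rewrite !addr_ge0.
  have HW : (W <= C3 * (w + 1) * j.+1%:R)%R.
    have := constants_drift x0 j.+2 r0; rewrite -/t -/C1 => h.
    have j2 : (j.+2%:R <= 2 * j.+1%:R :> R)%R by rewrite -natrM ler_nat mul2n -addnn addSn ltnS ltn_addl.
    have j1 : (1 <= j.+1%:R :> R)%R by rewrite ler1n.
    have h1 : (W <= w + 2 * j.+1%:R * C1 + B1)%R.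
      rewrite lerD2r lerD2l (le_trans h)// ler_wpM2r//.
    apply: (le_trans h1); rewrite /C3; move: (j.+1%:R : R)%R j1 => n n1.
    have a1 : (w <= w * n)%R by rewrite ler_peMr.
    have a2 : (B1 <= B1 * n)%R by rewrite ler_peMr.
    have a5 : (0 <= n)%R by rewrite (le_trans ler01).
    have a3 : (0 <= C1 * w * n)%R by apply: mulr_ge0 => //; exact: mulr_ge0.
    have a4 : (0 <= B1 * w * n)%R by apply: mulr_ge0 => //; exact: mulr_ge0.
    move: (C1) (B1) a1 a2 a3 a4 => c1 b1; lra.
  have := oscillation_le_Lnorm (beta x0 r) x x0 mf f0 t0; rewrite -/w -/B1 -/W.
  set J := \int[mu]_(y in qball d x0 t) _.
  have J0 : 0 <= J by apply: integral_ge0 => y _; rewrite lee_fin powR_ge0.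
  have J1 : J <= (N `^ p * t `^ g * (2^-1 ^+ j.+1 * Phi))%:E by exact: (H1 j.+1).
  have J2 := H2 _ t0; rewrite -/J in J2.
  have [Jr JE] : exists Jr, J = Jr%:E.
    by exists (fine J); rewrite fineK// ge0_fin_numE// (le_lt_trans J2)// ltry.
  move: J0 J1 J2; rewrite JE !lee_fin => J0 J1 J2; rewrite poweR_EFin -EFinM => Hosc.
  have co0 : (0 <= (L ^+ j * r) `^ (al - g))%R by exact: powR_ge0.
  apply: le_trans (lee_wpmul2l _ Hosc) _; first by rewrite lee_fin.
  rewrite -EFinM lee_fin.
  have y0 : (0 <= 2^-1 ^+ j.+1 * Phi)%R by rewrite mulr_ge0 ?(ltW Phi0)// exprn_ge0// invr_ge0.
  have A0 : (0 <= N `^ p * t `^ g)%R by rewrite mulr_ge0 ?powR_ge0.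
  have HJ := powR_interpolation p0 pq J0 A0 y0 (powR_ge0 _ _) J1 J2.
  have W1 : (0 <= W * (v * t `^ g) `^ p'^-1)%R by rewrite mulr_ge0 ?powR_ge0.
  apply: le_trans (ler_wpM2l co0 (ler_wpM2l W1 HJ)) _.
  rewrite mulrA tE far_constant// -/C2.
  have -> : ((2^-1 ^+ j.+1 * Phi) `^ q^-1 = z ^+ j.+1 * Phi `^ q^-1)%R.
    rewrite powRM ?exprn_ge0 ?invr_ge0 ?(ltW Phi0)//; congr (_ * _)%R.
    have h20 : (0 <= 2^-1 :> R)%R by rewrite invr_ge0.
    by rewrite -(powR_mulrn j.+1 h20) -powRrM mulrC powRrM powR_mulrn.
  have {}HW : (W * z ^+ j.+1 <= C3 * (w + 1) * j.+1%:R * z ^+ j)%R.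
    case/andP: z01 => z0 z1; apply: ler_pM => //; first by rewrite exprn_ge0// ltW.
    by rewrite exprS; apply: ler_piMl; [apply: exprn_ge0|]; exact: ltW.
  have K0 : (0 <= C2 * N * Phi `^ q^-1)%R.
    by apply: mulr_ge0 => //; apply: mulr_ge0; exact: ltW.
  have := ler_wpM2l K0 HW.
  move: (Phi `^ _)%R (z ^+ j.+1)%R (z ^+ j)%R => y1 y2 y3.
  by congr (_ <= _)%R; ring.
apply: le_trans (lee_nneseries _ (fun j _ => term j)) _.
  by move=> j _; rewrite mule_ge0 ?lee_fin ?powR_ge0// oscillation_ge0.
apply: lime_le.
  apply: is_cvg_nneseries => j _ _; apply: le_trans (term j).
  by rewrite mule_ge0 ?lee_fin ?powR_ge0// oscillation_ge0.
apply: nearW => n; rewrite sumEFin lee_fin -mulr_sumr big_mkord.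
rewrite [leRHS](_ : _ = C2 * C3 * N * Phi `^ q^-1 * (w + 1) * S)%R; last first.
  by move: (Phi `^ _)%R => y; ring.
apply: ler_wpM2l.
  apply: mulr_ge0; last exact: addr_ge0.
  by apply: mulr_ge0 => //; apply: mulr_ge0; [apply: mulr_ge0|]; exact: ltW.
apply: le_trans (HS' n); apply: ler_sum => i _.
by rewrite powRr1.
Qed.


End far_estimate.

(** * The potential between Morrey spaces *)

Section morrey_estimate.
Local Open Scope ereal_scope.

Lemma poweR_add_le {R : realType} (x y : \bar R) (q : R) : (0 <= q)%R -> 0 <= x -> 0 <= y ->
  (x + y) `^ q <= (2 `^ q)%:E * (x `^ q + y `^ q).
Proof.
move=> q0; wlog xy : x y / x <= y.
  move=> H x0 y0; have [xy|/ltW yx] := leP x y; first exact: H.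
  by rewrite addeC (addeC (x `^ q)); apply: H.
move=> x0 y0; apply: (@le_trans _ _ ((2%:E * y) `^ q)).
  by apply: le_poweR; rewrite ?adde_ge0// -[2%R]/(1 + 1)%R EFinD ge0_muleDl// !mul1e leeD2r.
by rewrite poweRM// poweR_EFin lee_wpmul2l ?lee_fin ?powR_ge0// leeDr// poweR_ge0.
Qed.

Context disp (X : measurableType disp) (R : realType)
  (mu : {sigma_finite_measure set X -> \bar R}) (d : X -> X -> R) (k g v : R)
  (c : nat -> X).
Hypothesis HS : homogeneous_space mu d k g v c.
Variables (b : X -> R) (beta : X -> R -> R) (D : R).
Hypothesis mb : measurable_fun setT b.
Hypothesis D0 : (0 < D)%R.
Hypothesis bD : forall x r, (0 < r)%R ->
  \int[mu]_(y in qball d x r) `|b y - beta x r|%:E <= D%:E * mu (qball d x r).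
Variables (p q al be : R).
Hypotheses (p1 : (1 < p)%R) (pq : (p < q)%R).
Hypotheses (al0 : (0 < al)%R) (alg : (al < g)%R).
Hypothesis bE : (be * (q - p) = al * p)%R.
Let v0 := hs_v HS.
Let g0 := hs_g HS.
Let k1 := hs_k HS.
Let p0 : (0 < p)%R. Proof. by apply: lt_trans p1. Qed.
Let q0 : (0 < q)%R. Proof. by apply: lt_trans pq. Qed.

Section fixed_dilation.
Variable L : R.
Hypothesis kL : (4 * k ^+ 2 <= L)%R.
Let L1 : (1 < L)%R. Proof. exact: (L_gt1 HS kL). Qed.
Let L0 : (0 < L)%R. Proof. exact: lt_trans L1. Qed.

(** In the pointwise bound only |b x - beta x0 r| depends on [x], and the John-Nirenberg inequality
    with exponent [q] controls its integral. *)
Lemma far_bound : exists2 K : R, (0 < K)%R & forall (f : X -> R) (x0 : X) (r N Phi : R),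
  measurable_fun setT f -> (forall y, (0 <= f y)%R) -> (0 < r)%R -> (0 < N)%R -> (0 < Phi)%R ->
  (forall j, \int[mu]_(y in qball d x0 (L ^+ j.+1 * r)) (f y `^ p)%:E <=
     (N `^ p * (L ^+ j.+1 * r) `^ g * (2^-1 ^+ j * Phi))%:E) ->
  (forall t, (0 < t)%R -> \int[mu]_(y in qball d x0 t) (f y `^ p)%:E <=
     (N `^ p * t `^ g * t `^ (- (p * (al + be))))%:E) ->
  \int[mu]_(x in qball d x0 r) potential mu d g b al f (~` qball d x0 (L * r)) x `^ q <=
    (K * N `^ q * Phi * r `^ g)%:E.
Proof.
have [p' [p'0 pp']] : exists p', (0 < p')%R /\ (p'^-1 + p^-1 = 1)%R.
  exists (p / (p - 1))%R; rewrite divr_gt0 ?subr_gt0//; split => //.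
  by rewrite invf_div; field; rewrite gt_eqF.
have [B B0 bB] := john_nirenberg HS kL mb D0 bD p'0.
have [B' B'0 bB'] := john_nirenberg HS kL mb D0 bD q0.
have [K K0 HK] := far_pointwise HS kL mb D0 bD p0 p'0 pp' B0 bB alg pq bE.
exists (K `^ q * 2 `^ q * (B' + 1) * v)%R.
  by rewrite !mulr_gt0 ?powR_gt0// addr_gt0.
move=> f x0 r N Phi mf f0 r0 N0 Phi0 H1 H2.
have mE := measurable_qball HS x0 r.
pose M := (K * N * Phi `^ q^-1)%R.
have M0 : (0 < M)%R by rewrite !mulr_gt0 ?powR_gt0.
have Mq : (M `^ q = K `^ q * N `^ q * Phi)%R.
  rewrite /M powRM ?mulr_ge0 ?powR_ge0 ?(ltW K0) ?(ltW N0)// powRM ?(ltW K0) ?(ltW N0)//.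
  by rewrite -powRrM mulVf ?gt_eqF// powRr1// ltW.
have MqE : (M `^ q)%:E = (K `^ q * N `^ q * Phi)%:E by rewrite Mq.
have mw : measurable_fun setT (fun y => ((`|b y - beta x0 r| `^ q)%:E : \bar R)).
  by apply/measurable_EFinP; apply: (measurableT_comp (measurable_powR _)); exact: measurable_dist_cst.
apply: (@le_trans _ _ (\int[mu]_(x in qball d x0 r)
    ((M `^ q * 2 `^ q)%:E * ((`|b x - beta x0 r| `^ q)%:E + 1)))).
  apply: le_integral_ge0 => x x0x; first exact: poweR_ge0.
  have := HK f x0 x r N Phi mf f0 r0 N0 Phi0 x0x H1 H2; rewrite -/M => h.
  apply: le_trans (le_poweR (ltW q0) _ h) _; first exact: potential_ge0.
  have M0' : 0 <= M%:E by rewrite lee_fin ltW.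
  have w1 : 0 <= (`|b x - beta x0 r| + 1)%:E by rewrite lee_fin addr_ge0.
  rewrite (EFinM M) (poweRM _ M0' w1) [M%:E `^ q]poweR_EFin (EFinM (M `^ q)%R) -muleA.
  apply: lee_wpmul2l; first by rewrite lee_fin powR_ge0.
  have := @poweR_add_le R (`|b x - beta x0 r|)%:E 1 q (ltW q0) _ lee01.
  by rewrite lee_fin normr_ge0 poweR_EFin poweR1r => /(_ isT).
rewrite ge0_integralZl_EFin//; last 3 first.
- by move=> x _; rewrite adde_ge0// lee_fin powR_ge0.
- by apply: measurable_funTS; apply: emeasurable_funD.
- by rewrite mulr_ge0 ?powR_ge0.
rewrite ge0_integralD//; last exact: measurable_funTS.
rewrite integral_cst// mul1e.
apply: (@le_trans _ _ ((M `^ q * 2 `^ q)%:E * ((B' + 1)%:E * mu (qball d x0 r)))).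
  apply: lee_wpmul2l; first by rewrite lee_fin mulr_ge0 ?powR_ge0.
  by rewrite EFinD ge0_muleDl ?lee_fin ?(ltW B'0)// mul1e leeD2r// bB'.
rewrite (hs_volume HS)// -!EFinM lee_fin Mq.
move: (_ `^ q)%R (_ `^ q)%R (_ `^ q)%R (_ `^ g)%R => y1 y2 y3 y4.
by rewrite le_eqVlt; apply/orP; left; apply/eqP; ring.
Qed.

(** Applies [near_bound] with th q = p; Hölder lowers the Morrey bound from the exponent p to s. *)
Lemma near_part : exists2 K : R, (0 < K)%R & forall (f : X -> R) (x0 : X) (r N Phi : R),
  measurable_fun setT f -> (forall y, (0 <= f y)%R) -> (0 < r)%R -> (0 < N)%R -> (0 < Phi)%R ->
  \int[mu]_(y in qball d x0 (L * r)) (f y `^ p)%:E <= (N `^ p * (L * r) `^ g * Phi)%:E ->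
  (forall z t, (0 < t)%R -> \int[mu]_(y in qball d z t) (f y `^ p)%:E <=
     (N `^ p * t `^ g * t `^ (- (p * (al + be))))%:E) ->
  \int[mu]_(x in qball d x0 r)
    potential mu d g b al (fun y => f y * \1_(qball d x0 (L * r)) y)%R (qball d x (L ^+ 2 * r)) x `^ q
   <= (K * N `^ q * Phi * r `^ g)%:E.
Proof.
have be0 : (0 < be)%R.
  by rewrite -(@pmulr_lgt0 _ (q - p)) ?subr_gt0// bE mulr_gt0.
have thE : (be / (al + be) * q = p)%R.
  have ab0 : (0 < al + be)%R by rewrite addr_gt0.
  rewrite mulrAC; apply: (mulIf (lt0r_neq0 ab0)); rewrite divfK ?gt_eqF//.
  by rewrite mulrDr (mulrC p al) -bE; ring.
pose q' := (q / (q - 1))%R.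
have q1 : (1 < q)%R by apply: lt_trans pq.
have q'1 : (1 < q')%R by rewrite /q' ltr_pdivlMr ?subr_gt0// mul1r ltrBlDr ltrDl.
have q'0 : (0 < q')%R by apply: lt_trans q'1.
have qq' : (q^-1 + q'^-1 = 1)%R by rewrite /q' invf_div; field; rewrite gt_eqF.
(* s > 1 leaves a finite conjugate exponent for the oscillation of b; s < p and s < q' allow the
   maximal theorem for f^s and h^s. *)
have [s [s1 sp sq']] : exists s, [/\ (1 < s)%R, (s < p)%R & (s < q')%R].
  exists ((1 + Num.min p q') / 2)%R.
  have m1 : (1 < Num.min p q')%R by rewrite lt_min p1.
  have mp : (Num.min p q' <= p)%R by rewrite ge_min lexx.
  have mq : (Num.min p q' <= q')%R by rewrite ge_min lexx orbT.
  by move: (Num.min p q') m1 mp mq => m m1 mp mq; split; lra.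
have s0 : (0 < s)%R by apply: lt_trans s1.
pose u := (s / (s - 1))%R.
have u0 : (0 < u)%R by rewrite divr_gt0// subr_gt0.
have us : (u^-1 + s^-1 = 1)%R by rewrite /u invf_div; field; rewrite gt_eqF.
have [B B0 bB] := john_nirenberg HS kL mb D0 bD u0.
have sp' : (s < be / (al + be) * q)%R by rewrite thE.
have [K K0 HK] := near_bound HS kL mb al0 alg be0 u0 s0 us B0 bB q0 q'0 qq' sp' sq'.
rewrite thE in HK.
(* The volume factor that Hölder produces when f^p is traded for f^s. *)
pose c1 := (v `^ ((p - s) / (p * s)))%R.
have c10 : (0 < c1)%R by rewrite powR_gt0.
exists (K * c1 `^ (q - p) * L `^ g)%R.
  by rewrite mulr_gt0 ?powR_gt0// mulr_gt0// powR_gt0.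
move=> f x0 r N Phi mf f0 r0 N0 Phi0 H1 H2.
have Lr0 : (0 < L * r)%R by rewrite mulr_gt0.
have mI : measurable_fun setT (\1_(qball d x0 (L * r)) : X -> R).
  by apply: measurable_indic; exact: measurable_qball HS _ _.
set f1 := (fun y => _ : R).
have mf1 : measurable_fun setT f1 by exact: measurable_funM.
have f10 y : (0 <= f1 y)%R by rewrite mulr_ge0.
have f1f y : (f1 y <= f y)%R.
  by rewrite /f1 indicE; case: (_ \in _); rewrite ?mulr1// mulr0.
have N10 : (0 < N * c1)%R by rewrite mulr_gt0.
have Hs z t : (0 < t)%R -> \int[mu]_(y in qball d z t) (f1 y `^ s)%:E <=
    ((N * c1) `^ s * t `^ (g - s * (al + be)))%:E.
  move=> t0; have tn e : (e == 0)%R ==> (t != 0%R) by rewrite (gt_eqF t0) implybT.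
  apply: (@le_trans _ _ (\int[mu]_(y in qball d z t) (f y `^ s)%:E)).
    apply: le_integral_ge0 => y _; rewrite lee_fin ?powR_ge0//.
    by apply: ge0_ler_powR; rewrite ?nnegrE ?(ltW s0).
  have ps0 : (0 < p / s)%R by rewrite divr_gt0.
  have psu0 : (0 < p / (p - s))%R by rewrite divr_gt0// subr_gt0.
  have psE : ((p / (p - s))^-1 + (p / s)^-1 = 1)%R.
    by rewrite !invf_div -mulrDl subrK mulfV// gt_eqF.
  have mfs : measurable_fun setT (fun y => f y `^ s)%R.
    exact: (measurableT_comp (measurable_powR _) mf).
  have := hoelder_set1 mu psu0 ps0 psE (measurable_qball HS z t) mfs (fun=> powR_ge0 _ _).
  under [X in _ * X `^ _]eq_integral do rewrite -powRrM mulrC divfK ?gt_eqF//.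
  move=> /le_trans; apply; rewrite [X in X `^ _ * _ <= _](hs_volume HS z t0) poweR_EFin.
  apply: le_trans (lee_wpmul2l _ (le_poweR _ _ (H2 z t t0))) _.
  - by rewrite lee_fin powR_ge0.
  - by rewrite invr_ge0 ltW.
  - by apply: integral_ge0 => y _; rewrite lee_fin powR_ge0.
  rewrite poweR_EFin -EFinM lee_fin !invf_div.
  rewrite !powRM ?powR_ge0 ?mulr_ge0 ?powR_ge0 ?(ltW v0) ?(ltW N0) ?(ltW c10)//.
  have c1E : (c1 `^ s = v `^ ((p - s) / p))%R.
    by rewrite /c1 -powRrM; congr (_ `^ _)%R; field; rewrite !gt_eqF.
  have NE : ((N `^ p) `^ (s / p) = N `^ s)%R by rewrite -powRrM mulrC divfK// gt_eqF.
  have tE : ((t `^ g) `^ ((p - s) / p) * ((t `^ g) `^ (s / p) * (t `^ (- (p * (al + be)))) `^ (s / p))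
      = t `^ (g - s * (al + be)))%R.
    rewrite -!powRrM -!powRD ?tn//; congr (_ `^ _)%R; field; exact: lt0r_neq0.
  rewrite c1E NE -tE.
  move: (v `^ _)%R (N `^ s)%R ((t `^ g) `^ ((p - s) / p))%R ((t `^ g) `^ (s / p))%R
    ((t `^ _) `^ (s / p))%R => y1 y2 y3 y4 y5.
  by rewrite le_eqVlt; apply/orP; left; apply/eqP; ring.
have L2r0 : (0 < L ^+ 2 * r)%R by rewrite mulr_gt0// exprn_gt0.
have := HK f1 (L ^+ 2 * r)%R (N * c1)%R (qball d x0 r) mf1 f10 L2r0 N10
  (measurable_qball HS _ _) (qball_fin HS _ _) Hs.
move=> /le_trans; apply.
have -> : \int[mu]_x (f1 x `^ p)%:E = \int[mu]_(x in qball d x0 (L * r)) (f x `^ p)%:E.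
  rewrite [RHS]integral_mkcond; apply: eq_integral => y _.
  rewrite patchE /f1 indicE; case: ifPn => _; first by rewrite mulr1.
  by rewrite mulr0 powR0// gt_eqF.
apply: le_trans (lee_wpmul2l _ H1) _.
  by rewrite lee_fin mulr_ge0 ?powR_ge0// ltW.
rewrite -EFinM lee_fin (powRM _ (ltW N0) (ltW c10)) (powRM _ (ltW L0) (ltW r0)).
have NE : (N `^ q = N `^ (q - p) * N `^ p)%R.
  by rewrite -powRD ?subrK// (gt_eqF N0) implybT.
rewrite NE; move: (N `^ p)%R (N `^ (q - p))%R (c1 `^ _)%R (L `^ g)%R (r `^ g)%R => y1 y2 y3 y4 y5.
by rewrite le_eqVlt; apply/orP; left; apply/eqP; ring.
Qed.

End fixed_dilation.

Lemma potential_morrey (C : R) (phi : X -> R -> R) : (1 <= C)%R ->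
  (forall x t, (0 < t)%R -> (0 < phi x t)%R) ->
  (forall x, growth_sup g p C (phi x)) ->
  (forall x r, (0 < r)%R ->
    \int[lebesgue_measure]_(t in `]r, +oo[)
      ((1 + ln (t / r)) * t `^ al * phi x t `^ p^-1 / t)%:E <= (C * r `^ (- be))%:E) ->
  exists2 K : R, (0 < K)%R & forall (f : X -> R) (N : R),
    measurable_fun setT f -> (forall y, (0 <= f y)%R) -> (0 < N)%R ->
    (forall x r, (0 < r)%R ->
      \int[mu]_(y in qball d x r) (f y `^ p)%:E <= (N `^ p * phi x r * r `^ g)%:E) ->
    forall x0 r, (0 < r)%R ->
    \int[mu]_(x in qball d x0 r) potential mu d g b al f setT x `^ q <=
      (K * N `^ q * phi x0 r * r `^ g)%:E.
Proof.
move=> C1 phi0 Hsup Hint; have C0 : (0 < C)%R by apply: lt_le_trans C1.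
have [L0 L01 HL0] := ess_inf_above_geometric g0 p0 C1.
(* One dilation factor for both the covering arguments and the decay of the essential infima. *)
have [L [kL LL0]] : exists L, (4 * k ^+ 2 <= L)%R /\ (L0 <= L)%R.
  by exists (Num.max (4 * k ^+ 2)%R L0); rewrite !le_max !lexx orbT.
have L1 : (1 < L)%R by exact: (L_gt1 HS kL).
have Lp : (0 < L)%R by apply: lt_trans L1.
have [K1 K10 HK1] := far_bound kL.
have [K2 K20 HK2] := near_part kL.
(* Dominates the constants of both bounds on the integrals of f^p, so that a single [N1] serves in
   [H1] and [H2]. *)
have [M0 M0E] : exists M0, M0 = (C + 2 `^ g * (2 * C) `^ p)%R by eexists.
have CM0 : (C <= M0)%R by rewrite M0E lerDl mulr_ge0 ?powR_ge0.
have M00 : (0 < M0)%R by apply: lt_le_trans CM0.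
have GM0 : (2 `^ g * (2 * C) `^ p <= M0)%R by rewrite M0E lerDr ltW.
exists (2 `^ q * ((K1 + K2) * M0 `^ (q / p)))%R.
  by rewrite !mulr_gt0 ?powR_gt0// addr_gt0.
move=> f N mf f0 N0 Hf.
pose N1 := (N * M0 `^ p^-1)%R.
have N10 : (0 < N1)%R by rewrite mulr_gt0// powR_gt0.
have N1p : (N1 `^ p = N `^ p * M0)%R.
  by rewrite /N1 powRM ?powR_ge0 ?(ltW N0)// -powRrM mulVf ?gt_eqF// powRr1// ltW.
have N1q : (N1 `^ q = N `^ q * M0 `^ (q / p))%R.
  by rewrite /N1 powRM ?powR_ge0 ?(ltW N0)// -powRrM (mulrC q).
have Np0 : (0 < N `^ p)%R by rewrite powR_gt0.
pose I x t := fine (\int[mu]_(y in qball d x t) (f y `^ p)%:E).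
have If0 x t : 0 <= \int[mu]_(y in qball d x t) (f y `^ p)%:E.
  by apply: integral_ge0 => y _; rewrite lee_fin powR_ge0.
have IE x t : (0 < t)%R -> \int[mu]_(y in qball d x t) (f y `^ p)%:E = (I x t)%:E.
  by move=> t0; rewrite fineK// ge0_fin_numE// (le_lt_trans (Hf x t t0))// ltry.
have I0 x t : (0 <= I x t)%R by exact: fine_ge0.
have Imono x t t' : (0 < t)%R -> (t < t')%R -> (I x t <= I x t')%R.
  move=> t0 tt'; rewrite -lee_fin -!IE//; last exact: lt_trans tt'.
  apply: le_integral_subset => [y|y _]; last by rewrite lee_fin powR_ge0.
  by rewrite /qball /= => /lt_trans; exact.
have HI x t : (0 < t)%R -> (I x t <= N `^ p * phi x t * t `^ g)%R.
  by move=> t0; rewrite -lee_fin -IE// Hf.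
have H2 x t : (0 < t)%R -> \int[mu]_(y in qball d x t) (f y `^ p)%:E <=
     (N1 `^ p * t `^ g * t `^ (- (p * (al + be))))%:E.
  move=> t0; rewrite IE// lee_fin.
  have := growth_int_bound g0 p0 C1 Np0 t0 (ltW al0) (phi0 x) (Imono x t ^~ t0) (I0 x t)
    (HI x) (Hint x t t0).
  move=> /le_trans; apply.
  have -> : (t `^ (g - p * (al + be)) = t `^ g * t `^ (- (p * (al + be))))%R.
    by rewrite powRD// (gt_eqF t0) implybT.
  rewrite mulrA ler_wpM2r ?powR_ge0// ler_wpM2r ?powR_ge0// N1p.
  by rewrite ler_pM2l.
have H1 x r j : (0 < r)%R -> \int[mu]_(y in qball d x (L ^+ j.+1 * r)) (f y `^ p)%:E <=
     (N1 `^ p * (L ^+ j.+1 * r) `^ g * (2^-1 ^+ j * phi x r))%:E.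
  move=> r0; have t0 : (0 < L ^+ j.+1 * r)%R by rewrite mulr_gt0// exprn_gt0.
  rewrite IE//.
  apply: le_trans (ess_inf_above_dominates Np0 t0 (fun u => Imono x _ u t0) (HI x)) _.
  apply: le_trans (lee_wpmul2l _ (HL0 L LL0 _ (phi0 x) (Hsup x) r j r0)) _.
    by rewrite lee_fin ltW.
  rewrite -EFinM lee_fin N1p.
  have z0 : (0 <= N `^ p * ((L ^+ j.+1 * r) `^ g) * (2^-1 ^+ j * phi x r))%R.
    apply: mulr_ge0; apply: mulr_ge0; rewrite ?powR_ge0 ?exprn_ge0 ?invr_ge0//.
    exact/ltW/phi0.
  have := ler_wpM2l z0 CM0.
  move: ((_ * r) `^ g)%R (phi x r)%R (2^-1 ^+ j)%R => y1 y2 y3.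
  by congr (_ <= _)%R; ring.
move=> x0 r r0.
have Lr0 : (0 < L * r)%R by rewrite mulr_gt0.
have mE := measurable_qball HS x0 r.
have mL := measurable_qball HS x0 (L * r).
set f1 := (fun y => f y * \1_(qball d x0 (L * r)) y)%R.
have mf1 : measurable_fun setT f1 by apply: measurable_funM => //; exact: measurable_indic.
have f10 y : (0 <= f1 y)%R by rewrite mulr_ge0.
have near := HK2 f x0 r N1 (phi x0 r) mf f0 r0 N10 (phi0 x0 r r0).
have := H1 x0 r 0%N r0; rewrite expr1 expr0 mul1r => /near/(_ H2) {}near.
have far := HK1 f x0 r N1 (phi x0 r) mf f0 r0 N10 (phi0 x0 r r0) (fun j => H1 x0 r j r0) (H2 x0).
have T1 x : (0 <= potential mu d g b al f1 (qball d x (L ^+ 2 * r)) x) by exact: potential_ge0.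
have T2 x : (0 <= potential mu d g b al f (~` qball d x0 (L * r)) x) by exact: potential_ge0.
have mpow (F : X -> \bar R) : measurable_fun setT F -> measurable_fun setT (fun x => F x `^ q).
  by move=> mF; exact: (measurableT_comp (measurable_poweR _) mF).
have mT1 := mpow _ (measurable_potential_qball HS mb al (L ^+ 2 * r) mf1 f10).
have mT2 := mpow _ (measurable_potential HS mb al mf f0 (measurableC mL)).
apply: (@le_trans _ _ (\int[mu]_(x in qball d x0 r) ((2 `^ q)%:E *
    (potential mu d g b al f1 (qball d x (L ^+ 2 * r)) x `^ q +
     potential mu d g b al f (~` qball d x0 (L * r)) x `^ q)))).
  apply: le_integral_ge0 => x x0x; first exact: poweR_ge0.
  apply: le_trans (poweR_add_le (ltW q0) (T1 x) (T2 x)).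
  apply: le_poweR; [exact: ltW|exact: potential_ge0|].
  have mh : measurable_fun setT (fun y => (((`|b x - b y| * f y) * d x y `^ (al - g))%:E : \bar R)).
    apply/measurable_EFinP; apply: measurable_funM; first exact: measurable_oscillation_term.
    apply: (measurableT_comp (measurable_powR _)).
    have m1 : measurable_fun setT (fun y : X => (x, y)).
      by apply/measurable_fun_pair => //; exact: measurable_cst.
    exact: (measurableT_comp (hs_measurable HS) m1).
  rewrite {1}/potential -(setvU (qball d x0 (L * r))) setUC ge0_integral_setU//; last 4 first.
  - exact: measurableC.
  - exact: measurable_funTS.
  - by move=> y _; rewrite lee_fin !mulr_ge0 ?powR_ge0.
  - by apply/disj_setPS => y [].
  apply: leeD2r; rewrite /potential integral_mkcond [leRHS]integral_mkcond.
  apply: le_integral_ge0 => y _.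
    by rewrite patchE; case: ifP => // _; rewrite lee_fin !mulr_ge0 ?powR_ge0.
  rewrite patchE; case: ifPn => [|_]; last first.
    by rewrite patchE; case: ifP => // _; rewrite lee_fin !mulr_ge0 ?powR_ge0.
  rewrite inE => x0y; rewrite patchE ifT.
    by rewrite /f1 indicE mem_set// mulr1.
  (* The ball of radius L r about [x0] lies in the ball of radius L^2 r about [x], since 2k <= L. *)
  rewrite inE /qball /=; have xx0 : (d x x0 < r)%R by rewrite (hs_sym HS).
  apply: lt_le_trans (qtriangle HS xx0 (x0y : (d x0 y < L * r)%R)) _.
  have rL : (r <= L * r)%R by rewrite ler_peMl ?(ltW r0)// ltW.
  have k0 : (0 < k)%R by apply: lt_le_trans k1.
  apply: (@le_trans _ _ (k * (2 * (L * r))))%R; first by rewrite ler_pM2l//; move: rL; lra.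
  have kL2 : (k * 2 <= L)%R by apply: le_trans kL; move: k1; nra.
  by have := ler_wpM2r (ltW Lr0) kL2; congr (_ <= _)%R; ring.
rewrite ge0_integralZl_EFin ?powR_ge0//; last 2 first.
- by move=> x _; rewrite adde_ge0 ?poweR_ge0.
- by apply: measurable_funTS; exact: emeasurable_funD.
rewrite ge0_integralD//; last 4 first.
- by move=> x _; exact: poweR_ge0.
- exact: measurable_funTS.
- by move=> x _; exact: poweR_ge0.
- exact: measurable_funTS.
apply: le_trans (lee_wpmul2l _ (leeD near far)) _; first by rewrite lee_fin powR_ge0.
rewrite -EFinD -EFinM lee_fin N1q.
move: (M0 `^ _)%R (N `^ q)%R (phi x0 r) (r `^ g)%R (2 `^ q)%R => y1 y2 y3 y4 y5.
by rewrite le_eqVlt; apply/orP; left; apply/eqP; ring.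
Qed.

End morrey_estimate.

(** * The two commutators: measurability and domination by the potential *)

Section commutators.
Context {R : realType} (n : nat).
Local Notation V := ('cV[R]_n).
Local Notation leb := (@lebesgue_cV R n).
Variables (P : 'M[R]_n) (rho : V -> R).
Hypothesis rhoP : quasi_distance P rho.
Local Notation g := (\tr P).
Hypothesis g0 : 0 < g.
Local Notation dist := (fun x y : V => rho (x - y)).

Lemma quasi_distance_space : exists k v c, homogeneous_space leb dist k g v c.
Proof.
have [k k1 Hk] := quasi_distance_subadd rhoP.
have [v v0 Hv] := ellipsoid_volume rhoP.
have [c Hc] := dense_centers rhoP.
exists k, v, c; split => //.
- exact: measurable_quasi_distance rhoP.
- exact: qd_sym rhoP.
- by move=> x; rewrite subrr (qd_0 rhoP).
- exact: qd_ge0 rhoP.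
- by move=> x y z; rewrite -(subrKA z).
- exact: ellipsoid_density rhoP.
Qed.

Variables (k v : R) (c : nat -> V).
Hypothesis HS : homogeneous_space leb dist k g v c.
Let v0 := hs_v HS.

Lemma vol_ellipsoid x r : 0 < r -> vol rho x r = v * r `^ g.
Proof. by move=> r0; rewrite /vol [X in fine X](hs_volume HS x r0). Qed.

Variables (b : V -> R) (al : R).
Hypothesis mb : measurable_fun setT b.
Hypotheses (al0 : 0 < al) (alg : al < g).

Lemma potential_commutatorE (f : V -> R) x : potential_commutator P rho b al f x =
  (\int[leb]_y ((b x - b y) * (f y * rho (x - y) `^ (al - g)))%:E)%E.
Proof. by apply: eq_integral => y _; rewrite -powRN opprB. Qed.

Lemma potential_commutator_le (f : V -> R) x : measurable_fun setT f ->
  (`|potential_commutator P rho b al f x| <=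
   potential leb dist g b al (fun y => `|f y|)%R setT x)%E.
Proof.
move=> mf; rewrite potential_commutatorE; apply: le_trans (le_abse_integral _ _ _) _ => //.
  apply/measurable_EFinP; apply: measurable_funM; first exact: measurable_funB.
  apply: measurable_funM => //; apply: (measurableT_comp (measurable_powR _)).
  have m1 : measurable_fun setT (fun y : V => (x, y)).
    by apply/measurable_fun_pair => //; exact: measurable_cst.
  exact: (measurableT_comp (hs_measurable HS) m1).
apply: le_integral_ge0 => y _ //=; rewrite lee_fin !normrM mulrA.
by rewrite (ger0_norm (powR_ge0 _ _)).
Qed.

(** The integrand changes sign, so Tonelli is applied to its positive and negative parts, whose
    difference defines the integral. *)
Lemma measurable_potential_commutator (f : V -> R) : measurable_fun setT f ->
  measurable_fun setT (potential_commutator P rho b al f).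
Proof.
move=> mf.
pose F (z : V * V) : \bar R :=
  ((b z.1 - b z.2) * (f z.2 * rho (z.1 - z.2) `^ (al - g)))%:E.
have mF : measurable_fun setT F.
  apply/measurable_EFinP; apply: measurable_funM.
    apply: measurable_funB; first exact: (measurableT_comp mb measurable_fst).
    exact: (measurableT_comp mb measurable_snd).
  apply: measurable_funM; first exact: (measurableT_comp mf measurable_snd).
  exact: (measurableT_comp (measurable_powR _) (hs_measurable HS)).
have mFp : measurable_fun setT F^\+%E by exact: measurable_funepos.
have mFn : measurable_fun setT F^\-%E by exact: measurable_funeneg.
have mp := @measurable_fun_fubini_tonelli_F _ _ _ _ _ leb _ mFp (funepos_ge0 _).
have mn := @measurable_fun_fubini_tonelli_F _ _ _ _ _ leb _ mFn (funeneg_ge0 _).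
have := emeasurable_funB mp mn.
congr measurable_fun; apply/funext => x.
rewrite potential_commutatorE [RHS]integralE /fubini_F /=.
by congr (_ - _)%E; apply: eq_integral => y _; rewrite unlock.
Qed.

(** An enumeration of the positive rationals; every other code gives 1. *)
Definition positive_rational (m : nat) : R :=
  let s := ratr (odflt 0%Q (unpickle m)) in if 0 < s then s else 1.

Lemma positive_rational_gt0 m : 0 < positive_rational m.
Proof. by rewrite /positive_rational; case: ifPn. Qed.

Definition ellipsoid_average (f : V -> R) (t : R) (x : V) : \bar R :=
  ((vol rho x t `^ (- 1 + al / g))%:E *
    oscillation leb b (fun y => `|f y|)%R (ellipsoid rho x t) x)%E.

Lemma vol_powE x t : 0 < t ->
  vol rho x t `^ (- 1 + al / g) = v `^ (- 1 + al / g) * t `^ (al - g).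
Proof.
move=> t0; rewrite vol_ellipsoid// powRM ?powR_ge0 ?(ltW v0)// -powRrM.
by congr (_ * _ `^ _); field; rewrite gt_eqF.
Qed.

(** Reduces the supremum to countably many radii. The integral increases with the radius and the
    volume factor is continuous, so the value at t is at most 1 + e times the value at a rational
    slightly above t. *)
Lemma maximal_commutatorE (f : V -> R) x : maximal_commutator P rho b al f x =
  ereal_sup [set ellipsoid_average f (positive_rational m) x | m in setT].
Proof.
apply/eqP; rewrite eq_le; apply/andP; split; last first.
  apply: ge_ereal_sup => _ [m _ <-]; apply: ereal_sup_ubound.
  exists (positive_rational m) => //=.
  by rewrite in_itv/= andbT positive_rational_gt0.
set S := ereal_sup [set _ | _ in setT].
have o0 t : (0 <= oscillation leb b (fun y => `|f y|)%R (ellipsoid rho x t) x)%E.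
  exact: oscillation_ge0.
have a0 t : (0 <= ellipsoid_average f t x)%E by rewrite mule_ge0// lee_fin powR_ge0.
have S0 : (0 <= S)%E by apply: le_trans (a0 (positive_rational 0%N)) _; apply: ereal_sup_ubound; exists 0%N.
apply: ge_ereal_sup => _ [t /= + <-]; rewrite in_itv/= andbT => t0.
have key e : 0 < e -> (ellipsoid_average f t x <= (1 + e)%:E * S)%E.
  move=> e0; have ga0 : 0 < g - al by rewrite subr_gt0.
  (* The ratio of radii at which the factor t^(al - g) has changed by exactly 1 + e. *)
  pose w := (1 + e) `^ (g - al)^-1.
  have w1 : 1 < w.
    have -> : 1 = 1 `^ (g - al)^-1 :> R by rewrite powR1.
    by apply: gt0_ltr_powR; rewrite ?invr_gt0 ?nnegrE ?addr_ge0 ?(ltW e0)// ltrDl.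
  have twt : t < w * t by rewrite ltr_pMl.
  have [s] := rat_in_itvoo twt.
  rewrite in_itv/= => /andP[ts sw].
  have s0 : 0 < ratr s :> R by apply: lt_trans ts.
  have sE : positive_rational (pickle s) = ratr s.
    by rewrite /positive_rational pickleK /= s0.
  apply: (@le_trans _ _ ((1 + e)%:E * ellipsoid_average f (ratr s) x)%E).
    rewrite /ellipsoid_average !vol_powE// muleA -EFinM.
    apply: lee_pmul => //.
    - by rewrite lee_fin mulr_ge0 ?powR_ge0.
    - rewrite lee_fin mulrCA ler_wpM2l ?powR_ge0//.
      have -> : al - g = - (g - al) by rewrite opprB.
      rewrite !powRN ler_pdivlMr ?powR_gt0// ler_pdivrMl ?powR_gt0//.
      rewrite mulrC.
      have -> : 1 + e = w `^ (g - al) by rewrite /w -powRrM mulVf ?gt_eqF// powRr1// addr_ge0// ltW.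
      rewrite -powRM ?(ltW t0) ?(ltW (lt_trans ltr01 w1))//.
      by apply: ge0_ler_powR; rewrite ?nnegrE ?(ltW s0) ?(ltW sw) ?(ltW ga0)// mulr_ge0 ?(ltW t0)// (ltW (lt_trans ltr01 w1)).
    - apply: le_integral_subset => [y|y _]; last by rewrite lee_fin mulr_ge0.
      by rewrite /ellipsoid /= => /lt_trans; exact.
  apply: lee_wpmul2l; first by rewrite lee_fin addr_ge0// ltW.
  by apply: ereal_sup_ubound; exists (pickle s) => //; rewrite sE.
case: S S0 key => [S| |//] S0 key; last exact: leey.
rewrite lee_fin in S0.
apply/lee_addgt0Pr => e e0.
(* The supremum may be 0, hence the division by S + 1. *)
have S1 : 0 < S + 1 by rewrite ltr_wpDl.
apply: le_trans (key (e / (S + 1)) _) _; first by rewrite divr_gt0.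
rewrite -EFinM -EFinD lee_fin mulrDl mul1r lerD2l mulrAC.
by rewrite ler_pdivrMr// ler_pM2l// lerDl.
Qed.

Lemma measurable_maximal_commutator (f : V -> R) : measurable_fun setT f ->
  measurable_fun setT (maximal_commutator P rho b al f).
Proof.
move=> mf; rewrite (_ : maximal_commutator _ _ _ _ _ =
  (fun x => esups ((ellipsoid_average f \o positive_rational)^~ x) 0%N)); last first.
  apply/funext => x; rewrite maximal_commutatorE /esups /sdrop /=.
  by congr ereal_sup; apply/seteqP; split => _ [m _ <-]; exists m.
apply: measurable_fun_esups => m.
have t0 := positive_rational_gt0 m.
have mnf : measurable_fun setT (fun y : V => `|f y|) by exact: measurableT_comp.
have m1 : measurable_fun setT (fun x : V => (x, x)) by exact/measurable_fun_pair.
have mo := measurableT_comp (measurable_oscillation2 HS mb mnf (fun=> normr_ge0 _)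
  (positive_rational m)) m1.
have := emeasurable_funM
  (measurable_cst (v `^ (- 1 + al / g) * positive_rational m `^ (al - g))%:E) mo.
by congr measurable_fun; apply/funext => x; rewrite /= /ellipsoid_average vol_powE.
Qed.

(** Inside E(x,t) the distance to [x] is below t, and al < g, so t^(al - g) is at most the kernel
    weight; on the diagonal the integrand vanishes. *)
Lemma maximal_commutator_le (f : V -> R) x : measurable_fun setT f ->
  (`|maximal_commutator P rho b al f x| <= (v `^ (- 1 + al / g))%:E *
   potential leb dist g b al (fun y => `|f y|)%R setT x)%E.
Proof.
move=> mf; rewrite gee0_abs; last first.
  rewrite maximal_commutatorE; apply: le_trans (ereal_sup_ubound _); last by exists 0%N.
  by rewrite /ellipsoid_average mule_ge0 ?lee_fin ?powR_ge0//; exact: oscillation_ge0.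
apply: ge_ereal_sup => _ [t /= + <-]; rewrite in_itv/= andbT => t0.
rewrite vol_powE// EFinM -muleA; apply: lee_wpmul2l; first by rewrite lee_fin powR_ge0.
have mosc : measurable_fun setT (fun y => `|b x - b y| * `|f y|).
  by apply: measurable_oscillation_term => //; exact: measurableT_comp.
rewrite -ge0_integralZl_EFin ?powR_ge0//; last 2 first.
- exact: measurable_ellipsoid rhoP _ _.
- by apply/measurable_EFinP; exact: measurable_funTS.
apply: (@le_trans _ _ (potential leb dist g b al (fun y => `|f y|) (ellipsoid rho x t) x)).
  apply: le_integral_ge0 => y; first by rewrite mule_ge0 ?lee_fin ?powR_ge0// mulr_ge0.
  rewrite /ellipsoid /= => xy; rewrite -EFinM lee_fin mulrC.
  have [->|xNy] := eqVneq x y; first by rewrite !subrr normr0 !mul0r.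
  rewrite ler_wpM2l ?mulr_ge0//.
  have -> : al - g = - (g - al) by rewrite opprB.
  apply: powR_anti; [by rewrite subr_ge0 ltW| |exact: ltW].
  by rewrite (qd_gt0 rhoP)// subr_eq0.
by apply: le_integral_subset => // y _; rewrite lee_fin !mulr_ge0 ?powR_ge0.
Qed.

End commutators.

(** * Transfer to Morrey norms *)

Section morrey_bounded_by_potential.
Context {R : realType} (n : nat).
Local Notation V := ('cV[R]_n).
Local Notation leb := (@lebesgue_cV R n).
Variables (P : 'M[R]_n) (rho : V -> R).
Hypothesis rhoP : quasi_distance P rho.
Local Notation g := (\tr P).
Local Notation dist := (fun x y : V => rho (x - y)).
Variables (k v : R) (c : nat -> V).
Hypothesis HS : homogeneous_space leb dist k g v c.
Let v0 := hs_v HS.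

Lemma Lnorm_patch (e : R) (F : V -> \bar R) (E : set V) : 0 < e ->
  ('N[leb]_e%:E[F \_ E] = (\int[leb]_(x in E) `|F x| `^ e) `^ e^-1)%E.
Proof.
move=> e0; rewrite unlock; congr (_ `^ _)%E; rewrite [RHS]integral_mkcond.
apply: eq_integral => x _; rewrite !patchE; case: ifP => // _.
by rewrite abse0 poweR0r// gt_eqF.
Qed.

(** Removes roots and inverses from the norm, so that the estimates can be made on integrals over
    ellipsoids. *)
Lemma morrey_normP (e : R) (phi : V -> R -> R) (F : V -> \bar R) (N : R) : 0 < e ->
  (forall x t, 0 < t -> 0 < phi x t) -> 0 <= N ->
  (morrey_norm rho e (fun x r => phi x r `^ e^-1)%R F <= N%:E)%E <->
  forall x r, 0 < r -> (\int[leb]_(y in ellipsoid rho x r) `|F y| `^ e <=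
    (N `^ e * phi x r * (v * r `^ g))%:E)%E.
Proof.
move=> e0 phi0 N0; have ei0 : 0 <= e^-1 by rewrite invr_ge0 ltW.
have J0 x r : (0 <= \int[leb]_(y in ellipsoid rho x r) `|F y| `^ e)%E.
  by apply: integral_ge0 => y _; exact: poweR_ge0.
have eq x r : 0 < r ->
    (((phi x r `^ e^-1)^-1 * vol rho x r `^ (- e^-1))%:E *
      'N[leb]_e%:E[F \_ (ellipsoid rho x r)] <= N%:E)%E <->
    (\int[leb]_(y in ellipsoid rho x r) `|F y| `^ e <=
      (N `^ e * phi x r * (v * r `^ g))%:E)%E.
  move=> r0; rewrite Lnorm_patch// (vol_ellipsoid HS)//.
  set m := v * r `^ g; have m0 : 0 < m by rewrite mulr_gt0 ?powR_gt0.
  have ph0 := phi0 x r r0.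
  rewrite (powRN m) -invfM -powRM ?(ltW ph0) ?(ltW m0)//.
  have pm0 : 0 < phi x r * m by rewrite mulr_gt0.
  rewrite lee_pdivrMl ?powR_gt0// -EFinM.
  split => H.
    have := le_poweR (ltW e0) (poweR_ge0 _ _) H.
    rewrite -poweRrM mulVf ?gt_eqF// poweRe1 ?J0// => /le_trans; apply.
    rewrite poweR_EFin lee_fin (powRM _ (powR_ge0 _ _) N0) -powRrM mulVf ?gt_eqF// powRr1 ?(ltW pm0)//.
    by rewrite mulrC mulrA.
  apply: le_trans (le_poweR ei0 (J0 x r) H) _.
  rewrite poweR_EFin lee_fin -mulrA (powRM _ (powR_ge0 N e) (ltW pm0)).
  by rewrite -powRrM mulfV ?gt_eqF// powRr1// mulrC.
split=> H.
  move=> x r r0; apply/eq => //; apply: le_trans H; apply: ereal_sup_ubound.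
  by exists (x, r).
apply: ge_ereal_sup => _ [[x r] /= r0 <-]; apply/eq => //; exact: H.
Qed.

Variables (b : V -> R) (al p q M K : R) (phi : V -> R -> R).
Hypotheses (mb : measurable_fun setT b) (p0 : 0 < p) (q0 : 0 < q) (M0 : 0 < M) (K0 : 0 < K).
Hypothesis phi0 : forall x t, 0 < t -> 0 < phi x t.
Variable T : (V -> R) -> V -> \bar R.
Hypothesis mT : forall f, measurable_fun setT f -> measurable_fun setT (T f).
Hypothesis T_le : forall f x, measurable_fun setT f ->
  (`|T f x| <= M%:E * potential leb dist g b al (fun y => `|f y|)%R setT x)%E.
Hypothesis HK : forall (f : V -> R) (N : R),
  measurable_fun setT f -> (forall y, 0 <= f y) -> 0 < N ->
  (forall x r, 0 < r ->
    (\int[leb]_(y in qball dist x r) (f y `^ p)%:E <= (N `^ p * phi x r * r `^ g)%:E)%E) ->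
  forall x0 r, 0 < r ->
  (\int[leb]_(x in qball dist x0 r) potential leb dist g b al f setT x `^ q <=
      (K * N `^ q * phi x0 r * r `^ g)%:E)%E.

(** [M] comes from the domination by the potential; the powers of [v] convert r^g into the volume v
    r^g on both sides. *)
Let A := M * (K * v `^ (q / p) / v) `^ q^-1.

Let A0 : 0 < A.
Proof. by rewrite mulr_gt0 ?powR_gt0// divr_gt0// mulr_gt0 ?powR_gt0. Qed.

Lemma integral_operator_le (f : V -> R) (N : R) x r : measurable_fun setT f -> 0 < N ->
  (morrey_norm rho p (fun x r => phi x r `^ p^-1)%R (EFin \o f) <= N%:E)%E -> 0 < r ->
  (\int[leb]_(y in ellipsoid rho x r) `|T f y| `^ q <=
    ((A * N) `^ q * phi x r * (v * r `^ g))%:E)%E.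
Proof.
move=> mf N0 /(morrey_normP _ p0 phi0 (ltW N0)) H r0.
have mnf : measurable_fun setT (fun y : V => `|f y|) by exact: measurableT_comp.
have N1 : 0 < N * v `^ p^-1 by rewrite mulr_gt0// powR_gt0.
have mE := measurable_ellipsoid rhoP x r.
have pot0 y : (0 <= potential leb dist g b al (fun y => `|f y|)%R setT y)%E by exact: potential_ge0.
have mpot := measurable_potential HS mb al mnf (fun=> normr_ge0 _) measurableT.
apply: (@le_trans _ _ (\int[leb]_(y in ellipsoid rho x r)
    ((M `^ q)%:E * potential leb dist g b al (fun y => `|f y|)%R setT y `^ q))%E).
  apply: le_integral_ge0 => y _; first exact: poweR_ge0.
  apply: le_trans (le_poweR (ltW q0) (abse_ge0 _) (T_le y mf)) _.
  by rewrite poweRM ?lee_fin ?(ltW M0)// poweR_EFin.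
rewrite ge0_integralZl_EFin ?powR_ge0//; last 2 first.
- by move=> y _; exact: poweR_ge0.
- by apply: measurable_funTS; exact: (measurableT_comp (measurable_poweR _) mpot).
have := HK mnf (fun=> normr_ge0 _) N1 _ x r0 => HK'.
apply: le_trans (lee_wpmul2l _ (HK' _)) _.
- by rewrite lee_fin powR_ge0.
- move=> z t t0; have := H z t t0; congr (_ <= _)%E.
  congr EFin; rewrite powRM ?powR_ge0 ?(ltW N0)// -powRrM mulVf ?gt_eqF// powRr1 ?(ltW v0)//.
  by ring.
rewrite -EFinM lee_fin le_eqVlt; apply/orP; left; apply/eqP.
have h0 : 0 <= K * v `^ (q / p) / v by rewrite divr_ge0 ?mulr_ge0 ?powR_ge0 ?(ltW v0) ?(ltW K0).
have AE : A `^ q = M `^ q * (K * v `^ (q / p) / v).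
  by rewrite /A (powRM _ (ltW M0) (powR_ge0 _ _)) -powRrM mulVf ?gt_eqF// powRr1.
have NE : (N * v `^ p^-1) `^ q = N `^ q * v `^ (q / p).
  by rewrite (powRM _ (ltW N0) (powR_ge0 _ _)) -powRrM (mulrC p^-1).
rewrite NE (powRM q (ltW A0) (ltW N0)) AE.
move: (v `^ _) (M `^ _) (N `^ _) (r `^ _) => y1 y2 y3 y4.
by field; rewrite gt_eqF.
Qed.

Lemma morrey_bounded_of_potential :
  morrey_bounded rho T p (fun x r => phi x r `^ p^-1) q (fun x r => phi x r `^ q^-1).
Proof.
exists A => f [[mf _] finf].
have {}mf : measurable_fun setT f by apply/measurable_EFinP.
set nf := morrey_norm _ _ _ _ in finf *.
have nf0 : (0 <= nf)%E.
  apply: le_trans (ereal_sup_ubound _); last by exists (0, 1) => //=.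
  by rewrite mule_ge0 ?Lnorm_ge0// lee_fin mulr_ge0 ?invr_ge0 ?powR_ge0.
have nfE : nf = (fine nf)%:E by rewrite fineK// ge0_fin_numE.
(* The estimates require N > 0 whereas the norm may vanish: take N a little above the norm and let e
   tend to 0. *)
have bound e : 0 < e ->
    (morrey_norm rho q (fun x r => phi x r `^ q^-1)%R (T f) <= (A * (fine nf + e))%:E)%E.
  move=> e0; have N0 : 0 < fine nf + e by rewrite ltr_wpDl// fine_ge0.
  apply/(morrey_normP _ q0 phi0); first by rewrite mulr_ge0 ?(ltW A0) ?(ltW N0).
  move=> x r r0; apply: integral_operator_le => //.
  by rewrite -/nf {1}nfE lee_fin lerDl ltW.
split.
- split; last by apply: le_lt_trans (bound 1 ltr01) _; exact: ltry.
  split; first exact: mT.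
  move=> C /(compact_sub_ellipsoid rhoP)[r r0 Cr].
  apply: le_lt_trans (le_integral_subset _ Cr _) _ => [x _|]; first exact: poweR_ge0.
  have N0 : 0 < fine nf + 1 by rewrite ltr_wpDl// fine_ge0.
  apply: le_lt_trans (integral_operator_le 0 mf N0 _ r0) _; last exact: ltry.
  by rewrite -/nf {1}nfE lee_fin lerDl.
- rewrite nfE -EFinM; apply/lee_addgt0Pr => e e0.
  have eA : 0 < e / A by rewrite divr_gt0.
  by apply: le_trans (bound _ eA) _; rewrite mulrDr mulrCA mulfV ?gt_eqF// mulr1.
Qed.

End morrey_bounded_by_potential.

(** * Conclusion for both commutators *)

Theorem corollary7 (R : realType) (n : nat) (P : 'M[R]_n)
    (rho : 'cV[R]_n -> R) (p q alpha C : R) (b : 'cV[R]_n -> R)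
    (phi : 'cV[R]_n -> R -> R)
    (n_ge2 : (2 <= n)%N)
    (P_eig : eigenvalues_Re_gt0 P)
    (rhoP : quasi_distance P rho)
    (p_gt1 : 1 < p)
    (alpha_gt0 : 0 < alpha)
    (alpha_lt : alpha < \tr P / p)
    (pq : p < q)
    (b_bmo : BMO rho b)
    (phi_gt0 : forall (x : 'cV[R]_n) (t : R), 0 < t -> 0 < phi x t)
    (phi_measurable : measurable_fun
       [set z : 'cV[R]_n * R | 0 < z.2]
       (fun z : 'cV[R]_n * R => phi z.1 z.2))
    (phi_sup : forall (x : 'cV[R]_n) (r : R), 0 < r ->
       (ereal_sup
          [set (t `^ (- \tr P) * (1 + ln (t / r)) `^ p)%:E *
               ess_inf_above t (fun tau => phi x tau * tau `^ (\tr P))%R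
          | t in `]r, +oo[]
        <= (C * phi x r)%:E)%E)
    (phi_int : forall (x : 'cV[R]_n) (r : R), 0 < r ->
       (\int[lebesgue_measure]_(t in `]r, +oo[)
          ((1 + ln (t / r)) * t `^ alpha * phi x t `^ p^-1 / t)%:E
        <= (C * r `^ (- (alpha * p / (q - p))))%:E)%E) :
  morrey_bounded rho (maximal_commutator P rho b alpha)
    p (fun x r => phi x r `^ p^-1) q (fun x r => phi x r `^ q^-1) /\
  morrey_bounded rho (potential_commutator P rho b alpha)
    p (fun x r => phi x r `^ p^-1) q (fun x r => phi x r `^ q^-1).
Proof.
have p0 : 0 < p by apply: lt_trans p_gt1.
have q0 : 0 < q by apply: lt_trans pq.
have g0 : 0 < \tr P.
  by have := lt_trans alpha_gt0 alpha_lt; rewrite pmulr_lgt0// invr_gt0.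
have alg : alpha < \tr P.
  by apply: lt_le_trans alpha_lt _; rewrite ler_pdivrMr// ler_peMr// ltW.
have [k [v [c HS]]] := quasi_distance_space rhoP g0.
have v0 := hs_v HS.
have [[mb _] bfin] := b_bmo.
have {}mb : measurable_fun setT b by apply/measurable_EFinP.
(* The added 1 makes the BMO constant strictly positive even when [b] has norm 0. *)
pose D := `|fine (bmo_norm rho b)| + 1.
have D0 : 0 < D by rewrite ltr_wpDl.
have bD x r : 0 < r -> (\int[@lebesgue_cV R n]_(y in qball (fun x y => rho (x - y))%R x r)
    `|b y - mean rho b x r|%:E <=
    D%:E * @lebesgue_cV R n (qball (fun x y => rho (x - y))%R x r))%E.
  move=> r0; have vr0 : 0 < v * r `^ \tr P by rewrite mulr_gt0// powR_gt0.
  rewrite (hs_volume HS)// -(vol_ellipsoid HS x r0) muleC -lee_pdivrMl; last by rewrite (vol_ellipsoid HS).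
  apply: (@le_trans _ _ (bmo_norm rho b)); first by apply: ereal_sup_ubound; exists (x, r).
  have [h|h] := leP 0%E (bmo_norm rho b); last first.
    by apply: le_trans (ltW h) _; rewrite lee_fin ltW.
  rewrite -[leLHS]fineK ?ge0_fin_numE// lee_fin /D.
  by rewrite ler_wpDr// ler_norm.
(* The growth lemmas are stated for a constant at least 1; enlarging [C] preserves both
   conditions. *)
pose C' := Num.max C 1.
have C'1 : 1 <= C' by rewrite le_max lexx orbT.
have CC' : C <= C' by rewrite le_max lexx.
have bE : alpha * p / (q - p) * (q - p) = alpha * p.
  by rewrite divfK// gt_eqF// subr_gt0.
have Hsup x : growth_sup (\tr P) p C' (phi x).
  move=> r r0; apply: le_trans (phi_sup x r r0) _; rewrite lee_fin ler_wpM2r//.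
  exact/ltW/phi_gt0.
have Hint x r : 0 < r -> (\int[lebesgue_measure]_(t in `]r, +oo[)
    ((1 + ln (t / r)) * t `^ alpha * phi x t `^ p^-1 / t)%:E
    <= (C' * r `^ (- (alpha * p / (q - p))))%:E)%E.
  move=> r0; apply: le_trans (phi_int x r r0) _.
  by rewrite lee_fin ler_wpM2r// powR_ge0.
have [K K0 HK] := potential_morrey HS mb D0 bD p_gt1 pq alpha_gt0 alg bE C'1 phi_gt0 Hsup Hint.
split.
- apply: (morrey_bounded_of_potential rhoP HS mb p0 q0 _ K0 phi_gt0 _ _ HK).
  + exact: (powR_gt0 (- 1 + alpha / \tr P) v0).
  + by move=> f mf; exact: (measurable_maximal_commutator g0 HS mb alg mf).
  + by move=> f x mf; exact: (maximal_commutator_le rhoP g0 HS mb alg _ mf).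
- apply: (morrey_bounded_of_potential rhoP HS mb p0 q0 ltr01 K0 phi_gt0 _ _ HK).
  + by move=> f mf; exact: (measurable_potential_commutator HS _ mb mf).
  + by move=> f x mf; rewrite mul1e; exact: (potential_commutator_le HS _ mb _ mf).
Qed.
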